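(* Let $(W,S)$ be a Coxeter system of type $A_2$ with set of reflections $T$, let $V$ be a reflection faithful representation of $W$ over $\mathbb{R}$, and let $\mathcal{C}$ be the associated category of graded $R$-bimodules generated by the $B_t$, $t\in T$ (defined in the context). Let $$\mathcal{X}:=\{\emptyset\neq A\subseteq W \mid \exists\, t\in T:\ tA=A\}.$$ Then, up to isomorphism and grading shift, the indecomposable objects of $\mathcal{C}$ are exactly the bimodules $R(A)$ for $A\in\mathcal{X}$, together with $R$. In particular, the $\mathbb{Z}[v^{\pm1}]$-algebra $A(W):=\langle\mathcal{C}\rangle$ (the split Grothendieck ring of $\mathcal{C}$, where $v$ acts by the grading shift $(1)$) is free of rank $20$ as a $\mathbb{Z}[v^{\pm1}]$-module.
   Context: Let $(W,S)$ be a Coxeter system, $e$ the identity of $W$, and $T=\bigcup_{w\in W}wSw^{-1}$ its set of reflections. A representation $V$ of $W$ (finite-dimensional, over $\mathbb{R}$) is reflection faithful if it is faithful and, for $w\in W$, the fixed subspace $V^w$ has codimension $1$ in $V$ if and only if $w\in T$. Put $R=\mathcal{O}(V)=S(V^* )$, the ring of polynomial functions on $V$, graded so that $\deg V^*=2$; $W$ acts on $R$, and for $t\in T$, $R^t\subseteq R$ denotes the graded subring of $t$-invariants. For a graded bimodule $M$, $M(n)$ denotes the shifted bimodule with $M(n)_i=M_{n+i}$. Morphisms of graded bimodules are homogeneous of degree $0$. For every $t\in T$ (not only simple reflections) set $B_t:=R\otimes_{R^t}R(1)$, a graded $R$-bimodule. Products of bimodules are tensor products over $R$. The category $\mathcal{C}$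 is the Karoubi envelope of the category of (shifted) tensor products of the $B_t$, $t\in T$; that is, the full subcategory of graded $R$-bimodules whose objects are isomorphic to direct summands of finite direct sums of grading shifts of tensor products $B_{t_1}\otimes_R\cdots\otimes_R B_{t_k}$ ($k\ge 0$, $t_i\in T$; the empty product is $R$). Its split Grothendieck ring $\langle\mathcal{C}\rangle$ has addition induced by $\oplus$ and multiplication induced by $\otimes_R$; it is a $\mathbb{Z}[v^{\pm1}]$-algebra with $v\cdot\langle M\rangle=\langle M(1)\rangle$. For $x\in W$ let $\mathrm{Gr}(x):=\{(xv,v)\mid v\in V\}\subseteq V\times V$. For $A\subseteq W$ let $R(A):=\mathcal{O}\left(\bigcup_{x\in A}\mathrm{Gr}(x)\right)$ be the graded ring of regular functions on this closed subvariety of $V\times V$, viewed as a graded $R$-bimodule via the surjection $R\otimes_{\mathbb{R}}R\cong\mathcal{O}(V\times V)\to R(A)$. *)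

(* Defs.v *)
From HB Require Import structures.
From mathcomp Require Import all_boot all_order all_algebra.
From mathcomp Require Import generic_quotient fraction.
From mathcomp Require Import boolp classical_sets functions cardinality fsbigop.
From mathcomp Require Import reals.

Set Implicit Arguments.
Unset Strict Implicit.
Unset Printing Implicit Defensive.

Import Order.TTheory GRing.Theory Num.Theory.

Local Open Scope classical_set_scope.
Local Open Scope ring_scope.

Section Coxeter.
Local Open Scope group_scope.

Variables (W : groupType) (S : set W).

(* [W] is presented by the generators [S] and the relations
   (s t)^m(s,t) = 1, where m(s,t) is the order of s t in [W] (no relation
   when the order is infinite); m(s,s) = 1 is the condition s^2 = 1.  *)
Definition coxeter_system : Prop :=
  (forall s, S s -> s != 1 /\ s * s = 1) /\
  forall (G : groupType) (f : W -> G),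
    (forall s t, S s -> S t ->
       forall n, (s * t) ^+ n = 1 -> (f s * f t) ^+ n = 1) ->
    exists! phi : W -> G,
      (forall x y, phi (x * y) = phi x * phi y) /\ (forall s, S s -> phi s = f s).

Definition type_A2 : Prop :=
  exists s t : W, [/\ S = [set s; t], s != t,
    (s * t) ^+ 3 = 1 & forall k, (0 < k < 3)%N -> (s * t) ^+ k != 1].

Definition reflections : set W :=
  [set x | exists w s, S s /\ x = w * s * w^-1].

Definition reflection_stable : set (set W) :=
  [set A | A !=set0 /\ exists2 t, reflections t & [set t * a | a in A] = A].

End Coxeter.

Section Grading.
Variables (M : zmodType) (gr : int -> set M).

(* [f] is the family of homogeneous components of [m]. *)
Definition components (m : M) (f : int -> M) : Prop :=
  [/\ forall i, gr i (f i), finite_set [set i | f i != 0]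
    & m = \sum_(i \in [set: int]) f i].

Definition is_grading : Prop :=
  (forall i, gr i 0 /\ forall x y, gr i x -> gr i y -> gr i (x - y)) /\
  forall m, exists! f, components m f.

End Grading.

Section GradingTheory.
Variables (M : zmodType) (gr : int -> set M).

Lemma fsbig_int (r : seq int) (f : int -> M) :
  uniq r -> (forall i, i \notin r -> f i = 0) ->
  \sum_(i \in [set: int]) f i = \sum_(i <- r) f i.
Proof.
move=> ur h0; rewrite [RHS]fsbig_seq // [RHS](fsbig_widen _ setT) //.
by move=> i [_ /negP/h0].
Qed.

Lemma componentsP m f : components gr m f <->
  (forall i, gr i (f i)) /\ exists r : seq int,
    [/\ uniq r, forall i, i \notin r -> f i = 0 & m = \sum_(i <- r) f i].
Proof.
split=> [[h fin ->]|[h [r [ur h0 ->]]]].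
  split=> //; have /finite_seqP[r rE] := fin.
  have h0 i : i \notin undup r -> f i = 0.
    rewrite mem_undup => ir; apply/eqP/negP => /negP fi.
    have : [set i | f i != 0] i by [].
    by rewrite rE /= (negPf ir).
  by exists (undup r); split; rewrite ?undup_uniq // -fsbig_int ?undup_uniq.
split=> //; last by rewrite -fsbig_int.
apply: (@sub_finite_set _ _ [set` r]); last exact: finite_seq.
by move=> i /=; apply: contraNT => ir; rewrite h0.
Qed.

Hypothesis gr_sub :
  forall i, gr i 0 /\ forall x y, gr i x -> gr i y -> gr i (x - y).

Lemma gr_opp i x : gr i x -> gr i (- x).
Proof. by have [h0 hB] := gr_sub i; rewrite -sub0r; exact: hB. Qed.

Lemma gr_add i x y : gr i x -> gr i y -> gr i (x + y).
Proof.
by have [_ hB] := gr_sub i; rewrite -[y]opprK => hx /gr_opp; rewrite opprK; exact: hB.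
Qed.

Lemma gr_sum i (I : Type) (r : seq I) (P : pred I) (F : I -> M) :
  (forall j, P j -> gr i (F j)) -> gr i (\sum_(j <- r | P j) F j).
Proof.
move=> h; elim/big_ind: _ => //; [by case: (gr_sub i)|exact: gr_add].
Qed.

Lemma grading_proj (pr : int -> M -> M) :
  (forall i, {morph pr i : x y / x + y}) ->
  (forall i j x, gr i x -> pr j x = if j == i then x else 0) ->
  (forall m, exists f, components gr m f) ->
  is_grading gr.
Proof.
move=> prD prg ex; split=> // m; have [f hf] := ex m; exists f; split=> // g hg.
have key h : components gr m h -> forall j, h j = pr j m.
  move=> /componentsP[hh [r [ur h0 ->]]] j.
  have pr0 : pr j 0 = 0 by apply: (@addIr _ (pr j 0)); rewrite -prD !add0r.
  rewrite (big_morph (pr j) (prD j) pr0).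
  under eq_bigr => i _ do rewrite (prg i) //.
  case: (boolP (j \in r)) => jr.
    rewrite (bigD1_seq j) //= eqxx big1 ?addr0 // => i ij.
    by rewrite eq_sym (negPf ij).
  rewrite h0 // big_seq big1 // => i ir.
  by case: eqP => // ji; rewrite -ji (negPf jr) in ir.
by apply/funext => j; rewrite (key f) ?(key g).
Qed.

Lemma grading_ex :
  (forall m, exists r : seq (int * M),
      (forall p, p \in r -> gr p.1 p.2) /\ m = \sum_(p <- r) p.2) ->
  forall m, exists f, components gr m f.
Proof.
move=> h m; have [r [hr ->]] := h m.
exists (fun i => \sum_(p <- r | p.1 == i) p.2); apply/componentsP; split.
  by move=> i; rewrite big_seq_cond; apply: gr_sum => p /andP[/hr + /eqP <-].
exists (undup [seq p.1 | p <- r]); split; first exact: undup_uniq.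
  move=> i; rewrite mem_undup => ir; rewrite big_seq_cond big1 // => p /andP[pr /eqP pi].
  by case/negP: ir; apply/mapP; exists p.
rewrite (exchange_big_dep xpredT) //= big_seq [RHS]big_seq; apply: eq_bigr => p pr.
rewrite big_mkcond (bigD1_seq p.1) ?undup_uniq //=; last first.
  by rewrite mem_undup; apply/mapP; exists p.
rewrite eqxx big1 ?addr0 // => i ip; by rewrite eq_sym (negPf ip).
Qed.
End GradingTheory.

#[local] Obligation Tactic := idtac.

Section Component.
Variables (M : zmodType) (gr : int -> set M) (grM : is_grading gr).

Definition component (i : int) (m : M) : M := sval (cid (grM.2 m)) i.

Lemma component_spec m : components gr m (component ^~ m).
Proof. exact: (svalP (cid (grM.2 m))).1. Qed.

Lemma component_uniq m f : components gr m f -> forall i, component i m = f i.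
Proof. by move=> hf i; rewrite /component ((svalP (cid (grM.2 m))).2 f hf). Qed.

Lemma componentD i : {morph component i : x y / x + y}.
Proof.
move=> x y; apply: (component_uniq (f := fun i => component i x + component i y)).
have [hx [r [ur r0 rE]]] := (componentsP _ _ _).1 (component_spec x).
have [hy [s [us s0 sE]]] := (componentsP _ _ _).1 (component_spec y).
have sumE (t : seq int) (f : int -> M) (u : seq int) : uniq t -> uniq u ->
    {subset t <= u} -> (forall i, i \notin t -> f i = 0) ->
    \sum_(i <- t) f i = \sum_(i <- u) f i.
  move=> ut uu tu f0; rewrite [RHS](bigID (mem t)) /= [X in _ = _ + X]big1 ?addr0 //.
  rewrite -[RHS]big_filter; apply: perm_big; apply: uniq_perm => //.
    exact: filter_uniq.
  by move=> j; rewrite mem_filter; case: (boolP (j \in t)) => // /tu ->.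
apply/componentsP; split; first by move=> j; apply: gr_add; [exact: grM.1| |].
exists (undup (r ++ s)); split; first exact: undup_uniq.
  move=> j; rewrite mem_undup mem_cat negb_or => /andP[jr js].
  by rewrite r0 // s0 // addr0.
rewrite big_split /= {1}rE {1}sE; congr (_ + _); apply: sumE => //;
  rewrite ?undup_uniq // => j jr; rewrite mem_undup mem_cat jr ?orbT //.
Qed.

Lemma component0 i : component i 0 = 0.
Proof. by apply: (@addIr _ (component i 0)); rewrite -componentD !add0r. Qed.

Lemma component_sum i (I : Type) (r : seq I) (P : pred I) (F : I -> M) :
  component i (\sum_(j <- r | P j) F j) = \sum_(j <- r | P j) component i (F j).
Proof. exact: (big_morph _ (componentD i) (component0 i)). Qed.

Lemma component_hom i j m : gr i m -> component j m = if j == i then m else 0.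
Proof.
move=> im; apply: (component_uniq (f := fun j => if j == i then m else 0)).
apply/componentsP; split.
  by move=> k; case: eqP => [->//|_]; case: (grM.1 k).
exists [:: i]; split=> //; first by move=> k; rewrite inE => /negPf ->.
by rewrite big_seq1 eqxx.
Qed.

Lemma component_gr i m : gr i (component i m).
Proof. by case: (component_spec m). Qed.

Lemma component_sumE m : exists2 r : seq int, uniq r &
  forall s, uniq s -> {subset r <= s} -> m = \sum_(i <- s) component i m.
Proof.
have [_ [r [ur r0 rE]]] := (componentsP _ _ _).1 (component_spec m).
exists r => // s us rs; rewrite [RHS](bigID (mem r)) /= [X in _ = _ + X]big1 ?addr0 //.
rewrite {1}rE -[RHS]big_filter; apply: perm_big; apply: uniq_perm => //.
  exact: filter_uniq.
by move=> j; rewrite mem_filter; case: (boolP (j \in r)) => // /rs ->.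
Qed.

Lemma component_supp m : exists r : seq int,
  [/\ uniq r, forall i, i \notin r -> component i m = 0
    & m = \sum_(i <- r) component i m].
Proof. exact: ((componentsP _ _ _).1 (component_spec m)).2. Qed.

End Component.

Record gradedRing := GradedRing {
  gring_sort :> comPzRingType;
  gring_deg : int -> set gring_sort;
  gring_grading : is_grading gring_deg;
  gring_deg1 : gring_deg 0 1;
  gring_degM : forall i j a b, gring_deg i a -> gring_deg j b -> gring_deg (i + j) (a * b)
}.

Record gradedSubring (R : gradedRing) := GradedSubring {
  gsub_set :> set R;
  gsub1 : gsub_set 1;
  gsubB : forall a b, gsub_set a -> gsub_set b -> gsub_set (a - b);
  gsubM : forall a b, gsub_set a -> gsub_set b -> gsub_set (a * b);
  gsub_component : forall i a, gsub_set a -> gsub_set (component (gring_grading R) i a)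
}.

Definition full_subring (R : gradedRing) : gradedSubring R :=
  @GradedSubring R setT I (fun _ _ _ _ => I) (fun _ _ _ _ => I) (fun _ _ _ => I).

Section GradedBimodule.
Variable R : gradedRing.

Record gbimod := Gbimod {
  gbimod_sort :> zmodType;
  lact : R -> gbimod_sort -> gbimod_sort;
  ract : gbimod_sort -> R -> gbimod_sort;
  gdeg : int -> set gbimod_sort;
  lactDl : forall m, {morph lact ^~ m : a b / a + b};
  lactDr : forall a, {morph lact a : m n / m + n};
  lact1 : forall m, lact 1 m = m;
  lactM : forall a b m, lact (a * b) m = lact a (lact b m);
  ractDl : forall a, {morph ract ^~ a : m n / m + n};
  ractDr : forall m, {morph ract m : a b / a + b};
  ract1 : forall m, ract m 1 = m;
  ractM : forall m a b, ract m (a * b) = ract (ract m a) b;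
  lractA : forall a m b, lact a (ract m b) = ract (lact a m) b;
  gdeg_grading : is_grading gdeg;
  gdeg_lact : forall i j a m, gring_deg i a -> gdeg j m -> gdeg (i + j) (lact a m);
  gdeg_ract : forall i j m a, gdeg i m -> gring_deg j a -> gdeg (i + j) (ract m a)
}.

Definition gmorphism (M N : gbimod) (f : {additive M -> N}) : Prop :=
  [/\ forall a m, f (lact a m) = lact a (f m),
      forall m a, f (ract m a) = ract (f m) a
    & forall i m, gdeg i m -> gdeg i (f m)].

Definition giso (M N : gbimod) : Prop :=
  exists (f : {additive M -> N}) (g : {additive N -> M}),
    [/\ gmorphism f, gmorphism g, cancel f g & cancel g f].

Program Definition regular_gbimod : gbimod :=
  @Gbimod R (fun a m => a * m) (fun m a => m * a) (@gring_deg R)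
    _ _ _ _ _ _ _ _ _ _ _ _.
Next Obligation. by move=> m a b; rewrite mulrDl. Qed.
Next Obligation. by move=> a m n; rewrite mulrDr. Qed.
Next Obligation. by move=> m /=; rewrite mul1r. Qed.
Next Obligation. by move=> a b m /=; rewrite mulrA. Qed.
Next Obligation. by move=> a m n; rewrite mulrDl. Qed.
Next Obligation. by move=> m a b; rewrite mulrDr. Qed.
Next Obligation. by move=> m /=; rewrite mulr1. Qed.
Next Obligation. by move=> m a b /=; rewrite mulrA. Qed.
Next Obligation. by move=> a m b /=; rewrite mulrA. Qed.
Next Obligation. exact: gring_grading. Qed.
Next Obligation. exact: gring_degM. Qed.
Next Obligation. exact: gring_degM. Qed.

Lemma shift_grading (M : gbimod) (n : int) :
  is_grading (fun i => @gdeg M (n + i)).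
Proof.
have [gs _] := gdeg_grading M.
apply: (@grading_proj _ _ _ (fun i => component (gdeg_grading M) (n + i))).
- by move=> i; exact: gs.
- by move=> i x y; rewrite componentD.
- move=> i j x hx; rewrite (component_hom _ _ hx).
  by rewrite (inj_eq (addrI n)).
- apply: grading_ex => [i|m]; first exact: gs.
  have [r ur rE] := component_sumE (gdeg_grading M) m.
  exists [seq (i - n, component (gdeg_grading M) i m) | i <- r]; split.
    by move=> p /mapP[i _ ->] /=; rewrite addrC subrK; exact: component_gr.
  by rewrite big_map /= -rE.
Qed.

Program Definition shift (M : gbimod) (n : int) : gbimod :=
  @Gbimod M (@lact M) (@ract M) (fun i => @gdeg M (n + i))
    (@lactDl M) (@lactDr M) (@lact1 M) (@lactM M) (@ractDl M) (@ractDr M)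
    (@ract1 M) (@ractM M) (@lractA M) (shift_grading M n) _ _.
Next Obligation. by move=> M n i j a m ha hm /=; rewrite addrCA; exact: gdeg_lact. Qed.
Next Obligation. by move=> M n i j m a hm ha /=; rewrite addrA; exact: gdeg_ract. Qed.

Section DirectSum.
Variables M N : gbimod.

Definition dsum_deg (i : int) : set (M * N)%type :=
  [set x | gdeg i x.1 /\ gdeg i x.2].

Lemma dsum_grading : is_grading dsum_deg.
Proof.
have [gM _] := gdeg_grading M; have [gN _] := gdeg_grading N.
have gs i : dsum_deg i 0 /\
    forall x y, dsum_deg i x -> dsum_deg i y -> dsum_deg i (x - y).
  split=> [|x y [x1 x2] [y1 y2]]; first by split; [case: (gM i)|case: (gN i)].
  by split; [apply: (gM i).2|apply: (gN i).2].
apply: (@grading_proj _ _ _ (fun i x =>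
  (component (gdeg_grading M) i x.1, component (gdeg_grading N) i x.2))) => //.
- by move=> i x y /=; rewrite !componentD.
- move=> i j [x y] [/= hx hy]; rewrite (component_hom _ _ hx) (component_hom _ _ hy).
  by case: ifP.
- apply: grading_ex => [//|[m n]].
  have [r ur rE] := component_sumE (gdeg_grading M) m.
  have [s us sE] := component_sumE (gdeg_grading N) n.
  exists ([seq (i, (component (gdeg_grading M) i m, 0)) | i <- r] ++
          [seq (i, (0, component (gdeg_grading N) i n)) | i <- s]); split.
    move=> p; rewrite mem_cat => /orP[] /mapP[i _ ->] /=; split=> /=;
      by [exact: component_gr|case: (gM i)|case: (gN i)].
  rewrite big_cat !big_map /=.
  have -> : \sum_(i <- r) (component (gdeg_grading M) i m, 0 : N) = (m, 0).
    rewrite [in RHS](rE r) //; elim: r {ur rE} => [|i r IH]; rewrite ?big_nil // !big_cons IH.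
    by rewrite /GRing.add /= /add_pair /= addr0.
  have -> : \sum_(i <- s) (0 : M, component (gdeg_grading N) i n) = (0, n).
    rewrite [in RHS](sE s) //; elim: s {us sE} => [|i s IH]; rewrite ?big_nil // !big_cons IH.
    by rewrite /GRing.add /= /add_pair /= addr0.
  by rewrite /GRing.add /= /add_pair /= addr0 add0r.
Qed.

Program Definition dsum : gbimod :=
  @Gbimod (M * N)%type (fun a x => (lact a x.1, lact a x.2))
    (fun x a => (ract x.1 a, ract x.2 a)) dsum_deg
    _ _ _ _ _ _ _ _ _ dsum_grading _ _.
Next Obligation. by move=> x a b /=; rewrite !lactDl. Qed.
Next Obligation. by move=> a x y /=; rewrite !lactDr. Qed.
Next Obligation. by move=> [m n] /=; rewrite !lact1. Qed.
Next Obligation. by move=> a b x /=; rewrite !lactM. Qed.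
Next Obligation. by move=> a x y /=; rewrite !ractDl. Qed.
Next Obligation. by move=> x a b /=; rewrite !ractDr. Qed.
Next Obligation. by move=> [m n] /=; rewrite !ract1. Qed.
Next Obligation. by move=> x a b /=; rewrite !ractM. Qed.
Next Obligation. by move=> a x b /=; rewrite !lractA. Qed.
Next Obligation. by move=> i j a x ha [h1 h2]; split; exact: gdeg_lact. Qed.
Next Obligation. by move=> i j x a [h1 h2] ha; split; exact: gdeg_ract. Qed.

End DirectSum.

Lemma zero_grading : is_grading (fun=> [set: 'rV[int]_0]).
Proof.
split=> // m; exists (fun=> 0); split=> [|f _]; last first.
  by apply/funext => i; rewrite [LHS]thinmx0 [RHS]thinmx0.
apply/componentsP; split=> //; exists [::]; split=> //.
by rewrite big_nil; exact: thinmx0.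
Qed.

Program Definition zero_gbimod : gbimod :=
  @Gbimod 'rV[int]_0 (fun _ m => m) (fun m _ => m) (fun=> setT)
    _ _ _ _ _ _ _ _ _ zero_grading _ _.
Next Obligation. by move=> m a b; rewrite [LHS]thinmx0 [RHS]thinmx0. Qed.
Solve Obligations with by [].
Next Obligation. by move=> m a b; rewrite [LHS]thinmx0 [RHS]thinmx0. Qed.

End GradedBimodule.

(* The tensor product of M and N over a graded subring S of R. Its elements
   are the formal sums of pairs (m, n), two of them being identified when all
   S-balanced maps into abelian groups agree on them: this is the quotient by
   the usual bilinear and S-balancing relations, and [tens_balanced],
   [tensor_liftD], [tensor_lift_tens] and [tensor_ext] give the universal
   property. Formal negatives are not needed as (- m, n) is the opposite of
   (m, n).  *)
Section Tensor.
Variables (R : gradedRing) (S : gradedSubring R) (M N : gbimod R).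

Record balanced (X : zmodType) (b : M -> N -> X) : Prop := Balanced {
  balancedDl : forall n, {morph b ^~ n : m m' / m + m'};
  balancedDr : forall m, {morph b m : n n' / n + n'};
  balancedA : forall m s n, gsub_set S s -> b (ract m s) n = b m (lact s n)
}.

Definition formal_sum := seq (M * N).

Definition eval_formal (X : zmodType) (b : M -> N -> X) (l : formal_sum) : X :=
  \sum_(p <- l) b p.1 p.2.

Definition tensor_eq (l l' : formal_sum) : bool :=
  `[< forall (X : zmodType) (b : M -> N -> X), balanced b ->
        eval_formal b l = eval_formal b l' >].

Lemma tensor_eq_refl : reflexive tensor_eq.
Proof. by move=> l; apply/asboolP. Qed.
Lemma tensor_eq_sym : symmetric tensor_eq.
Proof. by move=> l l'; apply/asboolP/asboolP => h X b hb; rewrite h. Qed.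
Lemma tensor_eq_trans : transitive tensor_eq.
Proof.
by move=> l l' l'' /asboolP h /asboolP h'; apply/asboolP => X b hb; rewrite h // h'.
Qed.

Canonical tensor_equiv : equiv_rel formal_sum :=
  EquivRel tensor_eq tensor_eq_refl tensor_eq_sym tensor_eq_trans.

Definition tensor_sort := {eq_quot tensor_equiv}%qT.
HB.instance Definition _ := Choice.on tensor_sort.
HB.instance Definition _ := EqQuotient.on tensor_sort.

Definition tpi (l : formal_sum) : tensor_sort := (\pi_tensor_sort l)%qT.

Lemma tpi_eq l l' : tpi l = tpi l' <->
  forall (X : zmodType) (b : M -> N -> X), balanced b ->
    eval_formal b l = eval_formal b l'.
Proof. by split=> [/eqmodP/asboolP|h]; last by apply/eqmodP/asboolP. Qed.

Lemma tpi_repr x : tpi (repr x) = x. Proof. exact: reprK. Qed.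

Lemma repr_tpi l (X : zmodType) (b : M -> N -> X) : balanced b ->
  eval_formal b (repr (tpi l)) = eval_formal b l.
Proof. by move: X b; apply/tpi_eq; rewrite tpi_repr. Qed.

Lemma eval_formal_cat (X : zmodType) (b : M -> N -> X) l l' :
  eval_formal b (l ++ l') = eval_formal b l + eval_formal b l'.
Proof. exact: big_cat. Qed.

Lemma balanced0l (X : zmodType) (b : M -> N -> X) n : balanced b -> b 0 n = 0.
Proof. by move=> hb; apply: (@addIr _ (b 0 n)); rewrite -(balancedDl hb) !add0r. Qed.

Lemma balanced0r (X : zmodType) (b : M -> N -> X) m : balanced b -> b m 0 = 0.
Proof. by move=> hb; apply: (@addIr _ (b m 0)); rewrite -(balancedDr hb) !add0r. Qed.

Definition tensor_add (x y : tensor_sort) := tpi (repr x ++ repr y).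
Definition tensor_opp (x : tensor_sort) := tpi [seq (- p.1, p.2) | p <- repr x].

Lemma tensor_addE l l' : tensor_add (tpi l) (tpi l') = tpi (l ++ l').
Proof. by apply/tpi_eq => X b hb; rewrite !eval_formal_cat !repr_tpi. Qed.

Lemma tensor_addA : associative tensor_add.
Proof.
move=> x y z; rewrite -[x]tpi_repr -[y]tpi_repr -[z]tpi_repr !tensor_addE.
by rewrite catA.
Qed.
Lemma tensor_addC : commutative tensor_add.
Proof. by move=> x y; apply/tpi_eq => X b hb; rewrite !eval_formal_cat addrC. Qed.
Lemma tensor_add0 : left_id (tpi [::]) tensor_add.
Proof. by move=> x; rewrite -[x in LHS]tpi_repr tensor_addE /= tpi_repr. Qed.
Lemma tensor_addN : left_inverse (tpi [::]) tensor_opp tensor_add.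
Proof.
move=> x; rewrite /tensor_opp.
rewrite -[X in tensor_add _ X]tpi_repr tensor_addE.
apply/tpi_eq => X b hb; rewrite eval_formal_cat /eval_formal big_map big_nil -big_split /=.
by rewrite big1 // => p _; rewrite -(balancedDl hb) addNr balanced0l.
Qed.

HB.instance Definition _ := GRing.isZmodule.Build tensor_sort
  tensor_addA tensor_addC tensor_add0 tensor_addN.

Definition tens (m : M) (n : N) : tensor_sort := tpi [:: (m, n)].

Lemma tpi_sum l : tpi l = \sum_(p <- l) tens p.1 p.2.
Proof.
elim: l => [|[m n] l IH]; first by rewrite big_nil.
by rewrite big_cons -IH /= [RHS]tensor_addE.
Qed.

Lemma tensorE x : x = \sum_(p <- repr x) tens p.1 p.2.
Proof. by rewrite -tpi_sum tpi_repr. Qed.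

Lemma tens_balanced : balanced tens.
Proof.
split=> [n m m'|m n n'|m s n Ss].
- rewrite [RHS]tensor_addE; apply/tpi_eq => X b hb.
  by rewrite /eval_formal !big_cons !big_nil !addr0 /= (balancedDl hb).
- rewrite [RHS]tensor_addE; apply/tpi_eq => X b hb.
  by rewrite /eval_formal !big_cons !big_nil !addr0 /= (balancedDr hb).
- apply/tpi_eq => X b hb.
  by rewrite /eval_formal !big_cons !big_nil !addr0 /= (balancedA hb).
Qed.

Definition tensor_lift (X : zmodType) (b : M -> N -> X) (x : tensor_sort) : X :=
  eval_formal b (repr x).

Lemma tensor_liftD (X : zmodType) (b : M -> N -> X) : balanced b ->
  {morph tensor_lift b : x y / x + y}.
Proof. by move=> hb x y; rewrite /tensor_lift -eval_formal_cat repr_tpi. Qed.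

Lemma tensor_lift_tens (X : zmodType) (b : M -> N -> X) m n : balanced b ->
  tensor_lift b (tens m n) = b m n.
Proof. by move=> hb; rewrite /tensor_lift repr_tpi // /eval_formal big_seq1. Qed.

Lemma tensor_ind (P : tensor_sort -> Prop) :
  P 0 -> (forall m n x, P x -> P (tens m n + x)) -> forall x, P x.
Proof.
move=> P0 PS x; rewrite [x]tensorE; elim: (repr x) => [|p l IH].
  by rewrite big_nil.
by rewrite big_cons; exact: PS.
Qed.

Lemma tensor_ext (X : zmodType) (f g : tensor_sort -> X) :
  {morph f : x y / x + y} -> {morph g : x y / x + y} ->
  (forall m n, f (tens m n) = g (tens m n)) -> f =1 g.
Proof.
move=> fD gD fg; apply: tensor_ind => [|m n x fgx]; last by rewrite fD gD fg fgx.
have -> : f 0 = 0 by apply: (@addIr _ (f 0)); rewrite -fD !add0r.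
by apply: (@addIr _ (g 0)); rewrite -gD !add0r.
Qed.

Definition tensor_lact (a : R) : tensor_sort -> tensor_sort :=
  tensor_lift (fun m n => tens (lact a m) n).
Definition tensor_ract (x : tensor_sort) (a : R) : tensor_sort :=
  tensor_lift (fun m n => tens m (ract n a)) x.

Lemma lact_balanced a : balanced (fun m n => tens (lact a m) n).
Proof.
split=> [n m m'|m n n'|m s n Ss].
- by rewrite lactDr (balancedDl tens_balanced).
- by rewrite (balancedDr tens_balanced).
- by rewrite lractA (balancedA tens_balanced).
Qed.

Lemma ract_balanced a : balanced (fun m n => tens m (ract n a)).
Proof.
split=> [n m m'|m n n'|m s n Ss].
- by rewrite (balancedDl tens_balanced).
- by rewrite ractDl (balancedDr tens_balanced).
- by rewrite -lractA (balancedA tens_balanced).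
Qed.

Lemma tensor_lactD a : {morph tensor_lact a : x y / x + y}.
Proof. exact/tensor_liftD/lact_balanced. Qed.
Lemma tensor_ractD a : {morph tensor_ract ^~ a : x y / x + y}.
Proof. exact/tensor_liftD/ract_balanced. Qed.
Lemma tensor_lactE a m n : tensor_lact a (tens m n) = tens (lact a m) n.
Proof. exact/tensor_lift_tens/lact_balanced. Qed.
Lemma tensor_ractE a m n : tensor_ract (tens m n) a = tens m (ract n a).
Proof. exact/tensor_lift_tens/ract_balanced. Qed.

Definition tensor_deg (k : int) : set tensor_sort :=
  [set x | exists l : seq (M * N),
     (forall p, p \in l -> exists i j, [/\ gdeg i p.1, gdeg j p.2 & i + j = k]) /\
     x = \sum_(p <- l) tens p.1 p.2].

Lemma tensor_deg_tens i j m n : gdeg i m -> gdeg j n -> tensor_deg (i + j) (tens m n).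
Proof.
move=> hm hn; exists [:: (m, n)]; rewrite big_seq1; split=> // p.
by rewrite inE => /eqP ->; exists i, j.
Qed.

Lemma tensor_deg_sub k : tensor_deg k 0 /\
  forall x y, tensor_deg k x -> tensor_deg k y -> tensor_deg k (x - y).
Proof.
split=> [|x y [l [hl ->]] [l' [hl' ->]]]; first by exists [::]; rewrite big_nil.
exists (l ++ [seq (- p.1, p.2) | p <- l']); split.
  move=> p; rewrite mem_cat => /orP[/hl//|/mapP[q /hl'[i [j [h1 h2 h3]]] ->]].
  by exists i, j; split=> //=; apply: gr_opp h1; exact: (gdeg_grading M).1.
rewrite big_cat big_map /= -sumrN; congr (_ + _); apply: eq_bigr => p _.
apply/eqP; rewrite eq_sym -addr_eq0 -(balancedDl tens_balanced) addNr.
by rewrite (balanced0l _ tens_balanced).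
Qed.

Let cM := component (gdeg_grading M).
Let cN := component (gdeg_grading N).

Let hproj (k : int) (m : M) (n : N) : tensor_sort :=
  \sum_(i \in [set: int]) tens (cM i m) (cN (k - i) n).

Let hprojDl k n : {morph hproj k ^~ n : m m' / m + m'}.
Proof.
move=> m m'; have [r [ur r0 _]] := component_supp (gdeg_grading M) m.
have [s [us s0 _]] := component_supp (gdeg_grading M) m'.
have e q : (forall i, i \notin undup (r ++ s) -> cM i q = 0) ->
    hproj k q n = \sum_(i <- undup (r ++ s)) tens (cM i q) (cN (k - i) n).
  move=> q0; apply: fsbig_int; first exact: undup_uniq.
  by move=> i /q0 ->; rewrite (balanced0l _ tens_balanced).
have z i : i \notin undup (r ++ s) -> cM i m = 0 /\ cM i m' = 0.
  by rewrite mem_undup mem_cat negb_or => /andP[/r0 ? /s0 ?].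
rewrite !e -?big_split /=.
- apply: eq_bigr => i _.
  by rewrite /cM componentD (balancedDl tens_balanced).
- by move=> i /z[].
- by move=> i /z[].
- by move=> i /z[h h']; rewrite /cM componentD -/cM h h' addr0.
Qed.

Let hprojDr k m : {morph hproj k m : n n' / n + n'}.
Proof.
move=> n n'; have [r [ur r0 _]] := component_supp (gdeg_grading M) m.
rewrite /hproj !(fsbig_int ur) -?big_split /=.
- apply: eq_bigr => i _.
  by rewrite /cN componentD (balancedDr tens_balanced).
- by move=> i /r0 h; rewrite /cM h (balanced0l _ tens_balanced).
- by move=> i /r0 h; rewrite /cM h (balanced0l _ tens_balanced).
- by move=> i /r0 h; rewrite /cM h (balanced0l _ tens_balanced).
Qed.

Let hproj_hom k i j m n : gdeg i m -> gdeg j n ->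
  hproj k m n = if k == i + j then tens m n else 0.
Proof.
move=> hm hn; rewrite /hproj (@fsbig_int _ [:: i]) //; last first.
  move=> l; rewrite inE => /negPf li.
  by rewrite /cM (component_hom _ _ hm) li (balanced0l _ tens_balanced).
rewrite big_seq1 /cM /cN (component_hom _ _ hm) (component_hom _ _ hn) eqxx.
rewrite subr_eq [j + i]addrC; case: ifP => // _.
exact: balanced0r tens_balanced.
Qed.

Let bigM (I : Type) (X : zmodType) (Y : zmodType) (f : X -> Y) (r : seq I) F :
  {morph f : x y / x + y} -> f (\sum_(i <- r) F i) = \sum_(i <- r) f (F i).
Proof.
move=> fD; apply: (big_morph f fD).
by apply: (@addIr _ (f 0)); rewrite -fD !add0r.
Qed.

Let hproj_balanced k : balanced (hproj k).
Proof.
split; [exact: hprojDl|exact: hprojDr|move=> m s n Ss].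
have [rm [_ _ mE]] := component_supp (gdeg_grading M) m.
have [rn [_ _ nE]] := component_supp (gdeg_grading N) n.
have [rs [_ _ sE]] := component_supp (gring_grading R) s.
rewrite mE (bigM _ _ (ractDl s)) (bigM _ _ (hprojDl k n)) (bigM _ _ (hprojDl k _)).
apply: eq_bigr => i _.
rewrite {1}sE (bigM _ _ (ractDr _)) (bigM _ _ (hprojDl k n)).
rewrite [in RHS]sE (bigM _ _ (lactDl _)) (bigM _ _ (hprojDr k _)).
apply: eq_bigr => l _.
rewrite nE (bigM _ _ (hprojDr k _)) (bigM _ _ (lactDr _)) (bigM _ _ (hprojDr k _)).
apply: eq_bigr => j _.
have hm := component_gr (gdeg_grading M) i m.
have hs := component_gr (gring_grading R) l s.
have hn := component_gr (gdeg_grading N) j n.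
rewrite (hproj_hom _ (gdeg_ract hm hs) hn) (hproj_hom _ hm (gdeg_lact hs hn)) addrA.
by rewrite (balancedA tens_balanced) //; exact: gsub_component.
Qed.

Lemma tensor_grading : is_grading tensor_deg.
Proof.
apply: (@grading_proj _ _ _ (fun k => tensor_lift (hproj k))).
- exact: tensor_deg_sub.
- by move=> k; exact/tensor_liftD/hproj_balanced.
- move=> k k' x [l [hl ->]].
  rewrite (bigM _ _ (tensor_liftD (hproj_balanced k'))) big_seq.
  rewrite [in RHS]big_seq; case: ifPn => [/eqP ->|kk].
    apply: eq_bigr => p /hl[i [j [hi hj <-]]].
    by rewrite (tensor_lift_tens _ _ (hproj_balanced _)) (hproj_hom _ hi hj) eqxx.
  apply: big1 => p /hl[i [j [hi hj ij]]].
  by rewrite (tensor_lift_tens _ _ (hproj_balanced _)) (hproj_hom _ hi hj) ij (negPf kk).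
- apply: grading_ex; first exact: tensor_deg_sub.
  apply: tensor_ind => [|m n x [r [hr ->]]]; first by exists [::]; rewrite big_nil.
  have [rm [_ _ mE]] := component_supp (gdeg_grading M) m.
  have [rn [_ _ nE]] := component_supp (gdeg_grading N) n.
  exists ([seq (i + j, tens (cM i m) (cN j n)) | i <- rm, j <- rn] ++ r); split.
    move=> p; rewrite mem_cat => /orP[/allpairsP[[i j] [_ _ ->]]|/hr//].
    by apply: tensor_deg_tens; exact: component_gr.
  rewrite big_cat; congr (_ + _) => /=.
  rewrite big_allpairs_dep {1}mE (bigM _ _ (balancedDl tens_balanced n)).
  apply: eq_bigr => i _ /=.
  by rewrite {1}nE (bigM _ _ (balancedDr tens_balanced _)).
Qed.

Program Definition tensor : gbimod R :=
  @Gbimod R tensor_sort tensor_lact tensor_ract tensor_deg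
    _ tensor_lactD _ _ tensor_ractD _ _ _ _ tensor_grading _ _.
Next Obligation.
move=> x a b /=; move: x; apply: tensor_ext => [||m n].
- exact: tensor_lactD.
- by move=> x y; rewrite !tensor_lactD addrACA.
- by rewrite !tensor_lactE lactDl (balancedDl tens_balanced).
Qed.
Next Obligation.
apply: tensor_ext => [||m n]; [exact: tensor_lactD| by []|].
by rewrite tensor_lactE lact1.
Qed.
Next Obligation.
move=> a b; apply: tensor_ext => [|x y|m n]; first exact: tensor_lactD.
  by rewrite !tensor_lactD.
by rewrite !tensor_lactE lactM.
Qed.
Next Obligation.
move=> x a b /=; move: x; apply: tensor_ext => [||m n].
- exact: tensor_ractD.
- by move=> x y; rewrite !tensor_ractD addrACA.
- by rewrite !tensor_ractE ractDr (balancedDr tens_balanced).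
Qed.
Next Obligation.
apply: tensor_ext => [||m n]; [exact: tensor_ractD| by []|].
by rewrite tensor_ractE ract1.
Qed.
Next Obligation.
move=> x a b /=; move: x; apply: tensor_ext => [|x y|m n]; first exact: tensor_ractD.
  by rewrite !tensor_ractD.
by rewrite !tensor_ractE ractM.
Qed.
Next Obligation.
move=> a x b /=; move: x; apply: tensor_ext => [x y|x y|m n].
- by rewrite tensor_ractD tensor_lactD.
- by rewrite tensor_lactD tensor_ractD.
- by rewrite tensor_ractE !tensor_lactE tensor_ractE.
Qed.
Next Obligation.
move=> i j a x ha [l [hl ->]]; rewrite (bigM _ _ (tensor_lactD a)) big_seq.
apply: gr_sum; first exact: tensor_deg_sub.
move=> p /hl[i1 [j1 [hi hj <-]]]; rewrite tensor_lactE addrA.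
by apply: tensor_deg_tens => //; exact: gdeg_lact.
Qed.
Next Obligation.
move=> i j x a [l [hl ->]] ha; rewrite (bigM _ _ (tensor_ractD a)) big_seq.
apply: gr_sum; first exact: tensor_deg_sub.
move=> p /hl[i1 [j1 [hi hj <-]]]; rewrite tensor_ractE -addrA.
by apply: tensor_deg_tens => //; exact: gdeg_ract.
Qed.

End Tensor.

Section PolynomialFunctions.
Variables (K : realType) (E : vectType K).

Inductive polyfun : (E -> K) -> Prop :=
  | polyfun_cst c : polyfun (fun=> c)
  | polyfun_lin (l : {scalar E}) : polyfun l
  | polyfunD f g : polyfun f -> polyfun g -> polyfun (f + g)
  | polyfunM f g : polyfun f -> polyfun g -> polyfun (f * g).

(* [homogfun d] is the image of S^d(E^* ) in the functions on E. *)
Inductive homogfun : nat -> (E -> K) -> Prop :=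
  | homogfun_cst c : homogfun 0 (fun=> c)
  | homogfun_lin (l : {scalar E}) d f : homogfun d f -> homogfun d.+1 ((l : E -> K) * f)
  | homogfunD d f g : homogfun d f -> homogfun d g -> homogfun d (f + g).

Lemma polyfunN f : polyfun f -> polyfun (- f).
Proof. by move=> hf; rewrite -mulN1r; apply: polyfunM => //; exact: (polyfun_cst (-1)). Qed.

Lemma polyfunB f g : polyfun f -> polyfun g -> polyfun (f - g).
Proof. by move=> hf /polyfunN; exact: polyfunD. Qed.

Lemma homog_polyfun d f : homogfun d f -> polyfun f.
Proof.
elim=> [c|l {}d {}f _ hf|{}d {}f g _ hf _ hg]; first exact: polyfun_cst.
- by apply: polyfunM => //; exact: polyfun_lin.
- exact: polyfunD.
Qed.

Lemma homogfunZ d c f : homogfun d f -> homogfun d ((fun=> c) * f).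
Proof.
elim=> [c'|l {}d {}f _ hf|{}d {}f g _ hf _ hg].
- exact: homogfun_cst.
- by rewrite mulrCA; exact: homogfun_lin.
- by rewrite mulrDr; exact: homogfunD.
Qed.

Lemma homogfun0 d : homogfun d 0.
Proof.
elim: d => [|d IH]; first exact: homogfun_cst.
have l0 : {scalar E} by exact: (\0).
by rewrite -[0](mulr0 (l0 : E -> K)); exact: homogfun_lin.
Qed.

Lemma homogfunB d f g : homogfun d f -> homogfun d g -> homogfun d (f - g).
Proof.
move=> hf hg; apply: homogfunD => //.
by rewrite -mulN1r; exact: (homogfunZ (-1)).
Qed.

Lemma homogfunM d e f g : homogfun d f -> homogfun e g -> homogfun (d + e) (f * g).
Proof.
move=> hf hg; elim: hf => [c|l {}d {}f _ IH|{}d {}f f' _ IH _ IH'].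
- exact: homogfunZ.
- by rewrite -mulrA; exact: homogfun_lin.
- by rewrite mulrDl; exact: homogfunD.
Qed.

Lemma homogfun_scale d f : homogfun d f -> forall (c : K) x, f (c *: x) = c ^+ d * f x.
Proof.
elim=> [a|l {}d {}f _ hf|{}d {}f g _ hf _ hg] c x.
- by rewrite mul1r.
- have lfE y : ((l : E -> K) * f) y = l y * f y by [].
  by rewrite !lfE hf scalarZ exprS mulrACA.
- by rewrite /GRing.add /= hf hg mulrDr.
Qed.

Lemma polyfun_homog f : polyfun f -> exists r : seq (nat * (E -> K)),
  (forall p, p \in r -> homogfun p.1 p.2) /\ f = \sum_(p <- r) p.2.
Proof.
elim=> [c|l|{}f g _ [r [hr ->]] _ [s [hs ->]]|{}f g _ [r [hr ->]] _ [s [hs ->]]].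
- exists [:: (0%N, (fun=> c))]; rewrite big_seq1; split=> // p.
  by rewrite inE => /eqP ->; exact: homogfun_cst.
- exists [:: (1%N, l : E -> K)]; rewrite big_seq1; split=> // p.
  rewrite inE => /eqP -> /=; rewrite -[X in homogfun _ X]mulr1.
  by apply: homogfun_lin; exact: homogfun_cst.
- exists (r ++ s); rewrite big_cat; split=> // p.
  by rewrite mem_cat => /orP[/hr|/hs].
- exists [seq ((p.1 + q.1)%N, p.2 * q.2) | p <- r, q <- s]; split.
    by move=> _ /allpairsP[[p q] [/hr hp /hs hq ->]]; exact: homogfunM.
  rewrite big_allpairs_dep mulr_suml; apply: eq_bigr => p _ /=.
  by rewrite mulr_sumr.
Qed.

(* The degree of a linear form is 2. *)
Definition polydeg (i : int) (f : E -> K) : Prop :=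
  f = 0 \/ exists2 d, i = d.*2 & homogfun d f.

Lemma polydeg_sub i : polydeg i 0 /\
  forall f g, polydeg i f -> polydeg i g -> polydeg i (f - g).
Proof.
split=> [|f g [->|[d iE hf]]]; first by left.
  case=> [->|[e ie hg]]; first by left; rewrite subr0.
  by right; exists e => //; apply: homogfunB => //; exact: homogfun0.
case=> [->|[e ie hg]]; right; exists d => //; first by rewrite subr0.
have de : e = d by move: iE; rewrite ie => -[/double_inj].
by apply: homogfunB => //; rewrite -de.
Qed.

Lemma polydegM i j f g : polydeg i f -> polydeg j g -> polydeg (i + j) (f * g).
Proof.
move=> [->|[d iE hf]]; first by left; rewrite mul0r.
move=> [->|[e jE hg]]; first by left; rewrite mulr0.
by right; exists (d + e)%N; [rewrite iE jE doubleD PoszD|exact: homogfunM].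
Qed.

Lemma polydeg_polyfun i f : polydeg i f -> polyfun f.
Proof. by case=> [->|[d _ /homog_polyfun//]]; exact: (polyfun_cst 0). Qed.

(* Restrictions of polynomial functions along [z : Z -> E], the image of
   which is a cone.  *)
Lemma restrict_grading (Z : Type) (z : Z -> E) (M : zmodType) (ev : M -> Z -> K) :
  (forall c x, exists y, z y = c *: z x) ->
  (forall m n, ev (m + n) = ev m + ev n) -> injective ev ->
  (forall m, exists2 f, polyfun f & ev m = f \o z) ->
  (forall f, polyfun f -> exists m, ev m = f \o z) ->
  is_grading (fun i => [set m | exists2 f, polydeg i f & ev m = f \o z]).
Proof.
move=> cone evD ev_inj evP evS; set gr := (X in is_grading X).
have ev0 : ev 0 = 0 by apply: (@addIr _ (ev 0)); rewrite -evD !add0r.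
have evN m : ev (- m) = - ev m.
  by apply: (@addIr _ (ev m)); rewrite -evD !addNr.
have ev_sum (I : Type) (r : seq I) (F : I -> M) :
    ev (\sum_(i <- r) F i) = \sum_(i <- r) ev (F i) by exact: (big_morph ev evD ev0).
have gs i : gr i 0 /\ forall m n, gr i m -> gr i n -> gr i (m - n).
  split; first by exists 0; [case: (polydeg_sub i)|rewrite ev0].
  move=> m n [f hf fE] [g hg gE]; exists (f - g); first exact: (polydeg_sub i).2.
  by rewrite evD evN fE gE.
split=> // m; have [f hf] : exists f, components gr m f.
  move: m; apply: grading_ex => // m; have [f /polyfun_homog[r [hr ->]] mE] := evP m.
  have hr' : forall p, p \in r -> exists y : M,
      ev y = p.2 \o z by move=> p /hr /homog_polyfun /evS.
  pose F (p : nat * (E -> K)) : M :=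
    if pselect (exists y, ev y = p.2 \o z) is left h then sval (cid h) else 0.
  have FE p : p \in r -> ev (F p) = p.2 \o z.
    by move=> /hr' h; rewrite /F; case: pselect => // h'; exact: svalP (cid h').
  exists [seq ((p.1.*2 : int), F p) | p <- r]; split.
    move=> _ /mapP[p pr ->] /=; exists p.2; last exact: FE.
    by right; exists p.1 => //; exact: hr.
  apply: ev_inj; rewrite big_map /= ev_sum mE.
  transitivity (\sum_(p <- r) (p.2 \o z)).
    by apply/funext => x /=; rewrite !fct_sumE.
  by rewrite big_seq [RHS]big_seq; apply: eq_bigr => p /FE.
exists f; split=> // g hg.
have /componentsP[hf1 [r [ur r0 rE]]] := hf.
have /componentsP[hg1 [s [us s0 sE]]] := hg.
pose t := undup (r ++ s); have ut : uniq t by exact: undup_uniq.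
have ft i : i \notin t -> f i = 0.
  by rewrite mem_undup mem_cat negb_or => /andP[/r0].
have gt i : i \notin t -> g i = 0.
  by rewrite mem_undup mem_cat negb_or => /andP[_ /s0].
have sum0 : \sum_(i <- t) (f i - g i) = 0.
  rewrite sumrB -(fsbig_int ut ft) -(fsbig_int ut gt).
  by rewrite (fsbig_int ur r0) (fsbig_int us s0) -rE -sE subrr.
have hgr i : gr i (f i - g i) by exact: (gs i).2.
suff h i : f i - g i = 0 by apply/funext => i; apply/eqP; rewrite -subr_eq0 h.
have [it|it] := boolP (i \in t); last by rewrite ft // gt // subrr.
apply: ev_inj; rewrite ev0; apply/funext => x.
pose P j : {poly K} :=
  if (0 <= j) && ~~ odd `|j|%N then ev (f j - g j) x *: 'X^(`|j|./2) else 0.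
have PE j c y : z y = c *: z x -> ev (f j - g j) y = (P j).[c].
  rewrite /P => yE; have [q [q0|[d jE hq]] ->] := hgr j.
    by rewrite /= q0; case: ifP; rewrite ?horner0 // scale0r horner0.
  by rewrite jE /= odd_double doubleK yE (homogfun_scale hq) hornerZ hornerXn mulrC.
have PS : \sum_(j <- t) P j = 0.
  have root0 (c : K) : (\sum_(j <- t) P j).[c] = 0.
    have [y yE] := cone c x; rewrite horner_sum.
    under eq_bigr => j _ do rewrite -(PE j c y yE).
    have e : ev (\sum_(j <- t) (f j - g j)) y = 0 by rewrite sum0 ev0.
    by rewrite ev_sum fct_sumE in e.
  apply/eqP; apply: contraT => /max_poly_roots h.
  have := h [seq n%:R | n <- iota 0 (size (\sum_(j <- t) P j)).+1].
  rewrite size_map size_iota ltnNge leqW // => h'; apply: h'.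
    by apply/allP => _ /mapP[n _ ->]; apply/eqP; exact: root0.
  by rewrite map_inj_uniq ?iota_uniq // => a b /eqP; rewrite eqr_nat => /eqP.
have Pi : P i = 0.
  rewrite /P; case: ifP => // /andP[i0 iodd].
  have := congr1 (fun p : {poly K} => p`_(`|i|./2)) PS.
  rewrite coef0 coef_sum (bigD1_seq i) //= big1 ?addr0.
    by rewrite /P i0 iodd coefZ coefXn eqxx mulr1 => ->; rewrite scale0r.
  move=> j ji; rewrite /P; case: ifP => [/andP[j0 jodd]|_]; last by rewrite coef0.
  rewrite coefZ coefXn; case: eqP => [e|]; last by rewrite mulr0.
  case/eqP: ji; rewrite -(gez0_abs i0) -(gez0_abs j0); congr (Posz _).
  rewrite -(odd_double_half `|i|) -(odd_double_half `|j|) e.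
  by rewrite (negPf iodd) (negPf jodd).
have := PE i 1 x; rewrite scale1r => /(_ erefl) ->.
by rewrite Pi horner0.
Qed.

End PolynomialFunctions.

Arguments polyfun_cst {K E} c.
Arguments homogfun_cst {K E} c.

Section CoordinateRing.
Variables (K : realType) (E : vectType K).

Definition polyfun_pred : {pred (E -> K)} := fun f => `[< polyfun f >].

Lemma polyfun_subring_closed : subring_closed polyfun_pred.
Proof.
split=> [|f g /asboolP hf /asboolP hg|f g /asboolP hf /asboolP hg]; apply/asboolP.
- exact: (polyfun_cst 1).
- exact: polyfunB.
- exact: polyfunM.
Qed.
HB.instance Definition _ :=
  GRing.isSubringClosed.Build (E -> K) polyfun_pred polyfun_subring_closed.

Definition polyring_sort := {f : (E -> K) | f \in polyfun_pred}.
HB.instance Definition _ := SubChoice.on polyring_sort.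
HB.instance Definition _ := 
  GRing.SubChoice_isSubComPzRing.Build (E -> K) polyfun_pred polyring_sort
    polyfun_subring_closed.

Lemma polyring_polyfun (f : polyring_sort) : polyfun (val f).
Proof. exact/asboolP/(valP f). Qed.

Lemma polyring_grading :
  is_grading (fun i => [set f : polyring_sort | polydeg i (val f)]).
Proof.
have -> : (fun i => [set f : polyring_sort | polydeg i (val f)]) =
    (fun i => [set m : polyring_sort | exists2 f, polydeg i f & val m = f \o id]).
  apply/funext => i; apply/funext => m; apply/propext.
  by split=> [h|[f h] /= ->//]; exists (val m).
apply: (@restrict_grading K E E id polyring_sort val) => [c x|//||m|f hf].
- by exists (c *: x).
- exact: val_inj.
- by exists (val m) => //; exact: polyring_polyfun.
- by exists (exist _ f (asboolT hf)).
Qed.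

Lemma polyring_deg1 : polydeg 0 (val (1 : polyring_sort)).
Proof. by right; exists 0%N => //; exact: (homogfun_cst 1). Qed.

(* The graded ring O(E) = S(E^* ) *)
Definition polyring : gradedRing :=
  @GradedRing polyring_sort _ polyring_grading polyring_deg1
    (fun i j a b => @polydegM K E i j (val a) (val b)).

Variable X : set E.

Definition regfun_pred : {pred (X -> K)} :=
  fun g => `[< exists2 f, polyfun f & g = f \o set_val >].

Lemma regfun_zmod_closed : zmod_closed regfun_pred.
Proof.
split=> [|f g /asboolP[p hp ->] /asboolP[q hq ->]]; apply/asboolP.
  by exists 0 => //; exact: (polyfun_cst 0).
by exists (p - q) => //; exact: polyfunB.
Qed.
HB.instance Definition _ :=
  GRing.isZmodClosed.Build (X -> K) regfun_pred regfun_zmod_closed.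

(* Regular functions on X *)
Definition regfun := {g : (X -> K) | g \in regfun_pred}.
HB.instance Definition _ := SubChoice.on regfun.
HB.instance Definition _ := [SubChoice_isSubZmodule of regfun by <:].

Definition regfun_deg (i : int) : set regfun :=
  [set g | exists2 f, polydeg i f & val g = f \o set_val].

Hypothesis coneX : forall c x, X x -> X (c *: x).

Lemma regfun_grading : is_grading regfun_deg.
Proof.
apply: (@restrict_grading K E X set_val regfun val) => [c x|//||m|f hf].
- have h : X (c *: set_val x) by apply/coneX/set_mem/(valP x).
  by exists (SigSub (mem_set h)).
- exact: val_inj.
- exact/asboolP/(valP m).
- have h : (f \o set_val : X -> K) \in regfun_pred by apply/asboolP; exists f.
  by exists (exist (fun g => is_true (g \in regfun_pred)) _ h).
Qed.

End CoordinateRing.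

Section Composition.
Variables (K : realType) (F E : vectType K) (h : {linear F -> E}).

Lemma polyfun_comp (f : E -> K) : polyfun f -> polyfun (f \o h).
Proof.
elim=> [c|l|{}f g _ hf _ hg|{}f g _ hf _ hg].
- exact: (polyfun_cst c).
- exact: (polyfun_lin (l \o h)).
- exact: (polyfunD hf hg).
- exact: (polyfunM hf hg).
Qed.

Lemma polydeg_comp i (f : E -> K) : polydeg i f -> polydeg i (f \o h).
Proof.
case=> [->|[d iE hf]]; first by left.
right; exists d => // {iE}.
elim: hf => [c|l {}d {}f _ hf|{}d {}f g _ hf _ hg].
- exact: (homogfun_cst c).
- exact: (homogfun_lin (l \o h) hf).
- exact: (homogfunD hf hg).
Qed.

End Composition.

Record representation (K : realType) (W : groupType) (V : vectType K) := Representation {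
  rep_fun :> W -> 'End(V);
  rep1 : rep_fun 1%g = \1%VF;
  repM : forall x y, rep_fun (x * y)%g = (rep_fun x \o rep_fun y)%VF
}.

Section ReflectionRepresentation.
Variables (K : realType) (W : groupType) (S : set W) (V : vectType K).
Variable rho : representation W V.

Definition reflection_faithful : Prop :=
  injective rho /\
  forall w, (\dim (fixedSpace (rho w))).+1 = \dim {:V} <-> reflections S w.

(* (w f)(v) = f(w^-1 v) *)
Definition polyring_act (w : W) (f : polyring V) : polyring V :=
  exist _ (val f \o rho w^-1%g) (asboolT (polyfun_comp (rho w^-1%g) (polyring_polyfun f))).

Definition invariant_set (w : W) : set (polyring V) := [set f | polyring_act w f = f].

Lemma invariant_component w i f : invariant_set w f ->
  invariant_set w (component (gring_grading (polyring V)) i f).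
Proof.
move=> wf; rewrite /invariant_set /= -[in RHS]wf; apply/esym.
have actD a b : polyring_act w (a + b) = polyring_act w a + polyring_act w b.
  exact: val_inj.
have act0 : polyring_act w 0 = 0 by exact: val_inj.
pose h j := polyring_act w (component (gring_grading (polyring V)) j f).
apply: (@component_uniq _ _ (gring_grading (polyring V)) _ h).
have [r [ur r0 rE]] := component_supp (gring_grading (polyring V)) f.
apply/componentsP; split=> [j|].
  have : polydeg j (val (component (gring_grading (polyring V)) j f)).
    exact: (component_gr (gring_grading (polyring V)) j f).
  exact: (polydeg_comp (rho w^-1%g)).
exists r; split=> // [j /r0 fj|]; first by rewrite /h fj.
by rewrite {1}rE (big_morph _ actD act0).
Qed.

Program Definition invariants (w : W) : gradedSubring (polyring V) :=
  @GradedSubring _ (invariant_set w) _ _ _ (@invariant_component w).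
Next Obligation. by move=> w; exact: val_inj. Qed.
Next Obligation.
move=> w a b ha hb; apply: val_inj; rewrite -[in RHS]ha -[in RHS]hb; exact: erefl.
Qed.
Next Obligation.
move=> w a b ha hb; apply: val_inj; rewrite -[in RHS]ha -[in RHS]hb; exact: erefl.
Qed.

Definition graph (x : W) : set (V * V)%type := [set (rho x v, v) | v in [set: V]].

Definition graphs (A : set W) : set (V * V)%type := \bigcup_(x in A) graph x.

Lemma graphs_cone A (c : K) x : graphs A x -> graphs A (c *: x).
Proof. by move=> [w Aw [v _ <-]]; exists w => //; exists (c *: v); rewrite ?linearZ. Qed.

Section GraphBimodule.
Variable A : set W.
Let Z := graphs A.
Let O := regfun Z.

Lemma graph_act_subproof (h : {linear (V * V)%type -> V}) (f : polyring V) (g : O) :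
  (fun z : Z => val f (h (set_val z)) * val g z) \in @regfun_pred K _ Z.
Proof.
have /asboolP[p hp gE] := valP g; apply/asboolP.
exists ((val f \o h) * p); last by rewrite gE.
by apply: polyfunM => //; exact: polyfun_comp (polyring_polyfun f).
Qed.

Lemma graph_deg_subproof (h : {linear (V * V)%type -> V}) i j (f : polyring V) (g : O) :
  gring_deg i f -> regfun_deg j g ->
  exists2 p, polydeg (i + j) p &
    (fun z : Z => val f (h (set_val z)) * val g z) = p \o set_val.
Proof.
move=> hf [p hp gE]; exists ((val f \o h) * p); last by rewrite gE.
by apply: polydegM => //; exact: polydeg_comp.
Qed.

(* (f g)(u, v) = f(u) g(u, v) and (g f)(u, v) = g(u, v) f(v) *)
Definition graph_lact (f : polyring V) (g : O) : O :=
  exist _ (fun z : Z => val f (set_val z).1 * val g z) (graph_act_subproof fst f g).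

Definition graph_ract (g : O) (f : polyring V) : O :=
  exist _ (fun z : Z => val f (set_val z).2 * val g z) (graph_act_subproof snd f g).

(* R(A) *)
Program Definition graph_bimod : gbimod (polyring V) :=
  @Gbimod (polyring V) O graph_lact graph_ract (@regfun_deg K _ Z)
    _ _ _ _ _ _ _ _ _ (regfun_grading (@graphs_cone A)) _ _.
Next Obligation.
by move=> g a b; apply/val_inj/funext => z /=; exact: mulrDl.
Qed.
Next Obligation.
by move=> a g g'; apply/val_inj/funext => z /=; exact: mulrDr.
Qed.
Next Obligation. by move=> g; apply/val_inj/funext => z /=; exact: mul1r. Qed.
Next Obligation.
by move=> a b g; apply/val_inj/funext => z /=; rewrite mulrA.
Qed.
Next Obligation.
by move=> a g g'; apply/val_inj/funext => z /=; exact: mulrDr.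
Qed.
Next Obligation.
by move=> g a b; apply/val_inj/funext => z /=; exact: mulrDl.
Qed.
Next Obligation. by move=> g; apply/val_inj/funext => z /=; exact: mul1r. Qed.
Next Obligation.
move=> g a b; apply/val_inj/funext => z /=; rewrite mulrA; congr (_ * _).
exact: mulrC.
Qed.
Next Obligation.
by move=> a g b; apply/val_inj/funext => z /=; rewrite mulrCA.
Qed.
Next Obligation. by move=> i j a g; exact: (graph_deg_subproof fst). Qed.
Next Obligation.
move=> i j g a hg ha; rewrite addrC; exact: (graph_deg_subproof snd ha hg).
Qed.

End GraphBimodule.

Definition tensorR (M N : gbimod (polyring V)) : gbimod (polyring V) :=
  tensor (full_subring (polyring V)) M N.

Definition Bbimod (t : W) : gbimod (polyring V) :=
  shift (tensor (invariants t) (regular_gbimod (polyring V)) (regular_gbimod (polyring V))) 1.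

(* B_t1 (x)_R (... (x)_R (B_tk (x)_R R)), which is R for the empty sequence *)
Definition Bproduct (ts : seq W) : gbimod (polyring V) :=
  foldr (fun t M => tensorR (Bbimod t) M) (regular_gbimod (polyring V)) ts.

Definition Bsum (s : seq (seq W * int)) : gbimod (polyring V) :=
  foldr (fun p M => dsum (shift (Bproduct p.1) p.2) M) (zero_gbimod (polyring V)) s.

(* Direct summands of finite direct sums of grading shifts of products of
   the B_t, t a reflection.  *)
Definition catC (M : gbimod (polyring V)) : Prop :=
  exists s : seq (seq W * int),
    (forall p, p \in s -> forall t, t \in p.1 -> reflections S t) /\
    exists N, giso (Bsum s) (dsum M N).

End ReflectionRepresentation.

Section Indecomposable.
Variable R : gradedRing.

Definition is_zero (M : gbimod R) : Prop := forall m : M, m = 0.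

Definition indecomposable (M : gbimod R) : Prop :=
  ~ is_zero M /\
  forall N P : gbimod R, giso M (dsum N P) -> is_zero N \/ is_zero P.

End Indecomposable.

Definition laurent_pred : {pred {fraction {poly int}}} :=
  fun x => `[< exists (n : nat) (p : {poly int}), x * tofrac 'X ^+ n = tofrac p >].

Lemma laurent_subring_closed : subring_closed laurent_pred.
Proof.
split=> [|x y /asboolP[m [p xE]] /asboolP[n [q yE]]|
          x y /asboolP[m [p xE]] /asboolP[n [q yE]]]; apply/asboolP.
- by exists 0%N, 1; rewrite mul1r tofrac1.
- exists (m + n)%N, (p * 'X^n - q * 'X^m).
  rewrite exprD mulrBl mulrA xE mulrCA yE tofracB !tofracM !tofracXn.
  by congr (_ - _); rewrite mulrC.
- by exists (m + n)%N, (p * q); rewrite exprD mulrACA xE yE tofracM.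
Qed.
HB.instance Definition _ :=
  GRing.isSubringClosed.Build {fraction {poly int}} laurent_pred laurent_subring_closed.

(* Z[v, v^-1], as a subring of Z(v) *)
Definition laurent := {x : {fraction {poly int}} | x \in laurent_pred}.
HB.instance Definition _ := SubChoice.on laurent.
HB.instance Definition _ := [SubChoice_isSubComNzRing of laurent by <:].

Lemma laurent_v_subproof : tofrac 'X \in laurent_pred.
Proof. by apply/asboolP; exists 0%N, 'X; rewrite mulr1. Qed.

Definition laurent_v : laurent := exist _ (tofrac 'X) laurent_v_subproof.

Section Grothendieck.
Variables (R : gradedRing) (C : gbimod R -> Prop).

Definition additive_invariant (X : zmodType) (f : gbimod R -> X) : Prop :=
  forall M M' M'', C M -> C M' -> C M'' -> giso M (dsum M' M'') -> f M = f M' + f M''.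

(* [A], with the class map [cls], is the split Grothendieck ring of [C]: the
   abelian group generated by the classes of the objects of [C] subject to
   <M> = <M'> + <M''> whenever M is isomorphic to the direct sum of M' and M''
   (such relations also make [cls] invariant under isomorphism, as soon as
   [C] contains the zero bimodule), with the product induced by the tensor
   product and v acting by the shift (1). A characterization is used because
   the objects of [C] do not form a small type; these conditions determine
   the algebra [A] up to a unique isomorphism compatible with [cls].  *)
Record split_grothendieck (A : algType laurent) (cls : gbimod R -> A) : Prop := {
  cls_additive : additive_invariant cls;
  cls_universal : forall (X : zmodType) (f : gbimod R -> X), additive_invariant f ->
    exists phi : {additive A -> X}, (forall M, C M -> phi (cls M) = f M) /\
      forall psi : {additive A -> X}, (forall M, C M -> psi (cls M) = f M) -> psi =1 phi;
  cls_tensor : forall M N, C M -> C N ->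
    cls (tensor (full_subring R) M N) = cls M * cls N;
  cls_unit : cls (regular_gbimod R) = 1;
  cls_shift : forall M, C M -> cls (shift M 1) = laurent_v *: cls M
}.

End Grothendieck.

Definition free_of_rank (L : pzRingType) (A : lmodType L) (n : nat) : Prop :=
  exists b : 'I_n -> A, forall x, exists! c : {ffun 'I_n -> L},
    x = \sum_(i < n) c i *: b i.

(* Main.v *)
Require Import Defs.
From HB Require Import structures.
From mathcomp Require Import all_boot all_order all_algebra.
From mathcomp Require Import generic_quotient fraction.
From mathcomp Require Import boolp classical_sets functions.
From mathcomp Require Import reals.
From mathcomp Require Import ring lra.

(** Up to shift, the category generated by the [B_t] is computed by one isomorphism. Let
    [t] be a reflection with root [al]. The bimodule [R (x)_{R^t} R(A)] contains
    [R(A u tA)], generated by [1 (x) 1], and the Demazure divided difference maps the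
    quotient onto [R(A n tA)(-2)]. The extension splits as soon as some linear function
    of [(u, z)] equals [al(u)] on the graphs over [tA - A] and [- al(u)] on the graphs
    over [A - tA]. In type A2, when [A] is [{1}] or is stable under some reflection, the
    difference [tA - A] is empty, or [{t}] with [A = {1}], or a coset [{x, r x}] of a
    reflection [r] other than [t]; such a linear function is then obtained from a linear
    form that is fixed by [r] and does not vanish on the coroot of [t] ([refl_split]).
    This gives ([tensor_invariants_iso], [BX_iso])

      B_t (x)_R R(A) = R(A u tA)(1) + R(A n tA)(-1).

    As [R = R({1})], every product of the [B_t] is therefore a sum of shifts of the
    bimodules R(A), where [A] is [{1}] or stable under a reflection. There are 20 such
    sets, and repeated unions and intersections of this kind produce all of them from
    [{1}] ([coded_labels], [coded_gen]), so each R(A) lies in the category.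

    The unit generates R(A) as a bimodule and spans its component of degree 0, so its
    endomorphisms are scalars. This makes the Krull-Schmidt theorem elementary
    ([sum_summand], [sum_unique]): direct summands of sums of shifts of R(A) are again
    such sums, and the multiplicities are unique. Moreover different [A] and different
    shifts give nonisomorphic bimodules, because the functions that act by zero on
    R(A) recover the union of the graphs over [A], and the lowest degree recovers the
    shift ([F_inj]).

    Consequently the Grothendieck group is the free module on these 20 classes over
    the Laurent polynomials. Its multiplication is the bilinear extension of the tensor
    product, and the ring laws follow from the associativity and unit isomorphisms
    ([grothendieck_exists]). By the universal property every other model is isomorphic
    to this one ([grothendieck_free]). *)

Set Implicit Arguments.
Unset Strict Implicit.
Unset Printing Implicit Defensive.

Import Order.TTheory GRing.Theory Num.Theory.

Local Open Scope classical_set_scope.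
Local Open Scope ring_scope.

(** * Graded bimodules *)

Section Bimodules.
Variable R : gradedRing.
Implicit Types M N P Q Y : gbimod R.

(** Plain functions are easier to add and to compose than bundled additive maps;
    [gisoP] translates between the two. *)
Definition ghom M N (f : M -> N) : Prop :=
  [/\ {morph f : x y / x + y}, forall a m, f (lact a m) = lact a (f m),
      forall m a, f (ract m a) = ract (f m) a
    & forall i m, gdeg i m -> gdeg i (f m)].

Lemma morphD0 (X X' : zmodType) (f : X -> X') : {morph f : x y / x + y} -> f 0 = 0.
Proof. by move=> fD; apply: (@addIr _ (f 0)); rewrite -fD !add0r. Qed.

Lemma morphDN (X X' : zmodType) (f : X -> X') : {morph f : x y / x + y} ->
  {morph f : x / - x}.
Proof. by move=> fD x; apply: (@addIr _ (f x)); rewrite -fD !addNr morphD0. Qed.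

Lemma morphD_sum (X X' : zmodType) (f : X -> X') (I : Type) (r : seq I) (F : I -> X) :
  {morph f : x y / x + y} -> f (\sum_(i <- r) F i) = \sum_(i <- r) f (F i).
Proof. by move=> fD; exact: (big_morph f fD (morphD0 fD)). Qed.

Lemma gisoP M N : giso M N <->
  exists (f : M -> N) (g : N -> M), [/\ ghom f, ghom g, cancel f g & cancel g f].
Proof.
have pack M' N' (f : M' -> N') (hf : ghom f) :
    exists2 F : {additive M' -> N'}, gmorphism F & f =1 F.
  have fB : GRing.zmod_morphism f.
    by case: hf => fD _ _ _ x y; rewrite fD (morphDN fD).
  pose Fm := GRing.isZmodMorphism.Build _ _ f fB.
  pose F : {additive M' -> N'} := HB.pack f Fm.
  by exists F => //; case: hf.
split=> [[f [g [[f1 f2 f3] [g1 g2 g3] fg gf]]]|[f [g [/pack[F hF fF] /pack[G hG gG] fg gf]]]].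
  by exists f, g; split=> //; split=> //; exact: raddfD.
exists F, G; split=> // x.
  by rewrite -fF -gG fg.
by rewrite -fF -gG gf.
Qed.

Lemma lact0l M (m : M) : lact 0 m = 0.
Proof. exact: (morphD0 (@lactDl _ _ m)). Qed.
Lemma lact0 M a : lact a (0 : M) = 0.
Proof. exact: (morphD0 (lactDr _)). Qed.
Lemma ract0 M a : ract (0 : M) a = 0.
Proof. exact: (morphD0 (ractDl _)). Qed.

Lemma gdeg0 M i : gdeg i (0 : M).
Proof. by case: ((gdeg_grading M).1 i). Qed.
Lemma gdegD M i (x y : M) : gdeg i x -> gdeg i y -> gdeg i (x + y).
Proof. exact: (gr_add (gdeg_grading M).1). Qed.
Lemma gdegN M i (x : M) : gdeg i x -> gdeg i (- x).
Proof. exact: (gr_opp (gdeg_grading M).1). Qed.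

Section Ghom.
Variables (M N : gbimod R) (f : M -> N).
Hypothesis hf : ghom f.
Lemma ghomD : {morph f : x y / x + y}. Proof. by case: hf. Qed.
Lemma ghom0 : f 0 = 0. Proof. exact/morphD0/ghomD. Qed.
Lemma ghomN : {morph f : x / - x}. Proof. exact/morphDN/ghomD. Qed.
Lemma ghomL a m : f (lact a m) = lact a (f m). Proof. by case: hf. Qed.
Lemma ghomR m a : f (ract m a) = ract (f m) a. Proof. by case: hf. Qed.
Lemma ghom_deg i m : gdeg i m -> gdeg i (f m). Proof. by case: hf => _ _ _ ; exact. Qed.
End Ghom.

Lemma ghom_id M : ghom (@id M).
Proof. by []. Qed.

Lemma ghom_comp M N P (f : N -> P) (g : M -> N) : ghom f -> ghom g -> ghom (f \o g).
Proof.
move=> hf hg; split=> [x y|a m|m a|i m hm] /=.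
- by rewrite (ghomD hg) (ghomD hf).
- by rewrite (ghomL hg) (ghomL hf).
- by rewrite (ghomR hg) (ghomR hf).
- by apply: (ghom_deg hf); exact: (ghom_deg hg).
Qed.

Lemma ghom_zero M N : ghom (fun _ : M => 0 : N).
Proof.
by split=> [x y|a m|m a|i m _]; rewrite ?addr0 ?lact0 ?ract0 //; exact: gdeg0.
Qed.

Lemma ghom_add M N (f g : M -> N) : ghom f -> ghom g -> ghom (fun x => f x + g x).
Proof.
move=> hf hg; split=> [x y|a m|m a|i m hm] /=.
- by rewrite (ghomD hg) (ghomD hf) addrACA.
- by rewrite (ghomL hg) (ghomL hf) lactDr.
- by rewrite (ghomR hg) (ghomR hf) ractDl.
- by apply: gdegD; [exact: ghom_deg|exact: ghom_deg].
Qed.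

Lemma ghom_opp M N (f : M -> N) : ghom f -> ghom (fun x => - f x).
Proof.
move=> hf; split=> [x y|a m|m a|i m hm] /=.
- by rewrite (ghomD hf) opprD.
- by rewrite (ghomL hf) (morphDN (lactDr _)).
- by rewrite (ghomR hf) (morphDN (ractDl _)).
- by apply: gdegN; exact: ghom_deg.
Qed.

Lemma ghom_fst M N : @ghom (dsum M N) M fst. Proof. by split=> // i m []. Qed.
Lemma ghom_snd M N : @ghom (dsum M N) N snd. Proof. by split=> // i m []. Qed.
Lemma ghom_inl M N : @ghom M (dsum M N) (fun x => (x, 0)).
Proof.
split=> [x y|a m|m a|i m hm] /=; last by split=> //; exact: gdeg0.
- by rewrite -[RHS]/(x + y, 0 + 0) addr0.
- by rewrite lact0.
- by rewrite ract0.
Qed.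
Lemma ghom_inr M N : @ghom N (dsum M N) (fun x => (0, x)).
Proof.
split=> [x y|a m|m a|i m hm] /=; last by split=> //; exact: gdeg0.
- by rewrite -[RHS]/(0 + 0, x + y) addr0.
- by rewrite lact0.
- by rewrite ract0.
Qed.
Lemma ghom_pair M N P (f : M -> N) (g : M -> P) : ghom f -> ghom g ->
  @ghom M (dsum N P) (fun x => (f x, g x)).
Proof.
move=> hf hg; split=> [x y|a m|m a|i m hm] /=.
- by rewrite (ghomD hf) (ghomD hg).
- by rewrite (ghomL hf) (ghomL hg).
- by rewrite (ghomR hf) (ghomR hg).
- by split; exact: ghom_deg.
Qed.

Lemma giso_refl M : giso M M.
Proof. by apply/gisoP; exists id, id. Qed.
Lemma giso_sym M N : giso M N -> giso N M.
Proof. by move=> /gisoP[f [g [hf hg fg gf]]]; apply/gisoP; exists g, f. Qed.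
Lemma giso_trans N M P : giso M N -> giso N P -> giso M P.
Proof.
move=> /gisoP[f [g [hf hg fg gf]]] /gisoP[f' [g' [hf' hg' fg' gf']]].
apply/gisoP; exists (f' \o f), (g \o g'); split; [exact: ghom_comp|exact: ghom_comp| |].
- exact: can_comp.
- exact: can_comp.
Qed.

(** The inverse needs no separate treatment: [f] preserves homogeneous components,
    so the preimage of a homogeneous element is homogeneous by injectivity. *)
Lemma giso_bij M N (f : M -> N) : ghom f -> injective f -> (forall y, exists x, f x = y) ->
  giso M N.
Proof.
move=> hf fI /choice[g gf]; have fg : cancel f g by move=> x; apply: fI; rewrite gf.
apply/gisoP; exists f, g; split=> //; split=> [x y|a m|m a|i m hm]; try apply: fI.
- by rewrite (ghomD hf) !gf.
- by rewrite (ghomL hf) !gf.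
- by rewrite (ghomR hf) !gf.
suff <- : component (gdeg_grading M) i (g m) = g m by exact: component_gr.
apply: fI; rewrite gf; have [r [ur r0 rE]] := component_supp (gdeg_grading M) (g m).
rewrite -(component_uniq (gdeg_grading N) (m := m)
            (f := fun j => f (component (gdeg_grading M) j (g m)))).
  by rewrite (component_hom _ _ hm) eqxx.
apply/componentsP; split=> [j|]; first by apply: (ghom_deg hf); exact: component_gr.
exists r; split=> [//|j /r0 ->|]; first exact: ghom0.
by rewrite -(morphD_sum _ _ (ghomD hf)) -rE gf.
Qed.

Lemma giso_zero M N : is_zero M -> is_zero N -> giso M N.
Proof.
move=> zM zN; apply/gisoP; exists (fun=> 0), (fun=> 0).
by split=> [||x|x]; [exact: ghom_zero|exact: ghom_zero|rewrite [RHS]zM|rewrite [RHS]zN].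
Qed.

Lemma zero_is_zero : is_zero (zero_gbimod R).
Proof. by move=> m; exact: thinmx0. Qed.

Lemma giso_is_zero M N : giso M N -> is_zero M -> is_zero N.
Proof. by move=> /gisoP[f [g [hf hg fg gf]]] z m; rewrite -(gf m) (z (g m)) (ghom0 hf). Qed.

Lemma dsum_iso M M' N N' : giso M M' -> giso N N' -> giso (dsum M N) (dsum M' N').
Proof.
move=> /gisoP[f [g [hf hg fg gf]]] /gisoP[f' [g' [hf' hg' fg' gf']]].
apply/gisoP; exists (fun x => (f x.1, f' x.2)), (fun x => (g x.1, g' x.2)); split.
- by apply: ghom_pair; [exact: (ghom_comp hf (ghom_fst _ _))|exact: (ghom_comp hf' (ghom_snd _ _))].
- by apply: ghom_pair; [exact: (ghom_comp hg (ghom_fst _ _))|exact: (ghom_comp hg' (ghom_snd _ _))].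
- by move=> [x y] /=; rewrite fg fg'.
- by move=> [x y] /=; rewrite gf gf'.
Qed.

Lemma dsumC M N : giso (dsum M N) (dsum N M).
Proof.
apply/gisoP; exists (fun x => (x.2, x.1)), (fun x => (x.2, x.1)); split.
- exact: (ghom_pair (ghom_snd _ _) (ghom_fst _ _)).
- exact: (ghom_pair (ghom_snd _ _) (ghom_fst _ _)).
- by case.
- by case.
Qed.

Lemma dsumA M N P : giso (dsum M (dsum N P)) (dsum (dsum M N) P).
Proof.
apply/gisoP; exists (fun x => ((x.1, x.2.1), x.2.2)), (fun x => (x.1.1, (x.1.2, x.2))).
have c M1 M2 M3 (f : M2 -> M3) (g : M1 -> M2) := @ghom_comp M1 M2 M3 f g.
split.
- apply: (@ghom_pair _ (dsum M N)); first apply: ghom_pair.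
  + exact: ghom_fst.
  + exact: (c _ _ _ _ _ (ghom_fst _ _) (ghom_snd _ _)).
  + exact: (c _ _ _ _ _ (ghom_snd _ _) (ghom_snd _ _)).
- apply: (@ghom_pair _ M (dsum N P)); last apply: ghom_pair.
  + exact: (c _ _ _ _ _ (ghom_fst _ _) (ghom_fst _ _)).
  + exact: (c _ _ _ _ _ (ghom_snd _ _) (ghom_fst _ _)).
  + exact: ghom_snd.
- by move=> [x [y z]].
- by move=> [[x y] z].
Qed.

Lemma dsum0 M N : is_zero N -> giso M (dsum M N).
Proof.
move=> zN; apply/gisoP; exists (fun x => (x, 0)), fst; split=> //.
- exact: ghom_inl.
- exact: ghom_fst.
- by move=> [x y] /=; rewrite [y]zN.
Qed.

Lemma dsumACA M N P Q : giso (dsum (dsum M N) (dsum P Q)) (dsum (dsum M P) (dsum N Q)).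
Proof.
apply: giso_trans (giso_sym (dsumA _ _ _)) _.
apply: giso_trans (dsumA _ _ _); apply: dsum_iso (giso_refl _) _.
apply: giso_trans (dsumA _ _ _) _; apply: giso_trans (giso_sym (dsumA _ _ _)).
exact: dsum_iso (dsumC _ _) (giso_refl _).
Qed.

Lemma dsumCA M N P : giso (dsum M (dsum N P)) (dsum N (dsum M P)).
Proof.
apply: giso_trans (dsumA _ _ _) _; apply: giso_trans (giso_sym (dsumA _ _ _)).
exact: dsum_iso (dsumC _ _) (giso_refl _).
Qed.

Lemma ghom_shift M N n (f : M -> N) : ghom f -> @ghom (shift M n) (shift N n) f.
Proof. by move=> [h1 h2 h3 h4]; split=> // i m; exact: h4. Qed.

Lemma shift_iso M N n : giso M N -> giso (shift M n) (shift N n).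
Proof.
move=> /gisoP[f [g [hf hg fg gf]]]; apply/gisoP; exists f, g.
by split=> //; exact: ghom_shift.
Qed.

Lemma shift0 M : giso (shift M 0) M.
Proof. by apply/gisoP; exists id, id; split=> //; split=> // i m /=; rewrite add0r. Qed.

Lemma shiftD M m n : giso (shift (shift M m) n) (shift M (m + n)).
Proof. by apply/gisoP; exists id, id; split=> //; split=> // i x /=; rewrite addrA. Qed.

Lemma shift_dsum M N n : giso (shift (dsum M N) n) (dsum (shift M n) (shift N n)).
Proof. by apply/gisoP; exists id, id; split. Qed.

Section Bigsum.
Variables (I : eqType) (F : I -> gbimod R).
Definition bigsum (s : seq I) : gbimod R :=
  foldr (fun i M => dsum (F i) M) (zero_gbimod R) s.

Lemma bigsum_cat s t : giso (bigsum (s ++ t)) (dsum (bigsum s) (bigsum t)).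
Proof.
elim: s => [|i s IH] /=.
  exact: giso_trans (dsum0 _ zero_is_zero) (dsumC _ _).
apply: giso_trans (dsumA _ _ _); exact: dsum_iso (giso_refl _) IH.
Qed.

Lemma bigsum_rem i s : i \in s -> giso (bigsum s) (bigsum (i :: rem i s)).
Proof.
elim: s => [//|j s IH]; rewrite inE eq_sym /=; case: eqVneq => [->|ji] /=.
  by move=> _; exact: giso_refl.
move=> /IH h; apply: giso_trans (dsumCA _ _ _); exact: dsum_iso (giso_refl _) h.
Qed.
End Bigsum.

Lemma bigsum_iso (I J : eqType) (F : I -> gbimod R) (G : J -> gbimod R) (h : I -> J) s :
  (forall i, i \in s -> giso (F i) (G (h i))) -> giso (bigsum F s) (bigsum G (map h s)).
Proof.
elim: s => [|i s IH] H /=; first exact: giso_refl.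
apply: dsum_iso; first by apply: H; rewrite inE eqxx.
by apply: IH => j js; apply: H; rewrite inE js orbT.
Qed.

Lemma bigsum_functor (I : eqType) (F : I -> gbimod R) (T : gbimod R -> gbimod R) s :
  is_zero (T (zero_gbimod R)) -> (forall M N, giso (T (dsum M N)) (dsum (T M) (T N))) ->
  giso (T (bigsum F s)) (bigsum (T \o F) s).
Proof.
move=> T0 TD; elim: s => [|i s IH] /=; first exact: giso_zero zero_is_zero.
exact: giso_trans (TD _ _) (dsum_iso (giso_refl _) IH).
Qed.

Section Kernel.
Variables (M N : gbimod R) (p : M -> N).
Hypothesis hp : ghom p.

Definition ker_pred : {pred M} := fun x => p x == 0.

Lemma ker_zmod_closed : zmod_closed ker_pred.
Proof.
split=> [|x y]; rewrite !unfold_in; first by rewrite ghom0.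
by move=> /eqP hx /eqP hy; rewrite (ghomD hp) (ghomN hp) hx hy subr0.
Qed.

Definition ker_sort := {x : M | x \in ker_pred}.
HB.instance Definition _ := SubChoice.on ker_sort.
HB.instance Definition _ := GRing.isZmodClosed.Build M ker_pred ker_zmod_closed.
HB.instance Definition _ := [SubChoice_isSubZmodule of ker_sort by <:].

Definition ker_elt x (hx : x \in ker_pred) : ker_sort := exist _ x hx.

Definition ker_deg (i : int) : set ker_sort := [set x | gdeg i (val x)].

Lemma ker_component i (x : ker_sort) : component (gdeg_grading M) i (val x) \in ker_pred.
Proof.
rewrite unfold_in; have [r [ur r0 rE]] := component_supp (gdeg_grading M) (val x).
have px : p (val x) = 0 by apply/eqP; exact: (valP x).
rewrite -(component_uniq (gdeg_grading N) (m := 0)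
            (f := fun j => p (component (gdeg_grading M) j (val x)))) ?component0 //.
apply/componentsP; split=> [j|]; first by apply: (ghom_deg hp); exact: component_gr.
exists r; split=> [//|j /r0 ->|]; first exact: ghom0.
by rewrite -(morphD_sum _ _ (ghomD hp)) -rE px.
Qed.

Lemma ker_grading : is_grading ker_deg.
Proof.
have gs i : ker_deg i 0 /\ forall x y, ker_deg i x -> ker_deg i y -> ker_deg i (x - y).
  by split=> [|x y]; [exact: gdeg0|exact: ((gdeg_grading M).1 i).2].
apply: (@grading_proj _ _ gs (fun i x => ker_elt (ker_component i x))).
- by move=> i x y; apply: val_inj; rewrite /= componentD.
- move=> i j x hx; apply: val_inj.
  by rewrite /= (component_hom (gdeg_grading M) j (hx : gdeg i (val x))); case: ifP.
- apply: grading_ex => // x; have [r [ur r0 rE]] := component_supp (gdeg_grading M) (val x).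
  exists [seq (i, ker_elt (ker_component i x)) | i <- r]; split.
    by move=> q /mapP[i _ ->] /=; exact: component_gr.
  by apply: val_inj; rewrite big_map raddf_sum /= {1}rE.
Qed.

Lemma ker_lact_subproof a (x : ker_sort) : lact a (val x) \in ker_pred.
Proof. by have := valP x; rewrite !unfold_in (ghomL hp) => /eqP ->; rewrite lact0. Qed.
Lemma ker_ract_subproof (x : ker_sort) a : ract (val x) a \in ker_pred.
Proof. by have := valP x; rewrite !unfold_in (ghomR hp) => /eqP ->; rewrite ract0. Qed.

Definition ker_lact a (x : ker_sort) : ker_sort := ker_elt (ker_lact_subproof a x).
Definition ker_ract (x : ker_sort) a : ker_sort := ker_elt (ker_ract_subproof x a).

#[local] Obligation Tactic := idtac.
Program Definition ker_gbimod : gbimod R :=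
  @Gbimod R ker_sort ker_lact ker_ract ker_deg _ _ _ _ _ _ _ _ _ ker_grading _ _.
Next Obligation. by move=> m a b; apply: val_inj; exact: lactDl. Qed.
Next Obligation. by move=> a m n; apply: val_inj; exact: lactDr. Qed.
Next Obligation. by move=> m; apply: val_inj; exact: lact1. Qed.
Next Obligation. by move=> a b m; apply: val_inj; exact: lactM. Qed.
Next Obligation. by move=> a m n; apply: val_inj; exact: ractDl. Qed.
Next Obligation. by move=> m a b; apply: val_inj; exact: ractDr. Qed.
Next Obligation. by move=> m; apply: val_inj; exact: ract1. Qed.
Next Obligation. by move=> a b m; apply: val_inj; exact: ractM. Qed.
Next Obligation. by move=> a m b; apply: val_inj; exact: lractA. Qed.
Next Obligation. by move=> i j a m; exact: gdeg_lact. Qed.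
Next Obligation. by move=> i j m a; exact: gdeg_ract. Qed.

(** The complement of the image of [i] is visible from [x = i (p x) + (x - i (p x))]. *)
Lemma ker_split (i : N -> M) : ghom i -> cancel i p -> giso M (dsum N ker_gbimod).
Proof.
move=> hi ip; have sub x : x - i (p x) \in ker_pred.
  by rewrite unfold_in (ghomD hp) (ghomN hp) ip subrr.
apply/gisoP; exists (fun x => (p x, ker_elt (sub x) : ker_gbimod)), (fun x => i x.1 + val x.2).
have hq : ghom (fun x => ker_elt (sub x) : ker_gbimod).
  have [h1 h2 h3 h4] := ghom_add (ghom_id M) (ghom_opp (ghom_comp hi hp)).
  by split=> [x y|a x|x a|k x hx]; try apply: val_inj; [exact: h1|exact: h2|exact: h3|exact: h4].
have hv : @ghom ker_gbimod M val by split.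
split.
- exact: ghom_pair.
- exact: (ghom_add (ghom_comp hi (ghom_fst N ker_gbimod))
                   (ghom_comp hv (ghom_snd N ker_gbimod))).
- by move=> x /=; rewrite addrC subrK.
move=> [y z]; have pz : p (val z) = 0 by apply/eqP; exact: (valP z).
have e : p (i y + val z) = y by rewrite (ghomD hp) ip pz addr0.
by congr (_, _); [exact: e|apply: val_inj; rewrite /= e addrC addKr].
Qed.
End Kernel.

(** The endomorphisms of degree 0 form a division ring. This is stronger than the
    local endomorphism rings of the Krull-Schmidt theorem, but it holds for the
    bimodules R(A), where these endomorphisms are scalars. *)
Definition brick M : Prop := ~ is_zero M /\
  forall f : M -> M, ghom f ->
    (forall x, f x = 0) \/ exists g, [/\ ghom g, cancel f g & cancel g f].

Lemma brick_iso M N : giso M N -> brick M -> brick N.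
Proof.
move=> h [nz bM]; split; first by move=> zN; apply: nz; exact: giso_is_zero (giso_sym h) zN.
have /gisoP[f [g [hf hg fg gf]]] := h => u hu.
have [u0|[v [hv uv vu]]] := bM (g \o u \o f) (ghom_comp (ghom_comp hg hu) hf).
  left=> x; rewrite -(gf x) -(gf (u (f (g x)))); have /= -> := u0 (g x).
  exact: ghom0.
right; exists (f \o v \o g); split; first exact: (ghom_comp (ghom_comp hf hv) hg).
  by move=> x /=; apply: (can_inj gf); rewrite fg -[in LHS](gf x); exact: (uv (g x)).
by move=> x /=; apply: (can_inj gf); exact: (vu (g x)).
Qed.

Lemma brick_shift M n : brick M -> brick (shift M n).
Proof.
move=> [nz bM]; split=> // f [f1 f2 f3 f4].
have hf : @ghom M M f.
  by split=> // i m hm; have := f4 (i - n) m; rewrite /= addrCA subrr addr0; apply.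
have [f0|[g [hg fg gf]]] := bM f hf; first by left.
by right; exists g; split=> //; exact: ghom_shift.
Qed.

(** The projector onto a summand is zero or invertible. *)
Lemma brick_indecomposable M : brick M -> indecomposable M.
Proof.
move=> [nz bM]; split=> // N P /gisoP[f [g [hf hg fg gf]]].
have hu : ghom (g \o (fun x : dsum N P => (x.1, 0) : dsum N P) \o f).
  apply: ghom_comp hf; apply: ghom_comp hg _.
  exact: (ghom_comp (ghom_inl N P) (ghom_fst N P)).
have [u0|[v [hv uv vu]]] := bM _ hu; [left=> x|right=> x].
  have := u0 (g (x, 0)); rewrite /= gf /= => /(congr1 f); rewrite gf (ghom0 hf).
  by case.
have := uv (g (0, x)); rewrite /= gf /= (ghom0 hg) (ghom0 hv) => /(congr1 f).
by rewrite gf (ghom0 hf) => -[].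
Qed.

(** The nonzero endomorphism [p i] is invertible, and composing [p] with its inverse
    gives a retraction of [i]. *)
Lemma brick_split Y M (i : Y -> M) (p : M -> Y) : brick Y -> ghom i -> ghom p ->
  ~ (forall y, p (i y) = 0) -> exists M', giso M (dsum Y M').
Proof.
move=> [_ bY] hi hp nz.
have [//|[g [hg fg gf]]] := bY (p \o i) (ghom_comp hp hi).
have hgp : ghom (g \o p) by exact: ghom_comp.
by exists (ker_gbimod hgp); apply: (ker_split hgp hi).
Qed.

(** When the corner [Y -> Y] of an isomorphism is invertible, with inverse [h], its
    Schur complement [p |-> d p - c (h (b p))] is an isomorphism. *)
Lemma schur_cancel Y P Q (f : dsum Y P -> dsum Y Q) (g : dsum Y Q -> dsum Y P)
    (h : Y -> Y) : ghom f -> ghom g -> cancel f g -> cancel g f ->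
  ghom h -> (forall y, h (f (y, 0)).1 = y) -> (forall y, (f (h y, 0)).1 = y) ->
  giso P Q.
Proof.
move=> hf hg fg gf hh h1 h2.
have hP : ghom (fun p : P => (f (- h (f (0, p)).1, p)).2).
  apply: (ghom_comp (ghom_snd Y Q)); apply: (ghom_comp hf); apply: ghom_pair (ghom_id P).
  apply: ghom_opp; apply: (ghom_comp hh); apply: (ghom_comp (ghom_fst Y Q)).
  exact: (ghom_comp hf (ghom_inr Y P)).
have fE y p : f (y, p) = (((f (y, 0)).1 + (f (0, p)).1), ((f (y, 0)).2 + (f (0, p)).2)).
  have -> : (y, p) = (y, 0) + (0, p) :> dsum Y P.
    by rewrite -[RHS]/(y + 0, 0 + p) addr0 add0r.
  by rewrite (ghomD hf).
have f1 p : (f (- h (f (0, p)).1, p)).1 = 0.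
  rewrite fE /=; have -> : (- h (f (0, p)).1, 0) = - (h (f (0, p)).1, 0) :> dsum Y P.
    by rewrite -[RHS]/(- _, - 0) oppr0.
  by rewrite (ghomN hf) -[X in X + _]/(- (f (h (f (0, p)).1, 0)).1) h2 addNr.
apply: (giso_bij hP) => [p p' e|q].
  have : f (- h (f (0, p)).1, p) = f (- h (f (0, p')).1, p').
    by rewrite [LHS]surjective_pairing [RHS]surjective_pairing !f1 e.
  by move=> /(can_inj fg)[].
exists (g (0, q)).2; set p := (g (0, q)).2; set y := (g (0, q)).1.
have E : f (y, p) = (0, q) by rewrite /y /p -surjective_pairing gf.
have yE : y = - h (f (0, p)).1.
  have := congr1 fst E; rewrite fE /= => /eqP; rewrite addrC addr_eq0 => /eqP ->.
  by rewrite (ghomN hh) opprK h1.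
by rewrite -yE E.
Qed.

(** The corner [a : Y -> Y] of the isomorphism is zero or invertible, and an
    automorphism of [Y + P] reduces the first case to the second. *)
Lemma brick_cancel Y P Q : brick Y -> giso (dsum Y P) (dsum Y Q) -> giso P Q.
Proof.
move=> [nzY bY] /gisoP[f [g [hf hg fg gf]]].
have ha : ghom (fun y : Y => (f (y, 0)).1).
  exact: (ghom_comp (ghom_fst Y Q) (ghom_comp hf (ghom_inl Y P))).
have [a0|[h [hh h1 h2]]] := bY _ ha; last first.
  exact: (schur_cancel hf hg fg gf hh h1 h2).
(* The corner [b c'] is the identity; a shear of [Y + P] adds it to the zero
   corner [a]. *)
have hc : ghom (fun y : Y => (g (y, 0)).2).
  exact: (ghom_comp (ghom_snd Y P) (ghom_comp hg (ghom_inl Y Q))).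
pose sh (x : dsum Y P) : dsum Y P := (x.1, x.2 + (g (x.1, 0)).2).
pose sh' (x : dsum Y P) : dsum Y P := (x.1, x.2 - (g (x.1, 0)).2).
have hs : ghom sh.
  exact: (ghom_pair (ghom_fst _ _) (ghom_add (ghom_snd Y P) (ghom_comp hc (ghom_fst Y P)))).
have hs' : ghom sh'.
  exact: (ghom_pair (ghom_fst _ _)
    (ghom_add (ghom_snd Y P) (ghom_opp (ghom_comp hc (ghom_fst Y P))))).
have ss' : cancel sh sh' by move=> [y p]; rewrite /sh' /sh /= addrK.
have s's : cancel sh' sh by move=> [y p]; rewrite /sh' /sh /= subrK.
have key y : (f (sh (y, 0))).1 = y.
  have -> : sh (y, 0) = g (y, 0) - ((g (y, 0)).1 - y, 0).
    rewrite /sh /= add0r; case: (g (y, 0)) => u v /=.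
    by rewrite -[RHS]/(u - (u - y), v - 0) subr0 subKr.
  rewrite (ghomD hf) (ghomN hf) gf -[LHS]/(y - (f ((g (y, 0)).1 - y, 0)).1).
  by rewrite a0 subr0.
apply: (@schur_cancel Y P Q (f \o sh) (sh' \o g) id (ghom_comp hf hs) (ghom_comp hs' hg)) => //.
- exact: can_comp.
- exact: can_comp.
Qed.

(** The exchange argument. The identity of the first brick [Y] of the sum is the sum
    of two endomorphisms, which factor through [M] and through [N]. One of them is
    nonzero, so [Y] splits off [M] or [N], and it can then be cancelled. *)
Lemma sum_summand (I : eqType) (F : I -> gbimod R) s M N :
  (forall i, i \in s -> brick (F i)) -> giso (dsum M N) (bigsum F s) ->
  exists2 s', {subset s' <= s} & giso M (bigsum F s').
Proof.
elim: s M N => [|i s IH] M N bF /=.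
  move=> h; exists [::] => //; apply: (giso_zero _ zero_is_zero) => m.
  by have := giso_is_zero (giso_sym h) zero_is_zero (m, 0) => -[].
have bi : brick (F i) by apply: bF; rewrite inE eqxx.
have {}bF j : j \in s -> brick (F j) by move=> js; apply: bF; rewrite inE js orbT.
set Y := F i in bi *; set Z := bigsum F s.
move=> h; have /gisoP[g [f [hg hf gf fg]]] := h.
have hY : ghom (f \o (fun y => (y, 0) : dsum Y Z)).
  exact: (ghom_comp hf (ghom_inl _ _)).
have hY' : ghom (fst \o g) by exact: (ghom_comp (ghom_fst _ _) hg).
have sumE y : (g ((f (y, 0)).1, 0)).1 + (g (0, (f (y, 0)).2)).1 = y.
  rewrite -[LHS]/(g ((f (y, 0)).1, 0) + g (0, (f (y, 0)).2)).1 -(ghomD hg).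
  suff -> : ((f (y, 0)).1, 0) + (0, (f (y, 0)).2) = f (y, 0) by rewrite fg.
  by case: (f (y, 0)) => u v; rewrite -[LHS]/(u + 0, 0 + v) addr0 add0r.
have [y0 y0P] : exists y : Y, y <> 0.
  by apply/not_existsP => z; apply: (bi.1) => y; apply: contrapT => /z.
have [[M' hM]|[N' hN]] :
    (exists M', giso M (dsum Y M')) \/ (exists N', giso N (dsum Y N')).
  have [nz|z] := pselect (exists y, (g ((f (y, 0)).1, 0)).1 <> 0); [left|right].
    apply: (@brick_split Y M (fst \o (f \o (fun y => (y, 0) : dsum Y Z)))
              ((fst \o g) \o (fun m => (m, 0) : dsum M N))) => //.
    - exact: (ghom_comp (ghom_fst _ _) hY).
    - exact: (ghom_comp hY' (ghom_inl _ _)).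
    - by case: nz => y hy z; apply: hy; exact: (z y).
  apply: (@brick_split Y N (snd \o (f \o (fun y => (y, 0) : dsum Y Z)))
            ((fst \o g) \o (fun m => (0, m) : dsum M N))) => //.
  - exact: (ghom_comp (ghom_snd _ _) hY).
  - exact: (ghom_comp hY' (ghom_inr _ _)).
  - move=> z'; apply: y0P; rewrite -(sumE y0); have /= -> := z' y0.
    by rewrite addr0; apply: contrapT => h'; apply: z; exists y0.
- have /(brick_cancel bi)/(IH _ _ bF)[s' s's hs'] : giso (dsum Y (dsum M' N)) (dsum Y Z).
    apply: giso_trans (dsumA _ _ _) _.
    exact: giso_trans (dsum_iso (giso_sym hM) (giso_refl _)) h.
  exists (i :: s'); last by apply: giso_trans hM _; exact: dsum_iso (giso_refl _) hs'.
  by move=> j; rewrite !inE => /predU1P[->|/s's ->]; rewrite ?eqxx ?orbT.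
- have /(brick_cancel bi)/(IH _ _ bF)[s' s's hs'] : giso (dsum Y (dsum M N')) (dsum Y Z).
    apply: giso_trans (dsumCA _ _ _) _.
    exact: giso_trans (dsum_iso (giso_refl _) (giso_sym hN)) h.
  by exists s' => // j /s's js; rewrite inE js orbT.
Qed.

(** Krull-Schmidt: the first brick of [s], being an indecomposable summand of the
    sum over [t], occurs in [t]; cancel it. *)
Lemma sum_unique (I : eqType) (F : I -> gbimod R) s t :
  (forall i, brick (F i)) -> (forall i j, giso (F i) (F j) -> i = j) ->
  giso (bigsum F s) (bigsum F t) -> perm_eq s t.
Proof.
move=> bF FI; elim: s t => [|i s IH] t h.
  case: t h => // j t h; case: (bF j).1 => m.
  by have := giso_is_zero h zero_is_zero (m, 0) => -[].
have it : i \in t.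
  have [[|j s'] sub hs'] := sum_summand (fun i _ => bF i) h.
    by case: (bF i).1; exact: giso_is_zero (giso_sym hs') zero_is_zero.
  have [z|z] := (brick_indecomposable (bF i)).2 _ _ hs'; first by case: (bF j).1.
  rewrite (FI i j) ?sub ?inE ?eqxx //.
  exact: giso_trans hs' (giso_sym (dsum0 _ z)).
have h' : giso (bigsum F s) (bigsum F (rem i t)).
  by apply: (brick_cancel (bF i)); exact: giso_trans h (bigsum_rem _ it).
by rewrite perm_sym (perm_trans (perm_to_rem it)) // perm_cons perm_sym IH.
Qed.

End Bimodules.

(** * Tensor products *)

Section TensorIso.
Variable R : gradedRing.
Implicit Types (S : gradedSubring R) (M N P X : gbimod R).

Lemma giso_can M N (f : M -> N) (g : N -> M) : ghom f -> cancel f g -> cancel g f -> giso M N.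
Proof. by move=> hf fg gf; apply: (giso_bij hf (can_inj fg)) => y; exists (g y). Qed.

(** The extra degree [k] is that of a third factor kept fixed, as in the proof of
    associativity. *)
Lemma lift_deg S M N X (b : M -> N -> X) k : balanced S b ->
  (forall i j m n, gdeg i m -> gdeg j n -> gdeg (i + j + k) (b m n)) ->
  forall i (x : tensor S M N), gdeg i x -> gdeg (i + k) (tensor_lift b x).
Proof.
move=> hb hd i x [l [hl ->]]; rewrite (morphD_sum _ _ (tensor_liftD hb)) big_seq.
apply: gr_sum; first exact: (gdeg_grading X).1.
by move=> p /hl[i1 [j1 [h1 h2 <-]]]; rewrite tensor_lift_tens //; exact: hd.
Qed.

Lemma ghom_lift S M N X (b : M -> N -> X) : balanced S b ->
  (forall a m n, b (lact a m) n = lact a (b m n)) ->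
  (forall m n a, b m (ract n a) = ract (b m n) a) ->
  (forall i j m n, gdeg i m -> gdeg j n -> gdeg (i + j) (b m n)) ->
  @ghom _ (tensor S M N) X (tensor_lift b).
Proof.
move=> hb bL bR bD; have lD := tensor_liftD hb; split=> [//|a m|m a|i m hm].
- move: m; apply: tensor_ext => [x y|x y|m n]; first by rewrite /= tensor_lactD lD.
    by rewrite lD lactDr.
  by rewrite /= tensor_lactE !tensor_lift_tens.
- move: m; apply: tensor_ext => [x y|x y|m n]; first by rewrite /= tensor_ractD lD.
    by rewrite lD ractDl.
  by rewrite /= tensor_ractE !tensor_lift_tens.
- rewrite -[i]addr0; apply: (lift_deg hb) hm => i' j' m' n' h1 h2.
  by rewrite addr0; exact: bD.
Qed.

Lemma tensDl S M N n : {morph (fun m : M => tens S m (n : N)) : x y / x + y}.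
Proof. exact: (balancedDl (tens_balanced S M N)). Qed.
Lemma tensDr S M N (m : M) : {morph (fun n : N => tens S m n) : x y / x + y}.
Proof. exact: (balancedDr (tens_balanced S M N)). Qed.
Lemma tensA S M N (m : M) s (n : N) : gsub_set S s -> tens S (ract m s) n = tens S m (lact s n).
Proof. exact: (balancedA (tens_balanced S M N)). Qed.

Definition tmap S M M' N N' (f : M -> M') (g : N -> N') : tensor S M N -> tensor S M' N' :=
  tensor_lift (fun m n => tens S (f m) (g n)).

Section Tmap.
Variables (S : gradedSubring R) (M M' N N' : gbimod R) (f : M -> M') (g : N -> N').
Hypotheses (hf : ghom f) (hg : ghom g).

Lemma tmap_balanced : balanced S (fun m n => tens S (f m) (g n)).
Proof.
split=> [n m m'|m n n'|m s n Ss].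
- by rewrite (ghomD hf) tensDl.
- by rewrite (ghomD hg) tensDr.
- by rewrite (ghomR hf) (ghomL hg) tensA.
Qed.

Lemma tmapE m n : tmap f g (tens S m n) = tens S (f m) (g n).
Proof. exact: tensor_lift_tens tmap_balanced. Qed.

Lemma ghom_tmap : ghom (@tmap S _ _ _ _ f g).
Proof.
apply: ghom_lift => [|a m n|m n a|i j m n hm hn]; first exact: tmap_balanced.
- by rewrite (ghomL hf) /= tensor_lactE.
- by rewrite (ghomR hg) /= tensor_ractE.
- by apply: tensor_deg_tens; exact: ghom_deg.
Qed.
End Tmap.

Lemma tensor_iso S M M' N N' : giso M M' -> giso N N' -> giso (tensor S M N) (tensor S M' N').
Proof.
move=> /gisoP[f [g [hf hg fg gf]]] /gisoP[f' [g' [hf' hg' fg' gf']]].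
have h1 := ghom_tmap S hf hf'; have h2 := ghom_tmap S hg hg'.
apply: (giso_can h1 (g := tmap g g')).
- apply: tensor_ext => [x y|//|m n]; first by rewrite (ghomD h1) (ghomD h2).
  by rewrite !tmapE // fg fg'.
- apply: tensor_ext => [x y|//|m n]; first by rewrite (ghomD h2) (ghomD h1).
  by rewrite !tmapE // gf gf'.
Qed.

Definition dfst M N (x : dsum M N) : M := x.1.
Definition dsnd M N (x : dsum M N) : N := x.2.
Definition dinl M N (x : M) : dsum M N := (x, 0).
Definition dinr M N (x : N) : dsum M N := (0, x).

Lemma ghom_dproj M N :
  [/\ ghom (@dfst M N), ghom (@dsnd M N), ghom (@dinl M N) & ghom (@dinr M N)].
Proof. by split; [exact: ghom_fst|exact: ghom_snd|exact: ghom_inl|exact: ghom_inr]. Qed.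

Lemma dsum_eta M N (x : dsum M N) : dinl N (dfst x) + dinr M (dsnd x) = x.
Proof. by case: x => m n; rewrite -[LHS]/(m + 0, 0 + n) addr0 add0r. Qed.

Lemma tmap_comp S M M' M'' N N' N'' (f : M -> M') (f' : M' -> M'') (g : N -> N')
    (g' : N' -> N'') (x : tensor S M N) : ghom f -> ghom f' -> ghom g -> ghom g' ->
  tmap f' g' (tmap f g x : tensor S M' N') = tmap (f' \o f) (g' \o g) x.
Proof.
move=> hf hf' hg hg'; move: x; apply: tensor_ext => [x y|x y|m n].
- by rewrite (ghomD (ghom_tmap S hf hg)) (ghomD (ghom_tmap S hf' hg')).
- by rewrite (ghomD (ghom_tmap S (ghom_comp hf' hf) (ghom_comp hg' hg))).
- by rewrite !tmapE //; exact: ghom_comp.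
Qed.

Lemma tmap_id S M N (x : tensor S M N) : tmap id id x = x.
Proof.
move: x; apply: tensor_ext => [|//|m n]; last by rewrite tmapE.
exact: (ghomD (ghom_tmap S (ghom_id M) (ghom_id N))).
Qed.

Lemma tmap0l S M M' N N' (g : N -> N') (x : tensor S M N) : ghom g ->
  tmap (fun _ : M => 0 : M') g x = 0.
Proof.
move=> hg; have hz := ghom_zero M M'; have h := ghom_tmap S hz hg.
move: x; apply: tensor_ind => [|m n x IH]; first exact: (ghom0 h).
by rewrite (ghomD h) IH addr0 tmapE // (morphD0 (tensDl S _)).
Qed.

Lemma tmap0r S M M' N N' (f : M -> M') (x : tensor S M N) : ghom f ->
  tmap f (fun _ : N => 0 : N') x = 0.
Proof.
move=> hf; have hz := ghom_zero N N'; have h := ghom_tmap S hf hz.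
move: x; apply: tensor_ind => [|m n x IH]; first exact: (ghom0 h).
by rewrite (ghomD h) IH addr0 tmapE // (morphD0 (tensDr S _)).
Qed.

Lemma tensor_dsumr S M N P :
  giso (tensor S M (dsum N P)) (dsum (tensor S M N) (tensor S M P)).
Proof.
have [p1 p2 i1 i2] := ghom_dproj N P; have hid := ghom_id M.
have h1 := ghom_tmap S hid p1; have h2 := ghom_tmap S hid p2.
have k1 := ghom_tmap S hid i1; have k2 := ghom_tmap S hid i2.
pose g (x : dsum (tensor S M N) (tensor S M P)) : tensor S M (dsum N P) :=
  tmap id (@dinl N P) x.1 + tmap id (@dinr N P) x.2.
apply: (giso_can (ghom_pair h1 h2) (g := g)).
- apply: tensor_ext => [x y|//|m n].
    by rewrite /g /= (ghomD h1) (ghomD h2) (ghomD k1) (ghomD k2) addrACA.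
  by rewrite /g /= !tmapE // -tensDr dsum_eta.
move=> [x y]; rewrite /g /= (ghomD h1) (ghomD h2) !tmap_comp //.
by rewrite !tmap_id !tmap0r // addr0 add0r.
Qed.

Lemma tensor_dsuml S M N P :
  giso (tensor S (dsum M N) P) (dsum (tensor S M P) (tensor S N P)).
Proof.
have [p1 p2 i1 i2] := ghom_dproj M N; have hid := ghom_id P.
have h1 := ghom_tmap S p1 hid; have h2 := ghom_tmap S p2 hid.
have k1 := ghom_tmap S i1 hid; have k2 := ghom_tmap S i2 hid.
pose g (x : dsum (tensor S M P) (tensor S N P)) : tensor S (dsum M N) P :=
  tmap (@dinl M N) id x.1 + tmap (@dinr M N) id x.2.
apply: (giso_can (ghom_pair h1 h2) (g := g)).
- apply: tensor_ext => [x y|//|m n].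
    by rewrite /g /= (ghomD h1) (ghomD h2) (ghomD k1) (ghomD k2) addrACA.
  by rewrite /g /= !tmapE // -tensDl dsum_eta.
move=> [x y]; rewrite /g /= (ghomD h1) (ghomD h2) !tmap_comp //.
by rewrite !tmap_id !tmap0l // addr0 add0r.
Qed.

Lemma tensor_zeror S M N : is_zero N -> is_zero (tensor S M N).
Proof.
move=> zN; apply: tensor_ind => // m n x ->.
by rewrite (zN n) addr0 (morphD0 (tensDr S m)).
Qed.

Lemma tensor_zerol S M N : is_zero M -> is_zero (tensor S M N).
Proof.
move=> zM; apply: tensor_ind => // m n x ->.
by rewrite (zM m) addr0 (morphD0 (tensDl S n)).
Qed.

Lemma tensor_shiftl S M N k : giso (tensor S (shift M k) N) (shift (tensor S M N) k).
Proof.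
have hb : balanced S (fun (m : shift M k) (n : N) => tens S (m : M) n).
  by case: (tens_balanced S M N).
have hc : balanced S (fun (m : M) (n : N) => tens S (m : shift M k) n).
  by case: (tens_balanced S (shift M k) N).
have hf : @ghom _ (tensor S (shift M k) N) (shift (tensor S M N) k)
    (tensor_lift (X := shift (tensor S M N) k) (fun (m : shift M k) (n : N) => tens S (m : M) n)).
  apply: ghom_lift => // [a m n|m n a|i j m n hm hn].
  - by rewrite [RHS]tensor_lactE.
  - by rewrite [RHS]tensor_ractE.
  - by rewrite /= addrA; exact: tensor_deg_tens.
pose g : shift (tensor S M N) k -> tensor S (shift M k) N :=
  tensor_lift (X := tensor S (shift M k) N) (fun (m : M) (n : N) => tens S (m : shift M k) n).
apply: (giso_can hf (g := g)).
- apply: tensor_ext => [x y|//|m n]; first by rewrite /g !tensor_liftD.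
  by rewrite /g !tensor_lift_tens.
- apply: tensor_ext => [x y|//|m n]; first by rewrite /g !tensor_liftD.
  by rewrite /g !tensor_lift_tens.
Qed.

Lemma tensor_shiftr S M N k : giso (tensor S M (shift N k)) (shift (tensor S M N) k).
Proof.
have hb : balanced S (fun (m : M) (n : shift N k) => tens S m (n : N)).
  by case: (tens_balanced S M N).
have hc : balanced S (fun (m : M) (n : N) => tens S m (n : shift N k)).
  by case: (tens_balanced S M (shift N k)).
have hf : @ghom _ (tensor S M (shift N k)) (shift (tensor S M N) k)
    (tensor_lift (X := shift (tensor S M N) k) (fun (m : M) (n : shift N k) => tens S m (n : N))).
  apply: ghom_lift => // [a m n|m n a|i j m n hm hn].
  - by rewrite [RHS]tensor_lactE.
  - by rewrite [RHS]tensor_ractE.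
  - by rewrite /= addrCA; exact: tensor_deg_tens.
pose g : shift (tensor S M N) k -> tensor S M (shift N k) :=
  tensor_lift (X := tensor S M (shift N k)) (fun (m : M) (n : N) => tens S m (n : shift N k)).
apply: (giso_can hf (g := g)).
- apply: tensor_ext => [x y|//|m n]; first by rewrite /g !tensor_liftD.
  by rewrite /g !tensor_lift_tens.
- apply: tensor_ext => [x y|//|m n]; first by rewrite /g !tensor_liftD.
  by rewrite /g !tensor_lift_tens.
Qed.

Lemma tensor_unitl M : giso (tensor (full_subring R) (regular_gbimod R) M) M.
Proof.
have hb : balanced (full_subring R) (fun (a : regular_gbimod R) (m : M) => lact a m).
  split=> [n a b|a m m'|a s m _] /=; first by rewrite lactDl.
    by rewrite lactDr.
  by rewrite lactM.
have hf : ghom (tensor_lift (fun (a : regular_gbimod R) (m : M) => lact a m)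
    : tensor (full_subring R) _ _ -> _).
  apply: ghom_lift => // [a m n|m n a|i j m n]; last exact: gdeg_lact.
    by rewrite /= lactM.
  by rewrite lractA.
pose g m : tensor (full_subring R) (regular_gbimod R) M := tens _ (1 : regular_gbimod R) m.
apply: (giso_can hf (g := g)).
- apply: tensor_ext => [x y|//|m n]; first by rewrite /g (tensor_liftD hb) tensDr.
  by rewrite /g tensor_lift_tens // -tensA //= mul1r.
- by move=> m; rewrite /g tensor_lift_tens // lact1.
Qed.

Lemma tensor_unitr M : giso (tensor (full_subring R) M (regular_gbimod R)) M.
Proof.
have hb : balanced (full_subring R) (fun (m : M) (a : regular_gbimod R) => ract m a).
  split=> [n a b|a m m'|a s m _] /=; first by rewrite ractDl.
    by rewrite ractDr.
  by rewrite ractM.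
have hf : ghom (tensor_lift (fun (m : M) (a : regular_gbimod R) => ract m a)
    : tensor (full_subring R) _ _ -> _).
  apply: ghom_lift => // [a m n|m n a|i j m n]; last exact: gdeg_ract.
    by rewrite lractA.
  by rewrite /= ractM.
pose g m : tensor (full_subring R) M (regular_gbimod R) := tens _ m (1 : regular_gbimod R).
apply: (giso_can hf (g := g)).
- apply: tensor_ext => [x y|//|m n]; first by rewrite /g (tensor_liftD hb) tensDl.
  by rewrite /g tensor_lift_tens // tensA //= mulr1.
- by move=> m; rewrite /g tensor_lift_tens // ract1.
Qed.

Section Assoc.
Variables (S S' : gradedSubring R) (M N P : gbimod R).

Let c (p : P) (m : M) (n : N) := tens S m (tens S' n p : tensor S' N P).
Let d (m : M) (n : N) (p : P) := tens S' (tens S m n : tensor S M N) p.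

Let c2 (x : tensor S M N) (p : P) : tensor S M (tensor S' N P) := tensor_lift (c p) x.
Let d2 (m : M) (y : tensor S' N P) : tensor S' (tensor S M N) P := tensor_lift (d m) y.

Let c_balanced p : balanced S (c p).
Proof.
split=> [n m m'|m n n'|m s n Ss]; rewrite /c.
- by rewrite tensDl.
- by rewrite tensDl tensDr.
- by rewrite tensA //= tensor_lactE.
Qed.

Let d_balanced m : balanced S' (d m).
Proof.
split=> [n p p'|n p p'|n s p Ss]; rewrite /d.
- by rewrite tensDr tensDl.
- by rewrite tensDr.
- by rewrite -tensA //= tensor_ractE.
Qed.

Let c2_balanced : balanced S' c2.
Proof.
rewrite /c2; split=> [p x y|x p p'|x s p Ss]; first by rewrite tensor_liftD.
- move: x; apply: tensor_ext => [x y|x y|m n]; first by rewrite tensor_liftD.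
    by rewrite !tensor_liftD // addrACA.
  by rewrite !tensor_lift_tens // /c !tensDr.
- move: x; apply: tensor_ext => [x y|x y|m n]; last 1 first.
  + by rewrite /= tensor_ractE !tensor_lift_tens // /c tensA.
  + by rewrite /= tensor_ractD tensor_liftD.
  + by rewrite tensor_liftD.
Qed.

Let d2_balanced : balanced S d2.
Proof.
rewrite /d2; split=> [y m m'|m y y'|m s y Ss]; last 1 first.
- move: y; apply: tensor_ext => [x y|x y|n p]; last 1 first.
  + by rewrite /= tensor_lactE !tensor_lift_tens // /d tensA.
  + by rewrite tensor_liftD.
  + by rewrite /= tensor_lactD tensor_liftD.
- move: y; apply: tensor_ext => [x y|x y|n p]; first by rewrite tensor_liftD.
    by rewrite !tensor_liftD // addrACA.
  by rewrite !tensor_lift_tens // /d !tensDl.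
- by rewrite tensor_liftD.
Qed.

(** Two different subrings are needed to identify [(R (x)_{R^t} R) (x)_R M] with
    [R (x)_{R^t} M]. *)
Lemma tensor_assoc :
  giso (tensor S' (tensor S M N) P) (tensor S M (tensor S' N P)).
Proof.
have hf : ghom (tensor_lift c2
    : tensor S' (tensor S M N) P -> _).
  apply: (ghom_lift c2_balanced); rewrite /c2.
  - move=> a x p; move: x; apply: tensor_ext => [x y|x y|m n].
    + by rewrite /= tensor_lactD tensor_liftD.
    + by rewrite tensor_liftD //= tensor_lactD.
    + by rewrite /= tensor_lactE !tensor_lift_tens // /c tensor_lactE.
  - move=> x p a; move: x; apply: tensor_ext => [x y|x y|m n].
    + by rewrite tensor_liftD.
    + by rewrite tensor_liftD //= tensor_ractD.
    + by rewrite /= !tensor_lift_tens // /c !tensor_ractE /= tensor_ractE.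
  - move=> i j x p hx hp;
    apply: (lift_deg (X := tensor S M (tensor S' N P)) (c_balanced p) _ hx) => i' j' m n hm hn.
    by rewrite -addrA; do 2 apply: tensor_deg_tens => //.
pose g : tensor S M (tensor S' N P) -> tensor S' (tensor S M N) P :=
  tensor_lift d2.
apply: (giso_can hf (g := g)).
- apply: tensor_ext => [x y|//|x p]; first by rewrite /g !tensor_liftD.
  rewrite /g tensor_lift_tens // /c2 /d2; move: x; apply: tensor_ext => [x y|x y|m n].
  + by rewrite !tensor_liftD.
  + by rewrite tensDl.
  + by rewrite !tensor_lift_tens.
- apply: tensor_ext => [x y|//|m y]; first by rewrite /g !tensor_liftD.
  rewrite /g tensor_lift_tens // /c2 /d2; move: y; apply: tensor_ext => [x y|x y|n p].
  + by rewrite !tensor_liftD.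
  + by rewrite tensDr.
  + by rewrite !tensor_lift_tens.
Qed.
End Assoc.

End TensorIso.

(** * Laurent polynomials *)

Section Laurent.

Let x0 : {fraction {poly int}} := tofrac 'X.

Lemma fracX_neq0 : x0 != 0.
Proof. by rewrite tofrac_eq0 polyX_eq0. Qed.

Lemma vpow_subproof (n : int) : x0 ^ n \in laurent_pred.
Proof.
apply/asboolP; case: n => n; first by exists 0%N, ('X^n); rewrite expr0 mulr1 tofracXn.
by exists n.+1, 1; rewrite -[x0 ^ _]/(x0 ^- n.+1) mulVf ?tofrac1 // expf_neq0 // fracX_neq0.
Qed.

Definition vpow (n : int) : laurent :=
  exist (fun x => is_true (x \in laurent_pred)) _ (vpow_subproof n).

Lemma vpow0 : vpow 0 = 1. Proof. exact: val_inj. Qed.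
Lemma vpow1 : vpow 1 = laurent_v. Proof. exact: val_inj. Qed.
Lemma vpowD m n : vpow (m + n) = vpow m * vpow n.
Proof. by apply: val_inj; rewrite /= expfzDr // fracX_neq0. Qed.

Section EvalPoly.
Variables (X : zmodType) (h : int -> X).

(** The image of [v^(-n) p] under the additive map that sends [v^k] to [h k]. *)
Definition laurent_eval (n : nat) (p : {poly int}) : X :=
  \sum_(k < size p) h (k%:Z - n%:Z) *~ p`_k.

Lemma laurent_evalE N n (p : {poly int}) : (size p <= N)%N ->
  laurent_eval n p = \sum_(k < N) h (k%:Z - n%:Z) *~ p`_k.
Proof.
move=> sN; rewrite /laurent_eval (big_ord_widen N (fun k => h (k%:Z - n%:Z) *~ p`_k)) //.
rewrite big_mkcond /=; apply: eq_bigr => k _; case: ltnP => // /(nth_default 0) ->.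
by rewrite mulr0z.
Qed.

Lemma laurent_evalD n : {morph laurent_eval n : p q / p + q}.
Proof.
move=> p q; pose N := maxn (size (p + q)) (maxn (size p) (size q)).
have [h1 h2 h3] : [/\ (size (p + q)%R <= N)%N, (size p <= N)%N & (size q <= N)%N].
  by rewrite !leq_max !leqnn !orbT.
rewrite !(laurent_evalE (N := N)) // -big_split; apply: eq_bigr => k _ /=.
by rewrite coefD mulrzDr.
Qed.

Lemma laurent_evalMX n p : laurent_eval n.+1 (p * 'X) = laurent_eval n p.
Proof.
rewrite (laurent_evalE (N := (size p).+1)); last first.
  by apply: leq_trans (size_polyMleq _ _) _; rewrite size_polyX addn2.
rewrite big_ord_recl coefMX /= mulr0z add0r; apply: eq_bigr => k _.
by rewrite coefMX /= !subzSS.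
Qed.

(** Hence the value at a Laurent polynomial depends only on the fraction, not on
    its expression as [v^(-n) p]. *)
Lemma laurent_evalMXn n m p : laurent_eval (n + m) (p * 'X^m) = laurent_eval n p.
Proof.
elim: m p => [|m IH] p; first by rewrite addn0 expr0 mulr1.
by rewrite addnS exprSr mulrA laurent_evalMX IH.
Qed.

Lemma laurentP (x : laurent) : exists np : nat * {poly int},
  val x * x0 ^+ np.1 = tofrac np.2.
Proof. by have /asboolP[n [p e]] := valP x; exists (n, p). Qed.

Definition laurent_lift (x : laurent) : X :=
  let np := sval (cid (laurentP x)) in laurent_eval np.1 np.2.

Lemma laurent_liftE x n p : val x * x0 ^+ n = tofrac p -> laurent_lift x = laurent_eval n p.
Proof.
move=> xp; rewrite /laurent_lift; case: cid => -[m q] /= xq.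
have e : q * 'X^n = p * 'X^m.
  by apply/eqP; rewrite -tofrac_eq !tofracM !tofracXn -xp -xq mulrAC.
by rewrite -(laurent_evalMXn m n) e addnC laurent_evalMXn.
Qed.

Lemma laurent_liftD : {morph laurent_lift : x y / x + y}.
Proof.
move=> x y; have [[m p] /= xp] := laurentP x; have [[n q] /= yq] := laurentP y.
rewrite (laurent_liftE (n := m + n) (p := p * 'X^n + q * 'X^m)).
  rewrite (laurent_liftE xp) (laurent_liftE yq) laurent_evalD.
  by rewrite laurent_evalMXn addnC laurent_evalMXn.
rewrite tofracD !tofracM !tofracXn -xp -yq /= mulrDl exprD mulrA.
by congr (_ + _); rewrite -!mulrA [X in _ * X]mulrC.
Qed.

Lemma laurent_lift_vpow n : laurent_lift (vpow n) = h n.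
Proof.
case: n => n.
  rewrite (laurent_liftE (n := 0) (p := 'X^n)); last by rewrite expr0 mulr1 tofracXn.
  rewrite /laurent_eval size_polyXn big_ord_recr big1 /= => [|k _].
    by rewrite coefXn eqxx mulr1z add0r subr0.
  by rewrite coefXn ltn_eqF // mulr0z.
rewrite (laurent_liftE (n := n.+1) (p := 1)).
  by rewrite /laurent_eval size_poly1 big_ord1 coefC mulr1z sub0r NegzE.
by rewrite /= -[x0 ^ _]/(x0 ^- n.+1) mulVf ?tofrac1 // expf_neq0 // fracX_neq0.
Qed.
End EvalPoly.

Lemma laurent_sum (x : laurent) : exists n p, x = laurent_eval vpow n p.
Proof.
have [[n p] /= xp] := laurentP x; exists n, p; apply: val_inj.
have nz : x0 ^+ n != 0 by rewrite expf_neq0 // fracX_neq0.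
apply: (mulIf nz); rewrite xp /laurent_eval raddf_sum mulr_suml.
rewrite -[in LHS](coefK p) poly_def raddf_sum; apply: eq_bigr => k _.
rewrite raddfMz -[LHS]/(tofrac (p`_k *: 'X^k)) -[X in X *~ _]/(x0 ^ (k%:Z - n%:Z)).
rewrite -[in LHS](intz p`_k) scaler_int raddfMz /= tofracXn mulrzAl.
by rewrite -[x0 ^+ n]/(x0 ^ n%:Z) -expfzDr ?fracX_neq0 // subrK.
Qed.

(** The powers of [v] generate the Laurent polynomials as an abelian group. *)
Lemma laurent_ind (P : laurent -> Prop) : P 0 -> (forall x y, P x -> P y -> P (x + y)) ->
  (forall x, P x -> P (- x)) -> (forall n, P (vpow n)) -> forall x, P x.
Proof.
move=> P0 PD PN Pv x; have [n [p ->]] := laurent_sum x.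
apply: big_ind => // k _; case: (p`_k) => m.
  by elim: m => [|m IH]; rewrite ?mulr0z // -pmulrn mulrS; apply: PD.
rewrite NegzE mulrNz; apply: (PN); elim: m.+1 => [|j IH]; rewrite ?mulr0z // -pmulrn mulrS.
exact: PD.
Qed.

End Laurent.

Section FreeModule.
Variable n : nat.
Local Notation U := {ffun 'I_n -> laurent^o}.

Definition free_gen (i : 'I_n) : U := [ffun j => (i == j)%:R].

Lemma free_decomp (x : U) : x = \sum_i x i *: free_gen i.
Proof.
apply/ffunP => j; rewrite sum_ffunE (bigD1 j) //= big1 => [|i ij].
  by rewrite !ffunE eqxx addr0 /GRing.scale /= mulr1.
by rewrite !ffunE (negPf ij) /GRing.scale /= mulr0.
Qed.

Variable X : zmodType.

Definition free_lift (h : 'I_n -> int -> X) (x : U) : X := \sum_i laurent_lift (h i) (x i).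

Lemma free_liftD h : {morph free_lift h : x y / x + y}.
Proof.
by move=> x y; rewrite -big_split; apply: eq_bigr => i _; rewrite ffunE laurent_liftD.
Qed.

Lemma free_lift_gen h k i : free_lift h (vpow k *: free_gen i) = h i k.
Proof.
rewrite /free_lift (bigD1 i) //= big1 => [|j ji].
  by rewrite !ffunE eqxx addr0 [X in laurent_lift _ X]mulr1 laurent_lift_vpow.
rewrite !ffunE eq_sym (negPf ji) [X in laurent_lift _ X]mulr0.
exact/morphD0/laurent_liftD.
Qed.

(** The values at [v^k e_i] suffice, without linearity over the Laurent polynomials:
    the universal property of the Grothendieck ring concerns abelian groups only. *)
Lemma free_ext (f g : U -> X) : {morph f : x y / x + y} -> {morph g : x y / x + y} ->
  (forall k i, f (vpow k *: free_gen i) = g (vpow k *: free_gen i)) -> f =1 g.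
Proof.
move=> fD gD fg x; rewrite [x]free_decomp (morphD_sum _ _ fD) (morphD_sum _ _ gD).
apply: eq_bigr => i _; move: (x i); apply: laurent_ind => [|a b|a|k].
- by rewrite scale0r (morphD0 fD) (morphD0 gD).
- by rewrite scalerDl fD gD => -> ->.
- by rewrite scaleNr (morphDN fD) (morphDN gD) => ->.
- exact: fg.
Qed.
End FreeModule.

(** A multiplication that depends on hypotheses cannot be the target of canonical
    instances by itself; bundled with its laws, it can. *)
Record alg_law (L : comNzRingType) (U : lmodType L) := AlgLaw {
  law_mul : U -> U -> U;
  law_one : U;
  law_mulA : associative law_mul;
  law_mul1l : left_id law_one law_mul;
  law_mul1r : right_id law_one law_mul;
  law_mulDl : left_distributive law_mul +%R;
  law_mulDr : right_distributive law_mul +%R;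
  law_mulZl : forall (a : L) x y, a *: law_mul x y = law_mul (a *: x) y;
  law_mulZr : forall (a : L) x y, a *: law_mul x y = law_mul x (a *: y);
  law_one_neq0 : law_one != 0
}.

Definition alg_of (L : comNzRingType) (U : lmodType L) (a : alg_law U) : Type := U.

Section AlgOf.
Variables (L : comNzRingType) (U : lmodType L) (a : alg_law U).
HB.instance Definition _ := GRing.Lmodule.on (alg_of a).
HB.instance Definition _ := GRing.Zmodule_isNzRing.Build (alg_of a) (law_mulA a)
  (law_mul1l a) (law_mul1r a) (law_mulDl a) (law_mulDr a) (law_one_neq0 a).
HB.instance Definition _ := GRing.Lmodule_isLalgebra.Build L (alg_of a) (law_mulZl a).
HB.instance Definition _ := GRing.Lalgebra_isAlgebra.Build L (alg_of a) (law_mulZr a).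
End AlgOf.

(** * The Coxeter group of type A2 *)

Section Generation.
Local Open Scope group_scope.
Variables (W : groupType) (H : {pred W}) (HG : group_closed H).

Definition sgroup := {x : W | x \in H}.
HB.instance Definition _ := SubChoice.on sgroup.
HB.instance Definition _ := SubChoice_isSubGroup.Build W H sgroup HG.

(** The universal property gives a morphism from [W] to [H] that fixes [S]. Followed
    by the inclusion, it is the identity of [W], by uniqueness. *)
Lemma coxeter_generated (S : set W) : coxeter_system S -> (forall s, S s -> s \in H) ->
  forall x, x \in H.
Proof.
move=> [_ univ] SH x.
pose f (w : W) : sgroup := insubd (1 : sgroup) w.
have fS s : S s -> val (f s) = s by move=> /SH sH; rewrite val_insubd sH.
have [|phi [[phiM phiS] _]] := univ sgroup f.
  move=> s t Ss St n e; apply: val_inj.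
  have valX (u : sgroup) : val (u ^+ n) = val u ^+ n by exact: (gmulfXn val).
  by rewrite valX valM !fS // e val1.
have [|psi [_ psiU]] := univ W id; first by [].
have e1 : forall y z, (val \o phi) (y * z) = (val \o phi) y * (val \o phi) z.
  by move=> y z; rewrite -[LHS]/(val (phi (y * z))) phiM valM.
have e2 s : S s -> (val \o phi) s = s by move=> Ss; rewrite /= phiS // fS.
have e := psiU _ (conj e1 e2).
have /psiU e' : (forall x y : W, id (x * y) = id x * id y) /\ (forall s, S s -> id s = s) by [].
by rewrite -[x]/(id x) -e' e; exact: (valP (phi x)).
Qed.
End Generation.

(** The code [k + 3 b] stands for [c^k s^b], where [c] is a rotation of order 3
    and [s] a reflection. *)
Definition mulc (i j : nat) : nat :=
  ((i %% 3 + (if i < 3 then j %% 3 else 3 - j %% 3)) %% 3 + 3 * ((i %/ 3 + j %/ 3) %% 2))%N.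

Definition invc (i : nat) : nat := nth 0%N [:: 0; 2; 1; 3; 4; 5]%N i.

Definition A2_coding (W : groupType) (S : set W) (g : nat -> W) : Prop :=
  [/\ forall i j, (i < 6)%N -> (j < 6)%N -> g (mulc i j) = (g i * g j)%g,
      forall i j, (i < 6)%N -> (j < 6)%N -> g i = g j -> i = j,
      forall x, exists2 i, (i < 6)%N & x = g i & S = [set g 3%N; g 5%N]].

Lemma codes_all (P : pred nat) : all P (iota 0 6) -> forall i, (i < 6)%N -> P i.
Proof. by move=> /allP h i i6; apply: h; rewrite mem_iota. Qed.

Lemma mulc_lt i j : (i < 6)%N -> (j < 6)%N -> (mulc i j < 6)%N.
Proof.
move=> i6 j6; move: j j6; apply: codes_all; move: i i6; apply: codes_all.
by vm_compute.
Qed.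

Lemma invc_lt i : (i < 6)%N -> (invc i < 6)%N.
Proof. by move: i; apply: codes_all. Qed.

Section Codes.
Local Open Scope group_scope.
Variables (W : groupType) (S : set W).
Hypotheses (coxS : coxeter_system S) (typeS : type_A2 S).

(** With [c = s t] one has [s c = c^-1 s], so the words [c^k s^b] form a subgroup that
    contains [S]. They are distinct because none of [c], [c^2], [s], [c s = s t s]
    and [c^2 s = t] is trivial. *)
Lemma A2_coded : exists g, A2_coding S g.
Proof.
have [s [t [SE st c3 c12]]] := typeS; have [inv _] := coxS.
have [s1 ss] : s != 1 /\ s * s = 1 by apply: inv; rewrite SE; left.
have [t1 tt] : t != 1 /\ t * t = 1 by apply: inv; rewrite SE; right.
move: c3 c12; set c := s * t => c3 c12; have cE : c = s * t by [].
clearbody c.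
have sc : s * c = c ^+ 2 * s.
  apply: (@mulgI _ c); rewrite [RHS]mulgA -expgS c3 mul1g cE.
  by rewrite !mulgA -(mulgA (s * t) s s) ss mulg1 -(mulgA s t t) tt mulg1.
have cmod n : c ^+ (n %% 3) = c ^+ n by rewrite {2}(divn_eq n 3) expgnDr mulnC expgnA c3 expg1n mul1g.
have smod n : s ^+ (n %% 2) = s ^+ n.
  by rewrite {2}(divn_eq n 2) expgnDr mulnC expgnA expg2 ss expg1n mul1g.
have scn l : (l <= 3)%N -> s * c ^+ l = c ^+ (3 - l) * s.
  have scn' m : s * c ^+ m = c ^+ (2 * m) * s.
    elim: m => [|m IH]; first by rewrite muln0 !expg0 mulg1 mul1g.
    by rewrite expgS mulgA sc -mulgA IH mulgA -expgnDr mulnS.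
  move=> l3; rewrite scn' -(cmod (2 * l)%N) -(cmod (3 - l)%N); congr (c ^+ _ * s).
  by case: l l3 => [|[|[|[|]]]].
pose g i := c ^+ (i %% 3) * s ^+ (i %/ 3).
have gM i j : (i < 6)%N -> (j < 6)%N -> g (mulc i j) = g i * g j.
  have modE k b : ((k %% 3 + 3 * (b %% 2)) %% 3)%N = (k %% 3)%N.
    by rewrite addnC mulnC modnMDl modn_mod.
  have divE k b : ((k %% 3 + 3 * (b %% 2)) %/ 3)%N = (b %% 2)%N.
    by rewrite addnC mulnC divnMDl // (divn_small (ltn_pmod _ _)) // addn0.
  move=> i6 j6; rewrite /g /mulc modE divE cmod smod !expgnDr mulgA -!mulgA; congr (_ * _).
  rewrite !mulgA; congr (_ * _).
  case: ltnP => i3; first by rewrite (divn_small i3) expg0 mulg1 mul1g.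
  have -> : (i %/ 3 = 1)%N by apply/eqP; rewrite eqn_leq -ltnS ltn_divLR // leq_divRL // i6.
  by rewrite expg1 scn // ltnW // ltn_pmod.
have g0 : g 0%N = 1 by exact: (mulg1 1).
have g1E : g 1%N = c by exact: (mulg1 c).
have g2E : g 2%N = c ^+ 2 by exact: (mulg1 (c ^+ 2)).
have g3E : g 3%N = s by exact: (mul1g s).
have g4E : g 4%N = c * s by [].
have g5E : g 5%N = t by rewrite -[LHS]/(c ^+ 2 * s) -sc cE mulgA ss mul1g.
have gV i : (i < 6)%N -> g (invc i) * g i = 1.
  move=> i6; rewrite -gM ?invc_lt //; suff -> : mulc (invc i) i = 0%N by [].
  by apply/eqP; move: i i6; apply: codes_all.
have g1 k : (k < 6)%N -> g k = 1 -> k = 0%N.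
  case: k => [//|[|[|[|[|[|//]]]]]] _ /eqP; rewrite ?(g1E, g2E, g3E, g4E, g5E).
  - by rewrite -[c]expg1 (negPf (c12 1%N _)).
  - by rewrite (negPf (c12 2%N _)).
  - by rewrite (negPf s1).
  - move=> /eqP e; case/negP: t1; apply/eqP.
    have : s * (c * s) * s = 1 by rewrite e mulg1 ss.
    by rewrite !mulgA -(mulgA _ s s) ss mulg1 cE mulgA ss mul1g.
  - by rewrite (negPf t1).
have gS : S = [set g 3%N; g 5%N].
  by rewrite g3E g5E.
have gI i j : (i < 6)%N -> (j < 6)%N -> g i = g j -> i = j.
  move=> i6 j6 e; have : mulc (invc i) j = 0%N.
    by apply: g1; rewrite ?mulc_lt ?invc_lt // gM ?invc_lt // -e gV.
  move=> /eqP h; apply/eqP; move: h; apply/implyP.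
  by move: j j6 {e}; apply: codes_all; move: i i6; apply: codes_all; vm_compute.
exists g; split=> // x; pose H : {pred W} := [pred x | x \in [seq g i | i <- iota 0 6]].
have HE y : y \in H -> exists2 i, (i < 6)%N & y = g i.
  by move=> /mapP[i]; rewrite mem_iota => i6 ->; exists i.
have EH i : (i < 6)%N -> g i \in H by move=> i6; apply/mapP; exists i; rewrite ?mem_iota.
have HG : group_closed H.
  split=> [|u v /HE[i i6 ->] /HE[j j6 ->]]; first by rewrite -g0; exact: EH.
  have -> : (g j)^-1 = g (invc j).
    by apply: (@mulIg _ (g j)); rewrite gV // mulVg.
  by rewrite -gM ?invc_lt //; apply: EH; rewrite mulc_lt ?invc_lt.
by apply: HE; apply: (coxeter_generated HG coxS) => r; rewrite gS => -[] ->; exact: EH.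
Qed.
End Codes.

(** Subsets of the group are coded by their characteristic vectors, so that a
    statement on all subsets is verified by computation on 64 vectors. *)
Fixpoint masks (n : nat) : seq (seq bool) :=
  if n is n'.+1 then [seq b :: m | b <- [:: true; false], m <- masks n'] else [:: [::]].

Lemma mem_masks n m : size m = n -> m \in masks n.
Proof.
elim: n m => [|n IH] [|b m] //= [/IH h]; rewrite !mem_cat.
by case: b; rewrite (map_f _ h) ?orbT.
Qed.

Lemma masks_size n m : m \in masks n -> size m = n.
Proof.
elim: n m => [|n IH] m /=; first by rewrite inE => /eqP ->.
by rewrite !mem_cat in_nil orbF => /orP[] /mapP[m' /IH <- ->].
Qed.

Definition refl_codes : seq nat := [:: 3; 4; 5]%N.
Definition mget (m : seq bool) i := nth false m i.
Definition mfun (f : pred nat) : seq bool := mkseq f 6.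
Definition mact (k : nat) m := mfun (fun i => mget m (mulc k i)).
Definition mcup m m' := mfun (fun i => mget m i || mget m' i).
Definition mcap m m' := mfun (fun i => mget m i && mget m' i).
Definition mdiff m m' := mfun (fun i => mget m i && ~~ mget m' i).
Definition mone := mfun (pred1 0%N).
Definition mstable m := has id m && has (fun k => mact k m == m) refl_codes.
Definition mgood m := mstable m || (m == mone).

(** The vector [m] codes [A] and [k] codes [t]: the difference [tA - A] is empty or a
    coset [{x, r x}] for a reflection [r] other than [t]. *)
Definition msplit m k := let D := mdiff (mact k m) m in
  (~~ has id D) || has (fun j => (j != k) &&
     has (fun x => D == mfun (fun i => (i == x) || (i == mulc j x))) (iota 0 6)) refl_codes.

Lemma msplit_all : all (fun m => all (fun k => mstable m ==> msplit m k) refl_codes) (masks 6).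
Proof. by vm_compute. Qed.

(** One round of closure under [A |-> A u tA] and [A |-> A n tA], leaving out the
    empty set. *)
Definition mstep (ms : seq (seq bool)) : seq (seq bool) :=
  undup (ms ++ [seq mcup m (mact k m) | m <- ms, k <- refl_codes] ++
         [seq m <- [seq mcap m (mact k m) | m <- ms, k <- refl_codes] | has id m]).

Lemma mbraid_all : all (fun j => all (fun k => (j != k) ==>
  (mulc (mulc j k) (mulc (mulc j k) (mulc j k)) == 0%N)) refl_codes) refl_codes.
Proof. by vm_compute. Qed.

Lemma mstep_all : all (fun m => mstable m ==> (m \in iter 5 mstep [:: mone])) (masks 6).
Proof. by vm_compute. Qed.

Definition mlabels := [seq m <- masks 6 | mgood m].

Lemma mlabels_size : size mlabels = 20%N. Proof. by vm_compute. Qed.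
Lemma mlabels_uniq : uniq mlabels. Proof. by vm_compute. Qed.

Section Masks.
Variables (W : groupType) (S : set W) (g : nat -> W).
Hypothesis cod : A2_coding S g.

Let gM i j : (i < 6)%N -> (j < 6)%N -> g (mulc i j) = (g i * g j)%g.
Proof. by case: cod => + _ _ _; apply. Qed.
Let gI i j : (i < 6)%N -> (j < 6)%N -> g i = g j -> i = j.
Proof. by case: cod => _ + _ _; apply. Qed.
Let gP x : exists2 i, (i < 6)%N & x = g i. Proof. by case: cod. Qed.
Let SE : S = [set g 3%N; g 5%N]. Proof. by case: cod. Qed.
Let g0 : g 0%N = 1%g.
Proof. by apply: (@mulgI _ (g 0%N)); rewrite -gM // mulg1. Qed.
Let gV i : (i < 6)%N -> (g i)^-1%g = g (invc i).
Proof.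
move=> i6; apply: (@mulIg _ (g i)); rewrite mulVg -gM ?invc_lt // -g0; congr g.
by apply/esym/eqP; move: i i6; apply: codes_all.
Qed.

Let refl_lt k : k \in refl_codes -> (k < 6)%N.
Proof. by rewrite !inE => /or3P[] /eqP ->. Qed.

Lemma reflections_coded x : reflections S x <-> exists2 k, k \in refl_codes & x = g k.
Proof.
split=> [[w [s [Ss ->]]]|[k kr ->]].
  have [i i6 ->] := gP w; rewrite gV //.
  have [k kS ->] : exists2 k, k \in [:: 3; 5]%N & s = g k.
    by move: Ss; rewrite SE => -[] ->; [exists 3%N|exists 5%N].
  have k6 : (k < 6)%N by move: kS; rewrite !inE => /orP[] /eqP ->.
  rewrite -!gM ?mulc_lt ?invc_lt //; eexists; last by [].
  move: k kS {k6}; apply/allP; move: i i6; apply: codes_all; by vm_compute.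
have S3 : S (g 3%N) by rewrite SE; left.
have S5 : S (g 5%N) by rewrite SE; right.
move: kr; rewrite !inE => /or3P[] /eqP ->.
- by exists 1%g, (g 3%N); rewrite invg1 mulg1 mul1g.
- by exists (g 3%N), (g 5%N); rewrite gV // -!gM.
- by exists 1%g, (g 5%N); rewrite invg1 mulg1 mul1g.
Qed.

Lemma coded_order r t : reflections S r -> reflections S t ->
  (t * t = 1 /\ (r != t -> (r * t) ^+ 3 = 1))%g.
Proof.
move=> /reflections_coded[j jr ->] /reflections_coded[k kr ->].
have j6 := refl_lt jr; have k6 := refl_lt kr; split.
  rewrite -gM // -g0; congr g; apply/eqP; move: k kr {k6}; exact/allP.
move=> jk; rewrite !expgS expg0 mulg1 -!gM ?mulc_lt // -g0; congr g; apply/eqP.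
have /implyP : (j != k) ==> (mulc (mulc j k) (mulc (mulc j k) (mulc j k)) == 0%N).
  by move/allP: mbraid_all => /(_ j jr)/allP/(_ k kr).
by apply; apply: contraNneq jk => ->.
Qed.

Definition setm (m : seq bool) : set W := [set x | exists2 i, (i < 6)%N && mget m i & x = g i].

Lemma setmE m i : (i < 6)%N -> setm m (g i) <-> mget m i.
Proof.
move=> i6; split=> [[j /andP[j6 mj] /(gI i6 j6) ->//]|mi].
by exists i; rewrite ?i6.
Qed.

Lemma set_coded (A B : set W) : (forall i, (i < 6)%N -> A (g i) <-> B (g i)) -> A = B.
Proof. by move=> h; apply/funext => x; have [i i6 ->] := gP x; exact/propext/h. Qed.

Lemma mget_mfun f i : (i < 6)%N -> mget (mfun f) i = f i.
Proof. by move=> i6; rewrite /mget nth_mkseq. Qed.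

Lemma setm_mfun f i : (i < 6)%N -> setm (mfun f) (g i) <-> f i.
Proof. by move=> i6; rewrite setmE // mget_mfun. Qed.

Lemma mfun_size f : size (mfun f) = 6%N. Proof. exact: size_mkseq. Qed.

Lemma setm_inj m m' : size m = 6%N -> size m' = 6%N -> setm m = setm m' -> m = m'.
Proof.
move=> s s' e; apply: (@eq_from_nth _ false); rewrite s // => i i6.
by apply/idP/idP => h; apply/(setmE _ i6); [rewrite -e|rewrite e]; apply/(setmE _ i6).
Qed.

Lemma setm_surj A : exists2 m, size m = 6%N & A = setm m.
Proof.
exists (mfun (fun i => `[< A (g i) >])); first exact: mfun_size.
by apply: set_coded => i i6; rewrite setm_mfun //; split=> /asboolP.
Qed.

Lemma setm_act k m : k \in refl_codes -> setm (mact k m) = [set (g k * a)%g | a in setm m].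
Proof.
move=> kr; have k6 := refl_lt kr.
have kk : (g k * g k = 1)%g.
  by rewrite -gM // -g0; congr g; apply/eqP; move: k kr {k6}; exact/allP.
apply: set_coded => i i6; rewrite setm_mfun // -setmE ?mulc_lt // gM //; split.
  by move=> h; exists (g k * g i)%g; rewrite // mulgA kk mul1g.
by move=> [a h <-]; rewrite mulgA kk mul1g.
Qed.

Lemma setm_cup m m' : setm (mcup m m') = setm m `|` setm m'.
Proof.
apply: set_coded => i i6; rewrite setm_mfun //.
by split=> [/orP[]|[]] /(setmE _ i6) h; [left|right| |]; rewrite ?h ?orbT //; apply/(setmE _ i6).
Qed.

Lemma setm_cap m m' : setm (mcap m m') = setm m `&` setm m'.
Proof.
apply: set_coded => i i6; rewrite setm_mfun //.
by split=> [/andP[h h']|[/(setmE _ i6) -> /(setmE _ i6) ->]//]; split; apply/(setmE _ i6).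
Qed.

Lemma setm_diff m m' : setm (mdiff m m') = setm m `\` setm m'.
Proof.
apply: set_coded => i i6; rewrite setm_mfun //.
split=> [/andP[h /negP h']|[/(setmE _ i6) -> h]]; first by split=> [|/(setmE _ i6)//]; apply/(setmE _ i6).
by apply/negP => /(setmE _ i6).
Qed.

Lemma setm_has m : size m = 6%N -> has id m <-> setm m !=set0.
Proof.
move=> s; split=> [/(has_nthP false)[i]|[x [i /andP[i6 mi] xE]]].
  by rewrite s => i6 mi; exists (g i); apply/setmE.
by apply/(has_nthP false); exists i; rewrite ?s.
Qed.

Lemma setm_one : setm mone = [set 1%g].
Proof.
apply: set_coded => i i6; rewrite setm_mfun //= -g0.
by split=> [/eqP ->//|/(gI i6) ->].
Qed.

Lemma setm_stable m : size m = 6%N -> mstable m <-> reflection_stable S (setm m).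
Proof.
move=> s; split=> [/andP[/(setm_has s) h /hasP[k kr /eqP e]]|[/(setm_has s) h [t]]].
  split=> //; exists (g k); first by apply/reflections_coded; exists k.
  by rewrite -setm_act // e.
move=> /reflections_coded[k kr ->]; rewrite -setm_act // => e.
apply/andP; split=> //; apply/hasP; exists k => //; apply/eqP.
by apply: setm_inj => //; exact: mfun_size.
Qed.

Lemma setm_good m : size m = 6%N -> mgood m <->
  reflection_stable S (setm m) \/ setm m = [set 1%g].
Proof.
move=> s; rewrite -setm_stable // -setm_one; split=> [/orP[|/eqP ->]|[|h]]; [by left|by right| |].
  by rewrite /mgood => ->.
by rewrite /mgood (@setm_inj m mone) ?eqxx ?orbT // mfun_size.
Qed.

Lemma coded_labels : exists L : seq (set W), [/\ uniq L, size L = 20%N &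
  forall A, A \in L <-> reflection_stable S A \/ A = [set 1%g]].
Proof.
exists [seq setm m | m <- mlabels]; split.
- rewrite map_inj_in_uniq ?mlabels_uniq // => m m'.
  rewrite !mem_filter => /andP[_ /masks_size h] /andP[_ /masks_size h']; exact: setm_inj.
- by rewrite size_map mlabels_size.
- move=> A; split=> [/mapP[m + ->]|].
    by rewrite mem_filter => /andP[h /masks_size s]; apply/setm_good.
  have [m s ->] := setm_surj A => /(setm_good s) h.
  by apply: map_f; rewrite mem_filter h mem_masks.
Qed.

(** For [t]-stable [A] the difference is empty. Otherwise [A] is stable under another
    reflection and is a pair or the complement of a pair. *)
Lemma coded_split A t : reflection_stable S A -> reflections S t ->
  let D := [set (t * a)%g | a in A] `\` A in
  D = set0 \/ exists x r, [/\ reflections S r, r <> t & D = [set x; (r * x)%g]].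
Proof.
move=> stA /reflections_coded[k kr ->] /=; have [m s AE] := setm_surj A.
have k6 := refl_lt kr.
rewrite AE -setm_act // -setm_diff; rewrite AE in stA.
have /implyP/(_ ((setm_stable s).2 stA))/orP[h|/hasP[j jr /andP[jk /hasP[i i6 /eqP ->]]]] :
    mstable m ==> msplit m k.
  by move/allP: msplit_all => /(_ m (mem_masks s))/allP/(_ k kr).
  left; apply: set_coded => i i6; rewrite setmE //; split=> // hi.
  case/negP: h; apply/(has_nthP false); exists i; last exact: hi.
  by rewrite /mdiff mfun_size.
right; exists (g i), (g j); have j6 := refl_lt jr.
rewrite mem_iota in i6; split; first by apply/reflections_coded; exists j.
  by move=> /(gI j6 k6) e; rewrite e eqxx in jk.
apply: set_coded => l l6; rewrite setm_mfun // -gM //; split.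
  by move=> /orP[] /eqP ->; [left|right].
by move=> [/(gI l6 i6)|/(gI l6 (mulc_lt j6 i6))] ->; rewrite eqxx ?orbT.
Qed.

(** An induction principle: five rounds of unions and intersections reach every
    stable set from [{1}]. *)
Lemma coded_gen (P : set W -> Prop) : P [set 1%g] ->
  (forall A t, P A -> reflections S t -> P (A `|` [set (t * a)%g | a in A])) ->
  (forall A t, P A -> reflections S t -> A `&` [set (t * a)%g | a in A] !=set0 ->
     P (A `&` [set (t * a)%g | a in A])) ->
  forall A, reflection_stable S A -> P A.
Proof.
move=> P1 PU PI A; have [m s ->] := setm_surj A => /(setm_stable s) st.
have : m \in iter 5 mstep [:: mone].
  by move/allP: mstep_all => /(_ m (mem_masks s)); rewrite st.
move: 5%N => n; elim: n m {s st} => [|n IH] m /=; first by rewrite inE => /eqP ->; rewrite setm_one.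
have rc k : k \in refl_codes -> reflections S (g k) by move=> kr; apply/reflections_coded; exists k.
rewrite mem_undup !mem_cat => /or3P[/IH//|/allpairsP[[m' k] [/IH h /= kr ->]]|].
  by rewrite setm_cup setm_act //; apply: PU => //; exact: rc.
rewrite mem_filter => /andP[ne /allpairsP[[m' k] [/IH h /= kr e]]].
move: ne; rewrite e => /(setm_has (mfun_size _)); rewrite setm_cap setm_act //.
by apply: PI => //; exact: rc.
Qed.

Lemma coded_finite : exists e : seq W, forall x, x \in e.
Proof.
exists [seq g i | i <- iota 0 6] => x; have [i i6 ->] := gP x.
by apply: map_f; rewrite mem_iota.
Qed.
End Masks.

(** * Polynomial functions *)

Section Domain.
Variables (K : realType) (E : vectType K).

Lemma poly_all_roots (p : {poly K}) : (forall c, p.[c] = 0) -> p = 0.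
Proof.
move=> p0; apply/eqP; apply: contraT => /max_poly_roots h.
have := h [seq n%:R | n <- iota 0 (size p)]; rewrite size_map size_iota ltnn => h'.
apply: h'; first by apply/allP => _ /mapP[n _ ->]; apply/eqP.
by rewrite map_inj_uniq ?iota_uniq // => a b /eqP; rewrite eqr_nat => /eqP.
Qed.

Lemma polyfun_line (f : E -> K) (a b : E) : polyfun f ->
  exists p : {poly K}, forall c, f (a + c *: b) = p.[c].
Proof.
elim=> [k|l|{}f g _ [p pE] _ [q qE]|{}f g _ [p pE] _ [q qE]].
- by exists k%:P => c; rewrite hornerC.
- exists ((l a)%:P + l b *: 'X) => c.
  by rewrite linearD /= scalarZ hornerD hornerC hornerZ hornerX mulrC.
- by exists (p + q) => c; rewrite hornerD -pE -qE.
- by exists (p * q) => c; rewrite hornerM -pE -qE.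
Qed.

(** On the lines through a point where [f] does not vanish, this is the integrality
    of the ring of polynomials in one variable. *)
Lemma polyfun_domain (f g : E -> K) : polyfun f -> polyfun g ->
  (forall x, f x * g x = 0) -> (exists x, f x != 0) -> forall x, g x = 0.
Proof.
move=> hf hg fg [a fa] x; have [p pE] := polyfun_line a (x - a) hf.
have [q qE] := polyfun_line a (x - a) hg.
have /eqP : p * q = 0 by apply: poly_all_roots => c; rewrite hornerM -pE -qE.
rewrite mulf_eq0 => /orP[] /eqP z.
  by case/eqP: fa; rewrite -[a]addr0 -(scale0r (x - a)) pE z horner0.
by have := qE 1; rewrite scale1r addrC subrK z horner0.
Qed.

End Domain.

Section PolyRing.
Variables (K : realType) (E : vectType K).

Definition pev (f : polyring E) (x : E) : K := val f x.

Lemma pev_ext (f g : polyring E) : (forall x, pev f x = pev g x) -> f = g.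
Proof. by move=> h; apply/val_inj/funext. Qed.

Lemma pevD (f g : polyring E) x : pev (f + g) x = pev f x + pev g x. Proof. by []. Qed.
Lemma pevN (f : polyring E) x : pev (- f) x = - pev f x. Proof. by []. Qed.
Lemma pevB (f g : polyring E) x : pev (f - g) x = pev f x - pev g x. Proof. by []. Qed.
Lemma pevM (f g : polyring E) x : pev (f * g) x = pev f x * pev g x. Proof. by []. Qed.
Lemma pev0 x : pev 0 x = 0. Proof. by []. Qed.
Lemma pev1 x : pev 1 x = 1. Proof. by []. Qed.
Definition pevE := (pevD, pevN, pevM, pev0, pev1).

Lemma polyfun_pev (f : polyring E) : polyfun (pev f).
Proof. exact: polyring_polyfun. Qed.

Definition mkpoly (f : E -> K) (hf : polyfun f) : polyring E :=
  exist (fun f : E -> K => is_true (f \in @polyfun_pred K E)) f (asboolT hf).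

Lemma pev_mk f (hf : polyfun f) x : pev (mkpoly hf) x = f x. Proof. by []. Qed.

Definition pcst (c : K) : polyring E := mkpoly (polyfun_cst c).
Definition plin (l : {scalar E}) : polyring E := mkpoly (polyfun_lin l).

Lemma pcst_deg c : gring_deg 0 (pcst c).
Proof. by right; exists 0%N => //; exact: homogfun_cst. Qed.

Lemma homog_lin (l : {scalar E}) : homogfun 1 l.
Proof.
have -> : (l : E -> K) = (l : E -> K) * (fun=> 1) by apply/funext => x; rewrite /= [RHS]mulr1.
by apply: homogfun_lin; exact: homogfun_cst.
Qed.

Lemma plin_deg l : gring_deg 2 (plin l).
Proof. by right; exists 1%N => //; exact: homog_lin. Qed.

Lemma pring_domain (f g : polyring E) : f * g = 0 -> f <> 0 -> g = 0.
Proof.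
move=> fg f0; apply: pev_ext; apply: (polyfun_domain (polyfun_pev f) (polyfun_pev g)).
  by move=> x; rewrite -pevM fg.
by apply: contrapT => h; apply: f0; apply: pev_ext => x; apply/eqP; apply: contra_notT h; exists x.
Qed.

Lemma polydeg0 (f : E -> K) : polydeg 0 f -> exists c, f = fun=> c.
Proof.
case=> [->|[d d0]]; first by exists 0.
have {d0}-> : d = 0%N by case: d d0.
move: {-2}0%N (erefl 0%N) => n nE h; elim: h nE => // [c _|m f' g' _ IH _ IH' m0].
  by exists c.
by have [[c ->] [c' ->]] := (IH m0, IH' m0); exists (c + c').
Qed.

Lemma polydeg_ge0 i (f : E -> K) : polydeg i f -> f <> 0 -> 0 <= i.
Proof. by case=> [->//|[d -> _] _]. Qed.

End PolyRing.

Section Reflection.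
Variables (K : realType) (E : vectType K) (tau : {linear E -> E}) (al : {scalar E}) (h : E).
Hypotheses (tauE : forall x, tau x = x - al x *: h) (alh : al h = 2).

Let alt x : al (tau x) = - al x.
Proof. by rewrite tauE linearB /= scalarZ alh mulrDr mulr1 opprD addrA subrr sub0r. Qed.

Section Shear.
Variables (l : {scalar E}) (c : K).
Definition lshear (x : E) : K := l x - c * al x.
Lemma lshear_linear : scalar lshear.
Proof. by move=> a x y; rewrite /lshear !linearP /=; ring. Qed.
HB.instance Definition _ := GRing.isLinear.Build K E K *%R lshear lshear_linear.
End Shear.

(** The polynomial functions are free of rank 2 over the functions invariant under a
    reflection, with basis [1] and the root [al]. The component [fm] is half of the
    Demazure divided difference [(f - f tau) / al]; induction on [f] shows that it is
    polynomial, by splitting a linear form into an invariant one and a multiple of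
    [al]. *)
Lemma homog_dem d f : homogfun d f -> exists fp fm : E -> K,
  [/\ homogfun d fp, if d is d'.+1 then homogfun d' fm else fm = 0,
      forall x, fp (tau x) = fp x, forall x, fm (tau x) = fm x
    & forall x, f x = fp x + al x * fm x].
Proof.
elim=> [c|l {}d {}f _ [fp [fm [h1 h2 h3 h4 h5]]]|{}d {}f g _ [fp [fm [h1 h2 h3 h4 h5]]]
    _ [gp [gm [g1 g2 g3 g4 g5]]]].
- exists (fun=> c), 0; split=> // [|x]; first exact: homogfun_cst.
  by rewrite mulr0 addr0.
- pose c := l h / 2; pose lp : {scalar E} := lshear l c.
  have lpt z : lp (tau z) = lp z.
    rewrite /= /lshear alt tauE linearB /= scalarZ mulrN opprK /c.
    by field.
  have lE z : l z = lp z + c * al z by rewrite /= /lshear subrK.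
  exists ((lp : E -> K) * fp + (fun x => c * (al x * (al x * fm x)))).
  exists ((lp : E -> K) * fm + (fun x => c * fp x)); split.
  + apply: homogfunD; first exact: homogfun_lin.
    case: d h1 h2 => [|d] h1 h2.
      rewrite h2 (_ : (fun x => _) = 0); first exact: homogfun0.
      by apply/funext => x; rewrite !mulr0.
    apply: (homogfunZ c (f := (al : E -> K) * ((al : E -> K) * fm))).
    by do 2 apply: homogfun_lin.
  + apply: homogfunD; last exact: (homogfunZ c).
    case: d h1 h2 => [|d] h1 h2; last exact: homogfun_lin.
    by rewrite h2 mulr0; exact: homogfun0.
  + move=> x; rewrite -[LHS]/(lp (tau x) * fp (tau x) + c * (al (tau x) * (al (tau x) * fm (tau x)))).
    rewrite -[RHS]/(lp x * fp x + c * (al x * (al x * fm x))).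
    by rewrite lpt h3 h4 alt; ring.
  + move=> x; rewrite -[LHS]/(lp (tau x) * fm (tau x) + c * fp (tau x)).
    by rewrite lpt h3 h4.
  + move=> x; rewrite -[LHS]/(l x * f x) h5 lE.
    rewrite -[X in _ = X + _]/(lp x * fp x + c * (al x * (al x * fm x))).
    rewrite -[X in _ = _ + al x * X]/(lp x * fm x + c * fp x); ring.
- exists (fp + gp), (fm + gm); split.
  + exact: homogfunD.
  + by case: d h1 h2 g1 g2 => [|d] _ h2 _ g2; [rewrite h2 g2 addr0|exact: homogfunD].
  + by move=> x; rewrite -[LHS]/(fp (tau x) + gp (tau x)) h3 g3.
  + by move=> x; rewrite -[LHS]/(fm (tau x) + gm (tau x)) h4 g4.
  + move=> x; rewrite -[LHS]/(f x + g x) h5 g5.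
    rewrite -[X in _ = X + _]/(fp x + gp x) -[X in _ = _ + al x * X]/(fm x + gm x); ring.
Qed.

Definition tau_inv (f : polyring E) : Prop := forall x, pev f (tau x) = pev f x.

Definition dem_spec (f fp fm : polyring E) : Prop :=
  [/\ tau_inv fp, tau_inv fm & f = fp + plin al * fm].

Lemma tau_invD f g : tau_inv f -> tau_inv g -> tau_inv (f + g).
Proof. by move=> hf hg x; rewrite !pevD hf hg. Qed.
Lemma tau_invM f g : tau_inv f -> tau_inv g -> tau_inv (f * g).
Proof. by move=> hf hg x; rewrite !pevM hf hg. Qed.

Lemma dem_deg i (f : polyring E) : gring_deg i f ->
  exists fp fm, [/\ dem_spec f fp fm, gring_deg i fp & gring_deg (i - 2) fm].
Proof.
case=> [f0|[d -> hf]].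
  exists 0, 0; split; [|by left|by left].
  by split=> //; apply: pev_ext => x; rewrite !pevE mulr0 addr0 /pev f0.
have [fp [fm [h1 h2 h3 h4 h5]]] := homog_dem hf.
have pm : polyfun fm.
  by case: d h2 {h1 hf} => [->|d /homog_polyfun//]; exact: (polyfun_cst 0).
exists (mkpoly (homog_polyfun h1)), (mkpoly pm); split.
- by split=> //; apply: pev_ext => x; exact: h5.
- by right; exists d.
- suff : polydeg (d.*2%:Z - 2) fm by [].
  case: d h2 {h1 hf} => [->|d h2]; first by left.
  by right; exists d => //; rewrite doubleS -addn2 PoszD addrK.
Qed.

Lemma dem_ex (f : polyring E) : exists fp fm, dem_spec f fp fm.
Proof.
have [r [_ _ ->]] := component_supp (gring_grading (polyring E)) f.
elim: r => [|i r [fp [fm [h1 h2 h3]]]].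
  by exists 0, 0; split=> //; rewrite big_nil mulr0 addr0.
have [gp [gm [[g1 g2 g3] _ _]]] := dem_deg (component_gr (gring_grading (polyring E)) i f).
exists (gp + fp), (gm + fm); split; [exact: tau_invD|exact: tau_invD|].
by rewrite big_cons h3 g3 mulrDr addrACA.
Qed.

Lemma plin_al_neq0 : plin al <> 0.
Proof. by move=> /(congr1 (fun f => pev f h)); rewrite /= pev_mk alh pev0 => /eqP; rewrite pnatr_eq0. Qed.

(** Evaluating at [x] and at [tau x] separates the two components, and [al] is not a
    zero divisor. *)
Lemma dem_uniq (f fp fm gp gm : polyring E) : dem_spec f fp fm -> dem_spec f gp gm ->
  fp = gp /\ fm = gm.
Proof.
move=> [h1 h2 ->] [g1 g2 e].
have key x : pev fp x = pev gp x /\ al x * pev fm x = al x * pev gm x.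
  have e1 := congr1 (fun f => pev f x) e; have e2 := congr1 (fun f => pev f (tau x)) e.
  rewrite /= !pevE !pev_mk in e1; rewrite /= !pevE !pev_mk alt h1 h2 g1 g2 in e2.
  by split; lra.
have fg : fp = gp by apply: pev_ext => x; case: (key x).
split=> //; apply/eqP; rewrite -subr_eq0; apply/eqP; apply: pring_domain plin_al_neq0.
by apply: pev_ext => x; rewrite !pevE pev_mk mulrBr (key x).2 subrr.
Qed.

End Reflection.

(** * The bimodules R(A) *)

Section GraphBimod.
Variables (K : realType) (W : groupType) (V : vectType K) (rho : representation W V).
Local Notation R := (polyring V).
Local Notation RR := (polyring (V * V)%type).
Local Notation X := (graph_bimod rho).
Implicit Types (a b : R) (F G H : RR) (A B : set W).

Definition pr1 a : RR := mkpoly (polyfun_comp (@fst V V) (polyring_polyfun a)).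
Definition pr2 a : RR := mkpoly (polyfun_comp (@snd V V) (polyring_polyfun a)).

Lemma pev_pr1 a z : pev (pr1 a) z = pev a z.1. Proof. by []. Qed.
Lemma pev_pr2 a z : pev (pr2 a) z = pev a z.2. Proof. by []. Qed.

Lemma pr1_deg i a : gring_deg i a -> gring_deg i (pr1 a).
Proof. exact: (polydeg_comp (@fst V V)). Qed.
Lemma pr2_deg i a : gring_deg i a -> gring_deg i (pr2 a).
Proof. exact: (polydeg_comp (@snd V V)). Qed.

Section Partial.
Variable l : {scalar (V * V)%type}.
Definition lfst (u : V) : K := l (u, 0).
Definition lsnd (v : V) : K := l (0, v).
Lemma lfst_linear : scalar lfst.
Proof.
move=> c u v; rewrite /lfst -linearP; congr (l _).
by rewrite -[RHS]/(c *: u + v, c *: 0 + 0) scaler0 addr0.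
Qed.
Lemma lsnd_linear : scalar lsnd.
Proof.
move=> c u v; rewrite /lsnd -linearP; congr (l _).
by rewrite -[RHS]/(c *: 0 + 0, c *: u + v) scaler0 addr0.
Qed.
HB.instance Definition _ := GRing.isLinear.Build K V K *%R lfst lfst_linear.
HB.instance Definition _ := GRing.isLinear.Build K V K *%R lsnd lsnd_linear.
Lemma lfst_lsnd z : l z = lfst z.1 + lsnd z.2.
Proof.
rewrite /lfst /lsnd -linearD; congr (l _); case: z => u v.
by rewrite -[RHS]/(u + 0, 0 + v) addr0 add0r.
Qed.
End Partial.

(** Since a linear form on [V * V] is the sum of a form in each variable, the
    functions on [V * V] are generated by [1] under the two actions. *)
Lemma poly_ind2 (Q : RR -> Prop) : Q 1 -> (forall a G, Q G -> Q (pr1 a * G)) ->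
  (forall a G, Q G -> Q (pr2 a * G)) -> (forall G H, Q G -> Q H -> Q (G + H)) ->
  forall G, Q G.
Proof.
move=> Q1 Ql Qr QD.
have Q0 : Q 0.
  have -> : 0 = pr1 0 * 1 by apply: pev_ext => z; rewrite !pevE pev_pr1 pev0 mul0r.
  exact: Ql.
have Qh d f : homogfun d f -> forall hf : polyfun f, Q (mkpoly hf).
  elim=> [c|l {}d {}f df IH|{}d {}f g df IH dg IH'] hf.
  - have -> : mkpoly hf = pr1 (pcst _ c) * 1.
      by apply: pev_ext => z; rewrite pevM pev1 mulr1.
    exact: Ql.
  - have hf' := homog_polyfun df.
    have -> : mkpoly hf = pr1 (plin (lfst l)) * mkpoly hf' + pr2 (plin (lsnd l)) * mkpoly hf'.
      apply: pev_ext => z; rewrite pevD !pevM -mulrDl pev_pr1 pev_pr2 !pev_mk.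
      by rewrite -lfst_lsnd.
    by apply: QD; [apply: Ql|apply: Qr].
  - have -> : mkpoly hf = mkpoly (homog_polyfun df) + mkpoly (homog_polyfun dg).
      by apply: pev_ext => z; rewrite pevD.
    exact: QD.
move=> G; have [r [_ _ ->]] := component_supp (gring_grading RR) G.
elim: r => [|i r IH]; rewrite ?big_nil ?big_cons //; apply: QD => {IH}//.
set C := component _ _ _; have [C0|[d _ hd]] : polydeg i (val C) := component_gr (gring_grading RR) i G.
  by have -> : C = 0 by apply: val_inj.
have -> : C = mkpoly (homog_polyfun hd) by apply: pev_ext.
exact: (Qh _ _ hd).
Qed.

Section OneSet.
Variable A : set W.

Lemma res_subproof G : (pev G \o set_val : graphs rho A -> K) \in @regfun_pred K _ (graphs rho A).
Proof. by apply/asboolP; exists (pev G) => //; exact: polyfun_pev. Qed.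

Definition res G : X A :=
  exist (fun g => is_true (g \in @regfun_pred K _ (graphs rho A))) _ (res_subproof G).

Lemma resP (g : X A) : exists G, g = res G.
Proof.
have /asboolP[f hf e] := valP g; exists (mkpoly hf).
by apply: val_inj; rewrite /= e.
Qed.

Lemma graphP x v : A x -> graphs rho A (rho x v, v).
Proof. by move=> Ax; exists x => //; exists v. Qed.

Lemma res_eq G H : res G = res H <-> forall x, A x -> forall v,
  pev G (rho x v, v) = pev H (rho x v, v).
Proof.
split=> [e x Ax v|h].
  exact: (congr1 (fun g : X A => val g (SigSub (mem_set (graphP v Ax)))) e).
apply: val_inj; apply/funext => -[z zA] /=.
have [x Ax [v _ zE]] := set_mem zA.
by rewrite -[set_val _]/z -zE; exact: h.
Qed.

Lemma resD G H : res (G + H) = res G + res H. Proof. exact: val_inj. Qed.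
Lemma res0 : res 0 = 0. Proof. exact: val_inj. Qed.
Lemma resL a G : res (pr1 a * G) = lact a (res G). Proof. exact: val_inj. Qed.
Lemma resR a G : res (pr2 a * G) = ract (res G) a.
Proof. by apply: val_inj; apply/funext. Qed.

Lemma res_deg i G : gring_deg i G -> gdeg i (res G).
Proof. by move=> h; exists (pev G). Qed.

Lemma res_degP i (g : X A) : gdeg i g -> exists2 G, gring_deg i G & g = res G.
Proof.
move=> [f hf e]; exists (mkpoly (polydeg_polyfun hf)) => //.
by apply: val_inj; rewrite /= e.
Qed.

Lemma res1_neq0 : A !=set0 -> res 1 <> 0.
Proof.
move=> [x Ax]; rewrite -res0 => /res_eq/(_ x Ax 0) /eqP.
by rewrite pev1 pev0 oner_eq0.
Qed.

Lemma graph_ge0 i (g : X A) : gdeg i g -> g <> 0 -> 0 <= i.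
Proof.
move=> /res_degP[G hG ->] nz; apply: (polydeg_ge0 hG) => e; apply: nz.
by rewrite -res0; apply/res_eq => x _ v; rewrite /pev e.
Qed.

(** As a bimodule, R(A) is generated by its unit, which is homogeneous of degree 0. *)
Lemma ghom_res1 (N : gbimod R) (f f' : X A -> N) :
  {morph f : x y / x + y} -> (forall a m, f (lact a m) = lact a (f m)) ->
  (forall m a, f (ract m a) = ract (f m) a) ->
  {morph f' : x y / x + y} -> (forall a m, f' (lact a m) = lact a (f' m)) ->
  (forall m a, f' (ract m a) = ract (f' m) a) ->
  f (res 1) = f' (res 1) -> f =1 f'.
Proof.
move=> fD fL fR fD' fL' fR' e g; have [G ->] := resP g; move: G.
apply: poly_ind2 => // [a G IH|a G IH|G H IH IH'].
- by rewrite resL fL fL' IH.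
- by rewrite resR fR fR' IH.
- by rewrite resD fD fD' IH IH'.
Qed.

Lemma lact_pcst c (g : X A) a : lact (pcst V c) (lact a g) = lact a (lact (pcst V c) g).
Proof. by rewrite -!lactM mulrC. Qed.

(** The endomorphisms of degree 0 are determined by the image of the unit, which
    is a constant. *)
Lemma graph_brick : A !=set0 -> brick (X A).
Proof.
move=> A0; split=> [z|f hf]; first exact: (res1_neq0 A0).
have [C hC e] : exists2 C, gring_deg 0 C & f (res 1) = res C.
  by apply: res_degP; apply: (ghom_deg hf); apply: res_deg; exact: gring_deg1.
have [c cE] := polydeg0 hC.
have lc (k : K) : ghom (lact (pcst V k) : X A -> X A).
  split=> [g g'|a m|m a|i m hm]; [exact: lactDr|exact: lact_pcst|exact: lractA|].
  by rewrite -[i]add0r; apply: gdeg_lact => //; exact: pcst_deg.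
have fE : f =1 lact (pcst V c).
  apply: ghom_res1.
  - exact: ghomD.
  - exact: ghomL.
  - exact: ghomR.
  - exact: (ghomD (lc c)).
  - exact: (ghomL (lc c)).
  - exact: (ghomR (lc c)).
  - rewrite e -resL; apply/res_eq => x _ v.
    by rewrite pevM pev1 mulr1 /pev cE.
have [c0|c0] := eqVneq c 0.
  left=> g; rewrite fE c0; have -> : pcst V 0 = 0 by apply: pev_ext.
  exact: lact0l.
have inv k : k != 0 -> cancel (lact (pcst V k) : X A -> X A) (lact (pcst V k^-1)).
  move=> k0 g; rewrite -lactM; have -> : pcst V k^-1 * pcst V k = 1.
    by apply: pev_ext => x; rewrite pevM !pev_mk mulVf.
  exact: lact1.
right; exists (lact (pcst V c^-1)); split=> [|g|g]; first exact: lc.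
  by rewrite fE inv.
by rewrite fE -[X in lact (pcst V X) _]invrK inv // invr_eq0.
Qed.
End OneSet.

(** The image of the unit is a constant [c], so that [f] sends the restriction of [G]
    to [A] to [c] times its restriction to [B]. Hence an injective [f] forces the
    functions that vanish on the graphs of [B] to vanish on those of [A]. *)
Lemma res_iso_sub A B (f : X A -> X B) G : ghom f -> injective f ->
  res B G = 0 -> gdeg 0 (f (res A 1)) -> res A G = 0.
Proof.
move=> hf fI G0 /res_degP[C hC e]; have [c cE] := polydeg0 hC.
have key : f (res A G) = lact (pcst V c) (res B G).
  move: (G); apply: poly_ind2 => // [|a H IH|a H IH|H H' IH IH'].
  - by rewrite e -resL; apply/res_eq => x _ v; rewrite pevM pev1 mulr1 /pev cE.
  - by rewrite !resL (ghomL hf) IH -!lactM mulrC.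
  - by rewrite !resR (ghomR hf) IH lractA.
  - by rewrite !resD (ghomD hf) IH IH' lactDr.
by apply: fI; rewrite key G0 lact0 (ghom0 hf).
Qed.

End GraphBimod.

(** * Reflections *)

Section Functional.
Variables (K : realType) (V : vectType K).

Lemma functional_ex (w : V) : w != 0 -> exists l : {scalar V}, l w = 1.
Proof.
move=> w0; have fw : free [tuple w] by rewrite free_cons span_nil memv0 w0 nil_free.
by exists (coord [tuple w] ord0); have := coord_free ord0 ord0 fw; rewrite eqxx.
Qed.

(** The image of [T - 1] is a line by the rank theorem, and [T] is [-1] on it because
    [T (T v - v) = - (T v - v)]. *)
Lemma reflection_form (T : 'End(V)) : (forall v, T (T v) = v) ->
  (\dim (fixedSpace T)).+1 = \dim {:V} ->
  exists (al : {scalar V}) (h : V), (forall v, T v = v - al v *: h) /\ al h = 2.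
Proof.
move=> TT dT; pose D := (T - \1)%VF.
have dD : \dim (D @: {:V}) = 1%N.
  have := limg_ker_dim D {:V}; rewrite capfv => e.
  by apply/eqP; rewrite -(eqn_add2l (\dim (lker D))) e -dT addn1.
have DE v : D v = T v - v by rewrite /D add_lfunE opp_lfunE id_lfunE.
have [h h0 hE] : exists2 h, h != 0 & (D @: {:V} = <[h]>)%VS.
  exists (vpick (D @: {:V})); first by rewrite vpick0 -dimv_eq0 dD.
  apply/eqP; rewrite eq_sym eqEdim -memvE memv_pick dD dim_vline.
  by rewrite vpick0 -dimv_eq0 dD.
have [l lh] := functional_ex h0.
have line v : exists k, D v = k *: h by apply/vlineP; rewrite -hE memv_img ?memvf.
pose f v := l (v - T v).
have fl : scalar f.
  move=> c x y; rewrite /f -[RHS]linearP; congr (l _).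
  by rewrite linearP scalerBr opprD addrACA.
pose al : {scalar V} := HB.pack f (GRing.isLinear.Build K V K *%R f fl).
have TE v : T v = v - al v *: h.
  have [k kE] := line v; rewrite DE in kE.
  have e : v - T v = - k *: h by rewrite scaleNr -kE opprB.
  by rewrite -[al v]/(l (v - T v)) e scalarZ lh mulr1 -e subKr.
exists al, h; split=> //.
have /memv_imgP[v _ hv] : h \in (D @: {:V})%VS by rewrite hE memv_line.
have Th : T h = - h by rewrite hv DE linearB /= TT opprB.
by rewrite -[al h]/(l (h - T h)) Th opprK linearD /= lh.
Qed.

End Functional.

Section SplitForms.
Variables (K : realType) (W : groupType) (S : set W) (V : vectType K).
Variable rho : representation W V.
Hypotheses (coxS : coxeter_system S) (typeS : type_A2 S) (faith : reflection_faithful S rho).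

Lemma rho1 v : rho 1%g v = v. Proof. by rewrite rep1 id_lfunE. Qed.
Lemma rhoM x y v : rho (x * y)%g v = rho x (rho y v). Proof. by rewrite repM comp_lfunE. Qed.
Lemma rhoK x : cancel (rho x) (rho x^-1%g). Proof. by move=> v; rewrite -rhoM mulVg rho1. Qed.
Lemma rhoVK x : cancel (rho x^-1%g) (rho x). Proof. by move=> v; rewrite -rhoM mulgV rho1. Qed.

Lemma refl_order r t : reflections S r -> reflections S t ->
  (t * t = 1 /\ (r != t -> (r * t) ^+ 3 = 1))%g.
Proof. by move=> hr ht; have [g cod] := A2_coded coxS typeS; exact: (coded_order cod hr ht). Qed.

Lemma refl_inv t : reflections S t -> (t * t = 1)%g.
Proof. by move=> h; case: (refl_order h h). Qed.

Lemma refl_form t : reflections S t -> exists (al : {scalar V}) (h : V),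
  (forall v, rho t v = v - al v *: h) /\ al h = 2.
Proof.
move=> ht; apply: reflection_form; last exact/faith.2.
by move=> v; rewrite -rhoM refl_inv // rho1.
Qed.

(** Averaging over [r] any linear form that does not vanish on [h + r h] gives such
    an [la]. If [h + r h = 0], then [r] and [t] have the same coroot line and [r t] is
    unipotent; being of order 3 it is trivial, which contradicts faithfulness. *)
Lemma refl_fixed_form r t (al : {scalar V}) (h : V) : reflections S r -> reflections S t ->
  r <> t -> (forall v, rho t v = v - al v *: h) -> al h = 2 ->
  exists la : {scalar V}, (forall v, la (rho r v) = la v) /\ la h = 2.
Proof.
move=> hr ht rt tE alh; have [w0|w0] := eqVneq (h + rho r h) 0; last first.
  have [l lh] := functional_ex w0; pose f v := 2 * l (v + rho r v).
  have fl : scalar f.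
    move=> c x y; rewrite /f mulrCA -mulrDr -linearP; congr (2 * l _).
    by rewrite linearP scalerDr addrACA.
  pose la : {scalar V} := HB.pack f (GRing.isLinear.Build K V K *%R f fl).
  exists la; split=> [v|]; last by rewrite -[LHS]/(2 * l (h + rho r h)) lh mulr1.
  by rewrite -[LHS]/(2 * l _) -rhoM refl_inv // rho1 addrC.
have rh : rho r h = - h by apply/eqP; rewrite -addr_eq0 addrC w0.
have [be [k [rE bek]]] := refl_form hr.
have h0 : h != 0.
  by apply/eqP => h0; move/eqP: alh; rewrite h0 linear0 eq_sym pnatr_eq0.
have ek : be h *: k = 2 *: h.
  rewrite scaler_nat mulr2n; have := rE h; rewrite rh => e.
  by rewrite -[X in X + _]opprK e opprB subrK.
have b0 : be h != 0.
  by apply/eqP => b0; move/eqP: ek; rewrite b0 scale0r eq_sym scaler_eq0 pnatr_eq0 (negPf h0).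
have kE : k = (2 / be h) *: h.
  by apply: (scalerI b0); rewrite ek scalerA mulrCA divff // mulr1.
pose de v := al v - be v * (2 / be h).
have rtE v : rho (r * t)%g v = v + de v *: h.
  rewrite rhoM tE linearB /= linearZ /= rh rE kE scalerA scalerN opprK -addrA -scaleNr -scalerDl.
  by rewrite addrC /de addrC [- _ + _]addrC.
have deh : de h = 0 by rewrite /de alh mulrCA divff // mulr1 subrr.
have deD v c : de (v + c *: h) = de v.
  by have := deh; rewrite /de !linearD /= !scalarZ => /subr0_eq e; rewrite mulrDl -!mulrA -e; ring.
have [_ /(_ (introN eqP rt)) o3] := refl_order hr ht.
have de0 v : de v = 0.
  have : rho ((r * t) ^+ 3)%g v = v by rewrite o3 rho1.
  rewrite !expgS expg0 mulg1 (rhoM (r * t)%g) (rhoM (r * t)%g) !rtE !deD.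
  rewrite -!addrA -!scalerDl => /(canRL (addKr _)).
  rewrite addNr => /eqP; rewrite scaler_eq0 (negPf h0) orbF => /eqP.
  by move=> e; lra.
case: rt; have e1 : (r * t = 1)%g.
  apply: faith.1; apply/lfunP => v; by rewrite rtE de0 scale0r addr0 rho1.
by apply: (@mulIg _ t); rewrite e1 refl_inv.
Qed.

Definition good_set (A : set W) : Prop := reflection_stable S A \/ A = [set 1%g].

Definition translate (t : W) (A : set W) : set W := [set (t * a)%g | a in A].

Lemma translateE t A x : (t * t = 1)%g -> translate t A x <-> A (t * x)%g.
Proof.
move=> tt; split=> [[a Aa <-]|h]; first by rewrite mulgA tt mul1g.
by exists (t * x)%g; rewrite // mulgA tt mul1g.
Qed.

(** The shape of [A] enters the splitting only here. One needs a linear form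
    [la] with [la - la t = 2 al] that takes the same values on the graphs over
    [tA - A], in the sense that [la w] does not depend on [w] in [tA - A]. If this
    difference is a coset [{x, r x}], a form fixed by [r] will do; for [A = {1}] the
    root itself will. Then [l = la w] and [m = al - la]. *)
Lemma refl_split A t (al : {scalar V}) (h : V) : good_set A -> reflections S t ->
  (forall v, rho t v = v - al v *: h) -> al h = 2 ->
  exists l m : {scalar V},
    (forall w v, A (t * w)%g -> ~ A w -> l v + m (rho w v) = al (rho w v)) /\
    (forall w v, A w -> ~ A (t * w)%g -> l v + m (rho w v) = - al (rho w v)).
Proof.
move=> gA ht tE alh; have tt := refl_inv ht.
have alt v : al (rho t v) = - al v by rewrite tE linearB /= scalarZ alh; ring.
have [la [x [la1 la2]]] : exists (la : {scalar V}) x, (forall v, la (rho t v) = la v - 2 * al v) /\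
    (forall w v, A (t * w)%g -> ~ A w -> la (rho w v) = la (rho x v)).
  have al2 v : al (rho t v) = al v - 2 * al v by rewrite alt; ring.
  case: gA => [sA|->]; last first.
    exists al, t; split=> // w v h1 _; congr (al (rho _ v)).
    by apply: (@mulgI _ t); rewrite h1 tt.
  have [g cod] := A2_coded coxS typeS.
  have [D0|[x [r [hr rt DE]]]] := coded_split cod sA ht.
    exists al, 1%g; split=> // w v h1 h2.
    have : (translate t A `\` A) w by split=> //; apply/translateE.
    by rewrite /translate D0.
  have [la [lar lah]] := refl_fixed_form hr ht rt tE alh.
  exists la, x; split=> [v|w v h1 h2]; first by rewrite tE linearB /= scalarZ lah; ring.
  have : (translate t A `\` A) w by split=> //; apply/translateE.
  by rewrite /translate DE => -[] -> //; rewrite rhoM lar.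
pose f v := la (rho x v); pose f' v := al v - la v.
have fl : scalar f by move=> c u v; rewrite /f !linearP.
have fl' : scalar f' by move=> c u v; rewrite /f' !linearP /=; ring.
pose F : {scalar V} := HB.pack f (GRing.isLinear.Build K V K *%R f fl).
pose F' : {scalar V} := HB.pack f' (GRing.isLinear.Build K V K *%R f' fl').
exists F, F'; split=> w v h1 h2; rewrite -[LHS]/(f v + f' (rho w v)) /f /f'.
  by rewrite (la2 w) //; ring.
have e : la (rho (t * w)%g v) = la (rho x v) by apply: la2 => //; rewrite mulgA tt mul1g.
by rewrite -e rhoM la1; ring.
Qed.

End SplitForms.

(** * Tensoring R(A) over the invariants of a reflection *)

Section KeyIso.
Variables (K : realType) (W : groupType) (V : vectType K) (rho : representation W V).
Local Notation R := (polyring V).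
Local Notation RR := (polyring (V * V)%type).
Local Notation X := (graph_bimod rho).
Variables (A : set W) (t : W) (al : {scalar V}) (h : V) (l m : {scalar V}).
Hypotheses (tt : (t * t = 1)%g) (tE : forall v, rho t v = v - al v *: h) (alh : al h = 2).
Hypothesis split1 :
  forall w v, A (t * w)%g -> ~ A w -> l v + m (rho w v) = al (rho w v).
Hypothesis split2 :
  forall w v, A w -> ~ A (t * w)%g -> l v + m (rho w v) = - al (rho w v).

Let U := A `|` translate t A.
Let I := A `&` translate t A.
Let UE w : U w <-> A w \/ A (t * w)%g.
Proof. by rewrite /U -(translateE A w tt). Qed.
Let IE w : I w <-> A w /\ A (t * w)%g.
Proof. by rewrite /I -(translateE A w tt). Qed.

Let alt v : al (rho t v) = - al v.
Proof. by rewrite tE linearB /= scalarZ alh; ring. Qed.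

(* An element [a (x) g] of the tensor product is regarded as the function
   [a(u) g(z1, z2)] on the points where [(z1, z2)] lies on a graph over [A] and [u] is
   [z1] or [t z1]. The second case occurs at [(u, z2)] on a graph over [tA]. The
   reflection below acts on the variable [z1]. *)
Definition tau2 (z : V * V) : V * V := (rho t z.1, z.2).
Lemma tau2_linear : linear tau2.
Proof. by move=> c y z; rewrite /tau2 !linearP. Qed.
HB.instance Definition _ := GRing.isLinear.Build K (V * V)%type (V * V)%type *:%R tau2 tau2_linear.

Definition al2 (z : V * V) : K := al z.1.
Lemma al2_linear : scalar al2.
Proof. by move=> c y z; rewrite /al2 !linearP. Qed.
HB.instance Definition _ := GRing.isLinear.Build K (V * V)%type K *%R al2 al2_linear.

Lemma tau2E z : tau2 z = z - al2 z *: (h, 0).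
Proof.
case: z => u v; rewrite /tau2 /al2 /= tE.
by rewrite -[RHS]/(u - al u *: h, v - al u *: 0) scaler0 subr0.
Qed.

Lemma al2h : al2 (h, 0) = 2. Proof. exact: alh. Qed.

Local Notation dem2 := (dem_spec tau2 al2).
Let uniq2 := dem_uniq tau2E al2h.

(** The linear function [al(z1) + split_form(u, z2)] vanishes at the points with [(u, z2)]
    outside the graphs over [A n tA], by the choice of [l] and [m]. *)
Definition split_form : RR := pr2 (plin l) + pr1 (plin m).

Let T : gbimod R := dsum (X U) (shift (X I) (-2)).

(** Writing [G = P + al M] with [P] and [M] invariant under [t] in [z1], one has
    [G = (P - split_form M) + (al + split_form) M], where invariance allows [z1] to be
    replaced by [u] in [P] and [M]. The first term is a function of [(u, z2)], and the
    second one depends only on the restriction of [M] to the graphs over [A n tA]. *)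
Definition dem_pair (G : RR) : T :=
  let P := sval (cid (dem_ex tau2E al2h G)) in
  let M := sval (cid (svalP (cid (dem_ex tau2E al2h G)))) in
  (res rho U (P - split_form * M), res rho I M).

Lemma dem_pairE G P M : dem2 G P M -> dem_pair G = (res rho U (P - split_form * M), res rho I M).
Proof.
rewrite /dem_pair; case: cid => P' e /=; case: cid => M' /= s s'.
by have [-> ->] := uniq2 s s'.
Qed.

Lemma dem_pairD : {morph dem_pair : G H / G + H}.
Proof.
move=> G H; have [P [M sG]] := dem_ex tau2E al2h G; have [Q [N sH]] := dem_ex tau2E al2h H.
have [[g1 g2 g3] [h1 h2 h3]] := (sG, sH).
have sGH : dem2 (G + H) (P + Q) (M + N).
  by split; [exact: tau_invD|exact: tau_invD|rewrite g3 h3 mulrDr addrACA].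
rewrite (dem_pairE sGH) (dem_pairE sG) (dem_pairE sH) -[RHS]/(_ + _, _ + _) -!resD.
by congr (res _ _ _, _); ring.
Qed.

Lemma dem2M H G P M : tau_inv tau2 H -> dem2 G P M -> dem2 (H * G) (H * P) (H * M).
Proof.
move=> hH [h1 h2 ->]; split; [exact: tau_invM|exact: tau_invM|].
by rewrite mulrDr mulrCA.
Qed.

Lemma dem_pairL a G : gsub_set (invariants rho t) a -> dem_pair (pr1 a * G) = lact a (dem_pair G).
Proof.
move=> ha; have [P [M sG]] := dem_ex tau2E al2h G.
have ia : tau_inv tau2 (pr1 a).
  move=> [u v]; have e := congr1 (fun f : R => pev f (rho t u)) ha.
  rewrite -[LHS]/(pev a (rho t u)) -e -[LHS]/(pev a (rho t^-1%g (rho t u))).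
  by rewrite rhoK.
rewrite (dem_pairE sG) (dem_pairE (dem2M ia sG)) -[RHS]/(lact a _, lact a _) -!resL.
by congr (res _ _ _, _); ring.
Qed.

Lemma dem_pairR a G : dem_pair (pr2 a * G) = ract (dem_pair G) a.
Proof.
have [P [M sG]] := dem_ex tau2E al2h G.
have ia : tau_inv tau2 (pr2 a) by [].
rewrite (dem_pairE sG) (dem_pairE (dem2M ia sG)) -[RHS]/(ract _ a, ract _ a) -!resR.
by congr (res _ _ _, _); ring.
Qed.

Lemma split_formE w v : pev split_form (rho w v, v) = l v + m (rho w v).
Proof. by []. Qed.

(** The function [v |-> al (rho w v)] is a nonzero linear form for every [w], hence not
    a zero divisor. *)
Lemma root_domain (G : RR) w : (forall v, al (rho w v) * pev G (rho w v, v) = 0) ->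
  forall v, pev G (rho w v, v) = 0.
Proof.
pose f v := (rho w v, v); have fl : linear f by move=> c y z; rewrite /f linearP.
pose F : {linear V -> (V * V)%type} := HB.pack f (GRing.isLinear.Build K V (V * V)%type *:%R f fl).
pose g v := al (rho w v); have gl : scalar g by move=> c y z; rewrite /g !linearP.
pose G' : {scalar V} := HB.pack g (GRing.isLinear.Build K V K *%R g gl).
move=> e; apply: (polyfun_domain (polyfun_lin G') (polyfun_comp F (polyfun_pev G)) e).
by exists (rho w^-1%g h); rewrite -[G' _]/(al (rho w _)) rhoVK alh pnatr_eq0.
Qed.

Lemma dem2_at G P M w v : dem2 G P M ->
  pev G (rho w v, v) = pev P (rho w v, v) + al (rho w v) * pev M (rho w v, v) /\
  pev G (rho (t * w)%g v, v) = pev P (rho w v, v) - al (rho w v) * pev M (rho w v, v).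
Proof.
move=> [h1 h2 ->]; split=> //; rewrite rhoM pevD pevM.
rewrite -[X in X * _]/(al (rho t (rho w v))) alt mulNr.
by rewrite -[(rho t _, _)]/(tau2 (rho w v, v)) h1 h2.
Qed.

(** So [dem_pair] is well defined on R(A). Over [A n tA] the function [G] vanishes both at
    [(u, z2)] and at [(t u, z2)], hence so do [P] and [M]; elsewhere [split_form] is [al]
    or [- al] and [P - split_form M] is a value of [G]. *)
Lemma dem_pair0 G : res rho A G = 0 -> dem_pair G = 0.
Proof.
rewrite -(res0 rho A) => /res_eq G0.
have {}G0 w v : A w -> pev G (rho w v, v) = 0 by move=> Aw; rewrite G0.
have [P [M sG]] := dem_ex tau2E al2h G.
have M0 w v : A w -> A (t * w)%g -> pev M (rho w v, v) = 0.
  move=> h1 h2; move: v; apply: root_domain => v.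
  have [e1 e2] := dem2_at w v sG; rewrite !G0 // in e1 e2; lra.
rewrite (dem_pairE sG) -[0]/(0 : X U, 0 : X I) -!res0.
congr (_, _); apply/res_eq => w; last by move=> /IE[h1 h2] v; rewrite M0.
move=> hw v; rewrite pevB pevM split_formE pev0; have [e1 e2] := dem2_at w v sG.
have [h1|h1] := pselect (A w); have [h2|h2] := pselect (A (t * w)%g).
- by rewrite M0 // mulr0 subr0; rewrite M0 // mulr0 addr0 G0 // in e1.
- by rewrite (split2 _ h1 h2); rewrite G0 // in e1; lra.
- by rewrite (split1 _ h2 h1); rewrite (G0 (t * w)%g) // in e2; lra.
- by case/UE: hw.
Qed.

Lemma dem_pair_res G H : res rho A G = res rho A H -> dem_pair G = dem_pair H.
Proof.
move=> e; apply/eqP; rewrite -subr_eq0; apply/eqP.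
rewrite -(morphDN dem_pairD) -dem_pairD; apply: dem_pair0; rewrite resD (morphDN (@resD _ _ _ rho A)).
by rewrite e subrr.
Qed.

Definition dem_pair' (g : X A) : T := dem_pair (sval (cid (resP g))).

Lemma dem_graphE G : dem_pair' (res rho A G) = dem_pair G.
Proof. by rewrite /dem_pair'; case: cid => H /= e; exact: dem_pair_res. Qed.

Lemma dem_graphD : {morph dem_pair' : x y / x + y}.
Proof.
move=> x y; have [[G ->] [H ->]] := (resP x, resP y).
by rewrite -resD !dem_graphE dem_pairD.
Qed.

Lemma dem_graphL a g : gsub_set (invariants rho t) a -> dem_pair' (lact a g) = lact a (dem_pair' g).
Proof. by move=> ha; have [G ->] := resP g; rewrite -resL !dem_graphE dem_pairL. Qed.

Lemma dem_graphR g a : dem_pair' (ract g a) = ract (dem_pair' g) a.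
Proof. by have [G ->] := resP g; rewrite -resR !dem_graphE dem_pairR. Qed.

Lemma split_form_deg : gring_deg 2 split_form.
Proof.
apply: (gr_add (gring_grading RR).1); first exact/pr2_deg/plin_deg.
exact/pr1_deg/plin_deg.
Qed.

Lemma dem_graph_deg i g : gdeg i g -> gdeg i (dem_pair' g).
Proof.
move=> /res_degP[G hG ->]; rewrite dem_graphE.
have [P [M [sG hP hM]]] := dem_deg tau2E al2h hG.
rewrite (dem_pairE sG); split; last by apply: res_deg; rewrite addrC.
apply: res_deg; apply: ((gring_grading RR).1 i).2 => //.
by have := gring_degM split_form_deg hM; rewrite addrC subrK.
Qed.

Definition dem_tensor (a : regular_gbimod R) (g : X A) : T := lact a (dem_pair' g).

Lemma dem_tensor_balanced : balanced (invariants rho t) dem_tensor.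
Proof.
split=> [g a b|a g g'|a s g hs]; rewrite /dem_tensor.
- exact: lactDl.
- by rewrite dem_graphD lactDr.
- by rewrite dem_graphL // -lactM.
Qed.

Let Tn : gbimod R := tensor (invariants rho t) (regular_gbimod R) (X A).

Lemma ghom_psi : ghom (tensor_lift dem_tensor : Tn -> T).
Proof.
apply: (ghom_lift dem_tensor_balanced) => [a b g|a g b|i j a g ha hg]; rewrite /dem_tensor.
- exact: lactM.
- by rewrite dem_graphR lractA.
- exact: gdeg_lact ha (dem_graph_deg hg).
Qed.

Let tn (a : R) (g : X A) : Tn := tens (invariants rho t) (a : regular_gbimod R) g.

(** By the decomposition [R = R^t + R^t al] of the left factor. *)
Lemma tensor_normal (x : Tn) : exists g k, x = tn 1 g + tn (plin al) k.
Proof.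
move: x; apply: tensor_ind => [|a g x [g' [k' ->]]].
  by exists 0, 0; rewrite /tn !(morphD0 (tensDr _ _)) addr0.
have [ap [am [h1 h2 ->]]] := dem_ex tE alh a.
have inv b : tau_inv (rho t) b -> gsub_set (invariants rho t) b.
  move=> hb; apply: pev_ext => v; rewrite -[LHS]/(pev b (rho t^-1%g v)).
  have -> : (t^-1 = t)%g by apply: (@mulIg _ t); rewrite mulVg tt.
  exact: hb.
exists (lact ap g + g'), (lact am g + k').
have -> : tens (invariants rho t) (ap + plin al * am : regular_gbimod R) g =
    tn 1 (lact ap g) + tn (plin al) (lact am g).
  rewrite tensDl /tn -!tensA; [|exact: inv|exact: inv].
  by congr (tens _ _ _ + _); rewrite /= mul1r.
by rewrite /tn !tensDr addrACA.
Qed.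

Lemma dem_pair_tn a G : tensor_lift dem_tensor (tn a (res rho A G)) = lact a (dem_pair G).
Proof. by rewrite /tn (tensor_lift_tens _ _ dem_tensor_balanced) /dem_tensor dem_graphE. Qed.

(** With [x = 1 (x) g + al (x) k], the two components of [dem_pair] at [(u, z2)] and at
    [(t u, z2)] are linear equations that force [g = 0] and [al k = 0]. *)
Lemma dem_pair_inj (x : Tn) : tensor_lift dem_tensor x = 0 -> x = 0.
Proof.
have [g [k ->]] := tensor_normal x; have [[G ->] [H ->]] := (resP g, resP k).
rewrite (ghomD ghom_psi) !dem_pair_tn lact1.
have [P [M sG]] := dem_ex tau2E al2h G; have [Q [N sH]] := dem_ex tau2E al2h H.
rewrite (dem_pairE sG) (dem_pairE sH).
rewrite -[X in _ + X]/(lact (plin al) (res rho U (Q - split_form * N)), lact (plin al) (res rho I N)).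
rewrite -!resL => e.
have eU : res rho U (P - split_form * M + pr1 (plin al) * (Q - split_form * N)) = 0.
  by rewrite resD; exact: (congr1 fst e).
have eI : res rho I (M + pr1 (plin al) * N) = 0 by rewrite resD; exact: (congr1 snd e).
move: eU eI; rewrite -(res0 rho U) -(res0 rho I) => /res_eq eU /res_eq eI.
have {}eU w v : A w \/ A (t * w)%g -> pev P (rho w v, v) -
    (l v + m (rho w v)) * pev M (rho w v, v) + al (rho w v) * (pev Q (rho w v, v) -
    (l v + m (rho w v)) * pev N (rho w v, v)) = 0.
  by move=> hw; have := eU w; rewrite UE => /(_ hw v).
have {}eI w v : A w -> A (t * w)%g ->
    pev M (rho w v, v) + al (rho w v) * pev N (rho w v, v) = 0.
  by move=> h1 h2; have := eI w; rewrite IE => /(_ (conj h1 h2) v).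
have ttw w : (t * (t * w) = w)%g by rewrite mulgA tt mul1g.
have inv F w v : tau_inv tau2 F -> pev F (rho (t * w)%g v, v) = pev F (rho w v, v).
  by move=> hF; rewrite -(hF (rho w v, v)) rhoM.
have altw w v : al (rho (t * w)%g v) = - al (rho w v) by rewrite rhoM alt.
have [[iP iM _] [iQ iN _]] := (sG, sH).
have N0 w v : A w -> A (t * w)%g -> pev N (rho w v, v) = 0.
  move=> h1 h2; move: v; apply: root_domain => v; have e1 := eI w v h1 h2.
  have := eI (t * w)%g v h2; rewrite ttw => /(_ h1); rewrite !inv // altw; lra.
have M0 w v : A w -> A (t * w)%g -> pev M (rho w v, v) = 0.
  by move=> h1 h2; have := eI w v h1 h2; rewrite N0 // mulr0 addr0.
have Q0 w v : A w -> A (t * w)%g -> pev Q (rho w v, v) = 0.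
  move=> h1 h2; move: v; apply: root_domain => v.
  have e1 := eU w v (or_introl h1); have e2 := eU (t * w)%g v (or_introl h2).
  rewrite !inv // altw in e2; rewrite M0 // N0 // in e1 e2; lra.
have key w : A w -> (forall v, pev G (rho w v, v) = 0) /\ (forall v, pev H (rho w v, v) = 0).
  move=> h1; have [h2|h2] := pselect (A (t * w)%g).
    split=> v; first have [-> _] := dem2_at w v sG; last have [-> _] := dem2_at w v sH.
      have := eU w v (or_introl h1); rewrite Q0 // M0 // N0 //; lra.
    by rewrite Q0 // N0 // mulr0 addr0.
  have e0 v : pev G (rho w v, v) + al (rho w v) * pev H (rho w v, v) = 0 /\
             pev G (rho w v, v) - al (rho w v) * pev H (rho w v, v) = 0.
    have e1 := eU w v (or_introl h1).
    have := eU (t * w)%g v; rewrite ttw => /(_ (or_intror h1)).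
    have h3 : A (t * (t * w))%g by rewrite ttw.
    rewrite (split1 v h3 h2) (split2 v h1 h2) in e1 *; rewrite !inv // altw => e2.
    have [-> _] := dem2_at w v sG; have [-> _] := dem2_at w v sH.
    by split; lra.
  by split=> [v|]; [have [] := e0 v; lra|apply: root_domain => v; have [] := e0 v; lra].
have -> : res rho A G = 0 by rewrite -(res0 rho A); apply/res_eq => w /key[].
have -> : res rho A H = 0 by rewrite -(res0 rho A); apply/res_eq => w /key[].
by rewrite /tn !(morphD0 (tensDr _ _)) addr0.
Qed.

(** The units of the two summands are the images of [1 (x) 1] and of
    [1 (x) al + split_form (1 (x) 1)]. *)
Lemma dem_pair_surj (y : T) : exists x : Tn, tensor_lift dem_tensor x = y.
Proof.
pose im (z : T) := exists x : Tn, tensor_lift dem_tensor x = z.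
have imD z z' : im z -> im z' -> im (z + z').
  by move=> [x <-] [x' <-]; exists (x + x'); exact: (ghomD ghom_psi).
have imL a z : im z -> im (lact a z).
  by move=> [x <-]; exists (lact a x); exact: (ghomL ghom_psi).
have imR a z : im z -> im (ract z a).
  by move=> [x <-]; exists (ract x a); exact: (ghomR ghom_psi).
have im1 G : im (res rho U G, 0).
  move: G; apply: poly_ind2 => [|a G h'|a G h'|G H h' h''].
  - exists (tn 1 (res rho A 1)); rewrite dem_pair_tn lact1.
    have s : dem2 1 1 0 by split=> //; rewrite mulr0 addr0.
    by rewrite (dem_pairE s) mulr0 subr0 res0.
  - by have := imL a _ h'; rewrite -[lact _ _]/(lact a _, lact a _) -resL lact0.
  - by have := imR a _ h'; rewrite -[ract _ _]/(ract _ a, ract _ a) -resR ract0.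
  - by have := imD _ _ h' h''; rewrite -[X in im X]/(_ + _, _ + _) -resD addr0.
have im2 G : im (0, res rho I G).
  move: G; apply: poly_ind2 => [|a G h'|a G h'|G H h' h''].
  - have s : dem2 (plin al2) 0 1 by split=> //; rewrite mulr1 add0r.
    have := imD _ _ (ex_intro _ (tn 1 (res rho A (plin al2))) erefl : im _) (im1 split_form).
    rewrite dem_pair_tn lact1 (dem_pairE s) -[X in im X]/(_ + _, _ + _) -resD mulr1 sub0r addNr addr0.
    by rewrite res0.
  - by have := imL a _ h'; rewrite -[lact _ _]/(lact a _, lact a _) -resL lact0.
  - by have := imR a _ h'; rewrite -[ract _ _]/(ract _ a, ract _ a) -resR ract0.
  - by have := imD _ _ h' h''; rewrite -[X in im X]/(_ + _, _ + _) -resD addr0.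
case: y => y1 y2; have [[G ->] [H ->]] := (resP y1, resP y2).
have := imD _ _ (im1 G) (im2 H); rewrite -[X in im X]/(_ + _, _ + _).
by rewrite addr0 add0r.
Qed.

Lemma tensor_invariants_iso :
  giso (tensor (invariants rho t) (regular_gbimod R) (X A)) (dsum (X U) (shift (X I) (-2))).
Proof.
apply: (giso_bij ghom_psi); last exact: dem_pair_surj.
move=> x y e; apply/eqP; rewrite -subr_eq0; apply/eqP/dem_pair_inj.
by rewrite (ghomD ghom_psi) (ghomN ghom_psi) e subrr.
Qed.

End KeyIso.

(** * Grothendieck rings of categories with finitely many bricks up to shift *)

Section Decomposable.
Variables (R : gradedRing) (n : nat) (X : 'I_n -> gbimod R).

Definition shifted (p : 'I_n * int) : gbimod R := shift (X p.1) p.2.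

Definition decomposable (M : gbimod R) : Prop := exists s, giso M (bigsum shifted s).

Lemma dec_iso M N : giso M N -> decomposable M -> decomposable N.
Proof. by move=> h [s hs]; exists s; exact: giso_trans (giso_sym h) hs. Qed.

Lemma dec_dsum M N : decomposable M -> decomposable N -> decomposable (dsum M N).
Proof.
move=> [s hs] [t ht]; exists (s ++ t).
exact: giso_trans (dsum_iso hs ht) (giso_sym (bigsum_cat _ _ _)).
Qed.

Lemma dec_zero M : is_zero M -> decomposable M.
Proof. by move=> z; exists [::]; exact: giso_zero z (@zero_is_zero R). Qed.

Lemma dec_shifted p : decomposable (shifted p).
Proof. by exists [:: p]; exact: dsum0 (@zero_is_zero R). Qed.

Lemma dec_shifted_sum s : decomposable (bigsum shifted s).
Proof. by exists s; exact: giso_refl. Qed.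

Lemma dec_bigsum (I : eqType) (G : I -> gbimod R) s :
  (forall i, i \in s -> decomposable (G i)) -> decomposable (bigsum G s).
Proof.
elim: s => [_|i s IH h] /=; first exact: dec_zero (@zero_is_zero R).
apply: dec_dsum; first by apply: h; rewrite inE eqxx.
by apply: IH => j js; apply: h; rewrite inE js orbT.
Qed.

Lemma shift_shifted p k : giso (shift (shifted p) k) (shifted (p.1, p.2 + k)).
Proof. exact: shiftD. Qed.

Lemma shift_bigsum s k : giso (shift (bigsum shifted s) k)
  (bigsum shifted [seq (p.1, p.2 + k) | p <- s]).
Proof.
elim: s => [|p s IH] /=; first by apply: giso_zero; exact: zero_is_zero.
exact: giso_trans (shift_dsum _ _ _) (dsum_iso (shift_shifted p k) IH).
Qed.

Lemma dec_shift M k : decomposable M -> decomposable (shift M k).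
Proof.
move=> [s hs]; exists [seq (p.1, p.2 + k) | p <- s].
exact: giso_trans (shift_iso k hs) (shift_bigsum s k).
Qed.
End Decomposable.

Section FreeGrothendieck.
Variables (R : gradedRing) (n : nat) (X : 'I_n -> gbimod R).
Local Notation shifted := (shifted X).
Local Notation C := (decomposable X).

Hypotheses (shifted_brick : forall p, brick (shifted p))
  (shifted_inj : forall p q, giso (shifted p) (shifted q) -> p = q)
  (dec_regular : C (regular_gbimod R))
  (dec_tensor_gen : forall i j, C (tensor (full_subring R) (X i) (X j)))
  (regular_neq0 : ~ is_zero (regular_gbimod R)).

Local Notation U := {ffun 'I_n -> laurent^o}.
Local Notation "M ** N" := (tensor (full_subring R) M N) (at level 40).

Definition weight (s : seq ('I_n * int)) : U := \sum_(p <- s) vpow p.2 *: free_gen p.1.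

Lemma weight_nil : weight [::] = 0. Proof. exact: big_nil. Qed.
Lemma weight_cons p s : weight (p :: s) = vpow p.2 *: free_gen p.1 + weight s.
Proof. exact: big_cons. Qed.

(** The decomposition is chosen arbitrarily; by Krull-Schmidt the class does not
    depend on it. *)
Definition free_class (M : gbimod R) : U :=
  if pselect (C M) is left h then weight (sval (cid h)) else 0.

Lemma free_classE M s : giso M (bigsum shifted s) -> free_class M = weight s.
Proof.
move=> hs; rewrite /free_class; case: pselect => [h|[]]; last by exists s.
case: cid => t /= ht; apply: perm_big; apply: (sum_unique shifted_brick shifted_inj).
exact: giso_trans (giso_sym ht) hs.
Qed.

Lemma free_class_iso M N : giso M N -> C N -> free_class M = free_class N.
Proof. by move=> h [s hs]; rewrite (free_classE (giso_trans h hs)) (free_classE hs). Qed.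

Lemma free_class_dsum M N : C M -> C N -> free_class (dsum M N) = free_class M + free_class N.
Proof.
move=> [s hs] [t ht]; rewrite (free_classE hs) (free_classE ht) -big_cat; apply: free_classE.
exact: giso_trans (dsum_iso hs ht) (giso_sym (bigsum_cat _ _ _)).
Qed.

Lemma free_class_zero M : is_zero M -> free_class M = 0.
Proof.
by move=> z; rewrite (@free_classE _ [::]) ?weight_nil //; exact: giso_zero z (@zero_is_zero R).
Qed.

Lemma free_class_shifted p : free_class (shifted p) = vpow p.2 *: free_gen p.1.
Proof.
rewrite (@free_classE _ [:: p]) ?weight_cons ?weight_nil ?addr0 //; exact: dsum0 (@zero_is_zero R).
Qed.

Lemma free_class_shift M k : C M -> free_class (shift M k) = vpow k *: free_class M.
Proof.
move=> [s hs]; rewrite (free_classE (giso_trans (shift_iso k hs) (shift_bigsum X s k))).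
rewrite (free_classE hs) /weight big_map scaler_sumr; apply: eq_bigr => p _ /=.
by rewrite scalerA addrC vpowD.
Qed.

Lemma additive_invariant0 (Z : zmodType) (f : gbimod R -> Z) :
  additive_invariant C f -> f (zero_gbimod R) = 0.
Proof.
have h0 := dec_zero X (@zero_is_zero R).
move=> /(_ _ _ _ h0 h0 h0 (dsum0 _ (@zero_is_zero R))) e.
by apply: (@addrI _ (f (zero_gbimod R))); rewrite addr0 -e.
Qed.

Lemma additive_invariant_iso (Z : zmodType) (f : gbimod R -> Z) M N :
  additive_invariant C f -> giso M N -> C N -> f M = f N.
Proof.
move=> fA h hN; have hM := dec_iso (giso_sym h) hN.
have h0 := dec_zero X (@zero_is_zero R).
rewrite (fA _ _ _ hM hN h0) ?additive_invariant0 ?addr0 //.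
exact: giso_trans h (dsum0 _ (@zero_is_zero R)).
Qed.

Lemma additive_invariant_sum (Z : zmodType) (f : gbimod R -> Z) s :
  additive_invariant C f -> f (bigsum shifted s) = \sum_(p <- s) f (shifted p).
Proof.
move=> fA; elim: s => [|p s IH].
  by rewrite big_nil; exact: additive_invariant0.
rewrite big_cons -IH; apply: (fA _ _ _ (dec_shifted_sum X (p :: s))) => //.
- exact: dec_shifted.
- exact: dec_shifted_sum.
- exact: giso_refl.
Qed.

Lemma free_class_additive : additive_invariant C free_class.
Proof.
move=> M M' M'' _ h' h'' h; rewrite -free_class_dsum //; apply: free_class_iso h _.
exact: dec_dsum.
Qed.

Definition class_lift (Z : zmodType) (f : gbimod R -> Z) : U -> Z :=
  free_lift (fun i k => f (shifted (i, k))).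

Lemma class_lift_zmod (Z : zmodType) (f : gbimod R -> Z) : GRing.zmod_morphism (class_lift f).
Proof.
by move=> x y; rewrite /class_lift free_liftD (morphDN (free_liftD _)).
Qed.

Lemma class_lift_cls (Z : zmodType) (f : gbimod R -> Z) : additive_invariant C f ->
  forall M, C M -> class_lift f (free_class M) = f M.
Proof.
move=> fA M hM; have [s hs] := hM; rewrite (free_classE hs).
rewrite (additive_invariant_iso fA hs (dec_shifted_sum X s)) additive_invariant_sum // /weight.
rewrite /class_lift (morphD_sum _ _ (free_liftD _)); apply: eq_bigr => -[i k] _.
exact: free_lift_gen.
Qed.

Lemma free_class_universal (Z : zmodType) (f : gbimod R -> Z) : additive_invariant C f ->
  exists phi : {additive U -> Z}, (forall M, C M -> phi (free_class M) = f M) /\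
    forall psi : {additive U -> Z}, (forall M, C M -> psi (free_class M) = f M) -> psi =1 phi.
Proof.
move=> fA; pose phi : {additive U -> Z} :=
  HB.pack (class_lift f) (GRing.isZmodMorphism.Build _ _ (class_lift f) (@class_lift_zmod Z f)).
exists phi; split=> [M hM|psi hpsi]; first exact: class_lift_cls.
apply: free_ext => [||k i]; [exact: raddfD|exact: raddfD|].
rewrite -(free_class_shifted (i, k)) hpsi ?[RHS](class_lift_cls fA) //; exact: dec_shifted.
Qed.

(** The structure constants are the classes of the products of the generators. All
    the laws are inherited from the tensor product, because the classes of the
    shifted generators span the module additively. *)
Definition class_mul (x y : U) : U := \sum_i \sum_j (x i * y j) *: free_class (X i ** X j).

Lemma class_mulDl : left_distributive class_mul +%R.
Proof.
move=> x y z; rewrite -big_split; apply: eq_bigr => i _; rewrite -big_split.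
by apply: eq_bigr => j _; rewrite ffunE mulrDl scalerDl.
Qed.

Lemma class_mulDr : right_distributive class_mul +%R.
Proof.
move=> x y z; rewrite -big_split; apply: eq_bigr => i _; rewrite -big_split.
by apply: eq_bigr => j _; rewrite ffunE mulrDr scalerDl.
Qed.

Lemma class_mulZl (a : laurent) x y : a *: class_mul x y = class_mul (a *: x) y.
Proof.
rewrite /class_mul scaler_sumr; apply: eq_bigr => i _; rewrite scaler_sumr.
by apply: eq_bigr => j _; rewrite ffunE scalerA mulrA.
Qed.

Lemma class_mulZr (a : laurent) x y : a *: class_mul x y = class_mul x (a *: y).
Proof.
rewrite /class_mul scaler_sumr; apply: eq_bigr => i _; rewrite scaler_sumr.
apply: eq_bigr => j _; rewrite ffunE scalerA; congr (_ *: _).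
by rewrite -[a *: y j]/(a * y j) mulrCA.
Qed.

Lemma class_mul_gen i j : class_mul (free_gen i) (free_gen j) = free_class (X i ** X j).
Proof.
rewrite /class_mul (bigD1 i) //= [X in _ + X]big1 ?addr0 => [|i' ii']; last first.
  by apply: big1 => j' _; rewrite !ffunE eq_sym (negPf ii') mul0r scale0r.
rewrite (bigD1 j) //= [X in _ + X]big1 ?addr0 => [|j' jj']; last first.
  by rewrite !ffunE [j == j']eq_sym (negPf jj') mulr0 scale0r.
by rewrite !ffunE !eqxx mulr1 scale1r.
Qed.

Lemma tensor_shifted p q :
  giso (shifted p ** shifted q) (shift (X p.1 ** X q.1) (p.2 + q.2)).
Proof.
rewrite addrC; apply: giso_trans (tensor_shiftl _ _ _ _) _.
apply: giso_trans (shift_iso _ (tensor_shiftr _ _ _ _)) _.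
exact: shiftD.
Qed.

Lemma dec_tensor_shifted p q : C (shifted p ** shifted q).
Proof. exact: dec_iso (giso_sym (tensor_shifted p q)) (dec_shift _ (dec_tensor_gen _ _)). Qed.

Lemma free_class_tensor_sum s t : C (bigsum shifted s ** bigsum shifted t) /\
  free_class (bigsum shifted s ** bigsum shifted t) = class_mul (weight s) (weight t).
Proof.
have Z0 : is_zero (zero_gbimod R) := @zero_is_zero R.
have m0l y : class_mul 0 y = 0 by exact: (morphD0 (fun x x' => class_mulDl x x' y)).
have m0r x : class_mul x 0 = 0 by exact: (morphD0 (class_mulDr x)).
have base p : C (shifted p ** bigsum shifted t) /\
    free_class (shifted p ** bigsum shifted t) = class_mul (vpow p.2 *: free_gen p.1) (weight t).
  elim: t => [|q t [IH1 IH2]] /=.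
    have z : is_zero (shifted p ** zero_gbimod R) by exact: tensor_zeror.
    by rewrite weight_nil m0r free_class_zero //; split=> //; exact: dec_zero.
  have h := tensor_dsumr (full_subring R) (shifted p) (shifted q) (bigsum shifted t).
  have hC := dec_dsum (dec_tensor_shifted p q) IH1.
  split; first exact: dec_iso (giso_sym h) hC.
  rewrite (free_class_iso h hC) free_class_dsum // ?IH2; last exact: dec_tensor_shifted.
  rewrite weight_cons class_mulDr; congr (_ + _).
  rewrite (free_class_iso (tensor_shifted p q)); last exact/dec_shift/dec_tensor_gen.
  by rewrite free_class_shift // -class_mulZl -class_mulZr class_mul_gen scalerA vpowD.
elim: s => [|p s [IH1 IH2]] /=.
  have z : is_zero (zero_gbimod R ** bigsum shifted t) by exact: tensor_zerol.
  by rewrite weight_nil m0l free_class_zero //; split=> //; exact: dec_zero.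
have h := tensor_dsuml (full_subring R) (shifted p) (bigsum shifted s) (bigsum shifted t).
have [b1 b2] := base p; have hC := dec_dsum b1 IH1.
split; first exact: dec_iso (giso_sym h) hC.
by rewrite (free_class_iso h hC) free_class_dsum // IH2 b2 weight_cons class_mulDl.
Qed.

Lemma free_class_tensor M N : C M -> C N ->
  C (M ** N) /\ free_class (M ** N) = class_mul (free_class M) (free_class N).
Proof.
move=> [s hs] [t ht]; have [h1 h2] := free_class_tensor_sum s t.
have h := tensor_iso (full_subring R) hs ht.
split; first exact: dec_iso (giso_sym h) h1.
by rewrite (free_class_iso h h1) h2 (free_classE hs) (free_classE ht).
Qed.

Lemma free_class_ext (f g : U -> U) : {morph f : x y / x + y} -> {morph g : x y / x + y} ->
  (forall p, f (free_class (shifted p)) = g (free_class (shifted p))) -> f =1 g.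
Proof.
by move=> fD gD fg; apply: free_ext => // k i; rewrite -(free_class_shifted (i, k)).
Qed.

Lemma class_mulA : associative class_mul.
Proof.
move=> x y z; move: x; apply: free_class_ext => [x x'|x x'|p]; rewrite ?class_mulDl //.
move: y; apply: free_class_ext => [y y'|y y'|q]; rewrite ?(class_mulDl, class_mulDr) //.
move: z; apply: free_class_ext => [z z'|z z'|r]; rewrite ?class_mulDr //.
have hC := @dec_shifted R n X.
have [c1 e1] := free_class_tensor (hC p) (hC q); have [c2 e2] := free_class_tensor (hC q) (hC r).
have [c3 e3] := free_class_tensor c1 (hC r); have [c4 e4] := free_class_tensor (hC p) c2.
rewrite -e1 -e2 -e3 -e4; apply: free_class_iso c3; exact/giso_sym/tensor_assoc.
Qed.

Definition class_one : U := free_class (regular_gbimod R).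

Lemma class_mul1l : left_id class_one class_mul.
Proof.
apply: free_class_ext => [x x'|//|p]; first exact: class_mulDr.
have [c <-] := free_class_tensor dec_regular (dec_shifted X p).
by apply: free_class_iso (dec_shifted X p); exact: tensor_unitl.
Qed.

Lemma class_mul1r : right_id class_one class_mul.
Proof.
apply: free_class_ext => [x x'|//|p]; first exact: class_mulDl.
have [c <-] := free_class_tensor (dec_shifted X p) dec_regular.
by apply: free_class_iso (dec_shifted X p); exact: tensor_unitr.
Qed.

Lemma free_gen_neq0 (i : 'I_n) : free_gen i <> 0.
Proof. by move=> /ffunP/(_ i) /eqP; rewrite !ffunE eqxx oner_eq0. Qed.

Lemma class_one_neq0 : class_one != 0.
Proof.
have [[|p s] hs] := dec_regular.
  by case: regular_neq0; exact: giso_is_zero (giso_sym hs) (@zero_is_zero R).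
apply/eqP => e; apply: (@free_gen_neq0 p.1).
by rewrite -[free_gen _]class_mul1l e (morphD0 (fun x x' => class_mulDl x x' _)).
Qed.

Definition class_law : alg_law U :=
  AlgLaw class_mulA class_mul1l class_mul1r class_mulDl class_mulDr class_mulZl class_mulZr class_one_neq0.

Lemma grothendieck_exists : exists (A : algType laurent) (cls : gbimod R -> A),
  split_grothendieck C cls.
Proof.
exists (alg_of class_law : algType laurent), free_class; split.
- exact: free_class_additive.
- move=> Z f fA; have [phi [h1 h2]] := free_class_universal fA.
  by exists phi; split=> // psi; exact: (h2 psi).
- by move=> M N hM hN; have [_] := free_class_tensor hM hN.
- by [].
- by move=> M hM; rewrite -vpow1; exact: free_class_shift.
Qed.

(** Any two solutions of the universal property are identified by additive
    bijections that respect classes. These are linear because multiplication by [v]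
    is the shift, so the basis of the free module is carried over. *)
Lemma grothendieck_free (A : algType laurent) (cls : gbimod R -> A) :
  split_grothendieck C cls -> free_of_rank A n.
Proof.
case=> clsA clsU _ _ clsS; have [phi [phiE _]] := clsU U free_class free_class_additive.
have [psi [psiE psiU]] := free_class_universal clsA.
have psiphi x : psi (phi x) = x.
  have [id' [_ idU]] := clsU A cls clsA.
  rewrite -[LHS]/((psi \o phi) x) idU => [|M hM]; last by rewrite /= phiE // psiE.
  by rewrite -[RHS]/(idfun x) idU.
have phipsi x : phi (psi x) = x.
  have [id' [_ idU]] := free_class_universal free_class_additive.
  rewrite -[LHS]/((phi \o psi) x) idU => [|M hM]; last by rewrite /= psiE // phiE.
  by rewrite -[RHS]/(idfun x) idU.
have clsV M k : C M -> cls (shift M k) = vpow k *: cls M.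
  have iso M' N' : giso M' N' -> C N' -> cls M' = cls N' by exact: additive_invariant_iso.
  have pos (j : nat) M' : C M' -> cls (shift M' j) = vpow j *: cls M'.
    move=> hM; elim: j => [|j IH]; first by rewrite (iso _ _ (shift0 _)) // vpow0 scale1r.
    rewrite -addn1 PoszD -(iso _ _ (shiftD M' j 1)); last exact: dec_shift.
    by rewrite clsS ?IH -?vpow1 ?scalerA -?vpowD 1?addrC //; exact: dec_shift.
  move=> hM; case: k => j; first exact: pos.
  have hS := dec_shift (Negz j) hM.
  have := pos j.+1 _ hS; rewrite (iso _ _ (shiftD _ _ _)); last exact: dec_shift.
  rewrite NegzE addNr (iso _ _ (shift0 _)) // => ->.
  by rewrite scalerA -vpowD addNr vpow0 scale1r.
have psiZ (a : laurent) i : psi (a *: free_gen i) = a *: psi (free_gen i).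
  move: a; apply: laurent_ind => [|a b ha hb|a ha|k].
  - by rewrite !scale0r raddf0.
  - by rewrite !scalerDl raddfD ha hb.
  - by rewrite !scaleNr raddfN ha.
  - have g0 : free_gen i = free_class (shifted (i, 0)) by rewrite free_class_shifted vpow0 scale1r.
    rewrite -(free_class_shifted (i, k)) g0 !psiE; [|exact: dec_shifted|exact: dec_shifted].
    rewrite -clsV; last exact: dec_shifted.
    apply: additive_invariant_iso => //; last exact/dec_shift/dec_shifted.
    apply/giso_sym; apply: giso_trans (shift_shifted X _ _) _.
    by rewrite /= add0r; exact: giso_refl.
have psi_sum (c : U) : psi c = \sum_i c i *: psi (free_gen i).
  by rewrite {1}(free_decomp c) raddf_sum; apply: eq_bigr => i _; exact: psiZ.
exists (fun i => psi (free_gen i)) => x; exists (phi x); split=> [|c e].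
  by rewrite -[LHS]psiphi psi_sum.
by rewrite e -(psi_sum c) phipsi.
Qed.

End FreeGrothendieck.

(** * The category C in type A2 *)

Section TypeA2.
Variables (K : realType) (W : groupType) (S : set W) (V : vectType K).
Variable rho : representation W V.
Hypotheses (coxS : coxeter_system S) (typeS : type_A2 S) (faith : reflection_faithful S rho).
Local Notation R := (polyring V).
Local Notation X := (graph_bimod rho).
Local Notation catC := (catC S rho).
Local Notation B := (Bbimod rho).
Implicit Types (M N : gbimod R).

Lemma catC_iso M N : giso M N -> catC M -> catC N.
Proof.
move=> h [s [hs [P hP]]]; exists s; split=> //; exists P.
exact: giso_trans hP (dsum_iso h (giso_refl _)).
Qed.

Lemma catC_summand M N P : giso M (dsum N P) -> catC M -> catC N.
Proof.
move=> h [s [hs [Q hQ]]]; exists s; split=> //; exists (dsum P Q).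
apply: giso_trans hQ _; apply: giso_trans (giso_sym (dsumA _ _ _)).
exact: dsum_iso h (giso_refl _).
Qed.

Lemma catC_dsum M N : catC M -> catC N -> catC (dsum M N).
Proof.
move=> [s [hs [P hP]]] [t [ht [Q hQ]]]; exists (s ++ t); split.
  by move=> p; rewrite mem_cat => /orP[/hs|/ht].
exists (dsum P Q); apply: giso_trans (bigsum_cat _ _ _) _.
exact: giso_trans (dsum_iso hP hQ) (dsumACA _ _ _ _).
Qed.

Lemma catC_zero M : is_zero M -> catC M.
Proof.
move=> z; exists [::]; split=> //; exists (zero_gbimod R).
by apply: (giso_zero (@zero_is_zero R)) => -[x y]; rewrite (z x) [y]thinmx0.
Qed.

Lemma catC_bigsum (I : eqType) (F : I -> gbimod R) s :
  (forall i, i \in s -> catC (F i)) -> catC (bigsum F s).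
Proof.
elim: s => [_|i s IH h] /=; first exact: catC_zero (@zero_is_zero R).
apply: catC_dsum; first by apply: h; rewrite inE eqxx.
by apply: IH => j js; apply: h; rewrite inE js orbT.
Qed.

Lemma catC_shift M n : catC M -> catC (shift M n).
Proof.
move=> [s [hs [P hP]]]; exists [seq (p.1, p.2 + n) | p <- s]; split.
  by move=> p /mapP[q qs ->]; exact: (hs q qs).
exists (shift P n); apply: giso_trans (shift_dsum _ _ _).
apply: giso_trans (shift_iso n hP); apply: giso_sym.
apply: giso_trans (bigsum_functor _ _ (T := fun M => shift M n) _ _) _.
- exact: zero_is_zero.
- by move=> M' N'; exact: shift_dsum.
- apply: (bigsum_iso (h := fun p => (p.1, p.2 + n))) => p _; exact: shiftD.
Qed.

Lemma catC_regular : catC (regular_gbimod R).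
Proof.
exists [:: ([::], 0)]; split; first by move=> p; rewrite inE => /eqP ->.
exists (zero_gbimod R); exact: dsum_iso (shift0 _) (giso_refl _).
Qed.

Lemma catC_B t M : reflections S t -> catC M -> catC (tensorR (B t) M).
Proof.
move=> ht [s [hs [P hP]]]; exists [seq (t :: p.1, p.2) | p <- s]; split.
  move=> p /mapP[q qs ->] r; rewrite inE => /predU1P[->//|]; exact: (hs q qs).
exists (tensorR (B t) P); apply: giso_trans (tensor_dsumr _ _ _ _).
apply: giso_trans (tensor_iso _ (giso_refl _) hP); apply: giso_sym.
apply: giso_trans (bigsum_functor _ _ (T := fun M => tensorR (B t) M) _ _) _.
- by apply: tensor_zeror; exact: zero_is_zero.
- by move=> M' N'; exact: tensor_dsumr.
- apply: (bigsum_iso (h := fun p => (t :: p.1, p.2))) => p _; exact: tensor_shiftr.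
Qed.

Lemma catC_tensor M N : catC M -> catC N -> catC (tensorR M N).
Proof.
move=> [s [hs [P hP]]] hN.
have hprod ts : (forall t, t \in ts -> reflections S t) -> catC (tensorR (Bproduct rho ts) N).
  elim: ts => [_|t ts IH h] /=; first exact: catC_iso (giso_sym (tensor_unitl N)) hN.
  apply: catC_iso (giso_sym (tensor_assoc _ _ _ _ _)) _; apply: catC_B.
    by apply: h; rewrite inE eqxx.
  by apply: IH => r rts; apply: h; rewrite inE rts orbT.
apply: (@catC_summand (tensorR (Bsum rho s) N) _ (tensorR P N)).
  apply: giso_trans (tensor_iso _ hP (giso_refl _)) _; exact: tensor_dsuml.
apply: catC_iso (giso_sym (bigsum_functor _ _ (T := fun M => tensorR M N) _ _)) _.
- by apply: tensor_zerol; exact: zero_is_zero.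
- by move=> M' N'; exact: tensor_dsuml.
- apply: catC_bigsum => p ps /=; apply: catC_iso (giso_sym (tensor_shiftl _ _ _ _)) _.
  apply: catC_shift; apply: hprod; exact: (hs p ps).
Qed.

(** [B_t (x)_R R(A)] is [R (x)_{R^t} R(A)] up to a shift. *)
Lemma BX_iso A t : good_set S A -> reflections S t ->
  giso (tensorR (B t) (X A))
    (dsum (shift (X (A `|` translate t A)) 1) (shift (X (A `&` translate t A)) (-1))).
Proof.
move=> gA ht; have [al [h [tE alh]]] := refl_form coxS typeS faith ht.
have [l [m [s1 s2]]] := refl_split coxS typeS faith gA ht tE alh.
have tt := refl_inv coxS typeS ht.
apply: giso_trans (tensor_shiftl _ _ _ _) _.
apply: giso_trans (shift_iso _ (tensor_assoc _ _ _ _ _)) _.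
apply: giso_trans (shift_iso _ (tensor_iso _ (giso_refl _) (tensor_unitl _))) _.
apply: giso_trans (shift_iso _ (tensor_invariants_iso tt tE alh s1 s2)) _.
apply: giso_trans (shift_dsum _ _ _) _; apply: dsum_iso (giso_refl _) _.
exact: shiftD.
Qed.

Lemma X_set1 : giso (regular_gbimod R) (X [set 1%g]).
Proof.
pose f (a : regular_gbimod R) := res rho [set 1%g] (pr1 a).
have hf : ghom f.
  split=> [a b|a b|a b|i a ha]; rewrite /f.
  - by rewrite -resD; congr (res _ _ _); exact: pev_ext.
  - by rewrite -resL; congr (res _ _ _); exact: pev_ext.
  - rewrite -resR; apply/res_eq => _ -> v.
    by rewrite pevM pev_pr1 pev_pr2 /= rho1 mulrC.
  - by apply: res_deg; exact: pr1_deg.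
apply: (giso_bij hf) => [a b /res_eq e|g].
  by apply: pev_ext => v; have := e 1%g erefl v; rewrite !pev_pr1 /= rho1.
have [G ->] := resP g; move: G; apply: poly_ind2 => [|a G [b hb]|a G [b hb]|G H [b hb] [c hc]].
- by exists 1; apply/res_eq => x _ v.
- by exists (lact a b); rewrite resL -hb (ghomL hf).
- by exists (ract b a); rewrite resR -hb (ghomR hf).
- by exists (b + c); rewrite (ghomD hf) hb hc resD.
Qed.

Lemma X_zero (A : set W) : ~ (A !=set0) -> is_zero (X A).
Proof.
move=> A0 g; have [G ->] := resP g; rewrite -(res0 rho A).
by apply/res_eq => x Ax; case: A0; exists x.
Qed.

Lemma stable_cup A t : A !=set0 -> reflections S t -> reflection_stable S (A `|` translate t A).
Proof.
move=> [x Ax] ht; have tt := refl_inv coxS typeS ht; split; first by exists x; left.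
exists t => //; apply/funext => y; apply/propext; rewrite -[X in X <-> _]/(translate t _ y).
rewrite translateE //; split=> -[h|h]; [right|left|right|left]; try exact/(translateE _ _ tt).
- by move/(translateE _ _ tt): h; rewrite mulgA tt mul1g.
- by apply/(translateE _ _ tt); rewrite mulgA tt mul1g.
Qed.

Lemma stable_cap A t : reflections S t -> A `&` translate t A !=set0 ->
  reflection_stable S (A `&` translate t A).
Proof.
move=> ht ne; have tt := refl_inv coxS typeS ht; split=> //.
exists t => //; apply/funext => y; apply/propext; rewrite -[X in X <-> _]/(translate t _ y).
rewrite translateE //; split=> -[h /(translateE _ _ tt) h']; split=> //.
- by move: h'; rewrite mulgA tt mul1g.
- exact/(translateE _ _ tt).
- by apply/(translateE _ _ tt); rewrite mulgA tt mul1g.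
Qed.

Lemma good_nonempty A : good_set S A -> A !=set0.
Proof. by case=> [[]//|->]; exists 1%g. Qed.

(** The bimodule [R(A u tA)] and, up to a shift, [R(A n tA)] are summands of
    [B_t (x)_R R(A)], and every set considered is reached from [{1}] in this way. *)
Lemma catC_X A : good_set S A -> catC (X A).
Proof.
case=> [sA|->]; last exact: catC_iso X_set1 catC_regular.
have [g cod] := A2_coded coxS typeS.
suff [] : catC (X A) /\ good_set S A by [].
have unshift M k : catC (shift M k) -> catC M.
  move=> /(catC_shift (- k)); apply: catC_iso; apply: giso_trans (shiftD _ _ _) _.
  by rewrite subrr; exact: shift0.
move: A sA; apply: (coded_gen cod (P := fun A => catC (X A) /\ good_set S A)).
- by split; [exact: catC_iso X_set1 catC_regular|right].
- move=> A t [cA gA] ht; split; last by left; apply: stable_cup => //; exact: good_nonempty gA.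
  apply: (unshift _ 1); exact: catC_summand (BX_iso gA ht) (catC_B ht cA).
- move=> A t [cA gA] ht ne; split; last by left; apply: stable_cap.
  apply: (unshift _ (-1)).
  exact: catC_summand (giso_trans (BX_iso gA ht) (dsumC _ _)) (catC_B ht cA).
Qed.

Section Labels.
Variable L : seq (set W).
Hypotheses (uL : uniq L) (sL : size L = 20%N) (LP : forall A, A \in L <-> good_set S A).

Definition label (i : 'I_20) : set W := nth set0 L i.
Definition Xlab (i : 'I_20) : gbimod R := X (label i).
Local Notation F := (shifted Xlab).

Lemma label_good i : good_set S (label i).
Proof. by apply/LP; apply: mem_nth; rewrite sL. Qed.

Lemma label_ex A : good_set S A -> exists i, A = label i.
Proof.
move=> /LP AL; have h : (index A L < 20)%N by rewrite -sL index_mem.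
by exists (Ordinal h); rewrite /label nth_index.
Qed.

Lemma label_inj : injective label.
Proof. by move=> i j /eqP; rewrite /label nth_uniq ?sL // => /eqP/val_inj. Qed.

Lemma F_brick p : brick (F p).
Proof. by apply: brick_shift; apply: graph_brick; exact: (good_nonempty (label_good p.1)). Qed.

Lemma F_catC p : catC (F p).
Proof. by apply: catC_shift; apply: catC_X; exact: label_good. Qed.

Local Notation decomposable := (decomposable Xlab).

Lemma dec_X A : good_set S A -> decomposable (X A).
Proof.
move=> /label_ex[i ->]; exists [:: (i, 0)]; apply: giso_trans (dsum0 _ (@zero_is_zero R)).
exact/giso_sym/shift0.
Qed.

Lemma dec_B t M : reflections S t -> decomposable M -> decomposable (tensorR (B t) M).
Proof.
move=> ht [s hs]; apply: dec_iso (giso_sym (tensor_iso _ (giso_refl _) hs)) _.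
apply: dec_iso (giso_sym (bigsum_functor _ _ (T := fun M => tensorR (B t) M) _ _)) _.
- by apply: tensor_zeror; exact: zero_is_zero.
- by move=> M' N'; exact: tensor_dsumr.
apply: dec_bigsum => p _ /=; apply: dec_iso (giso_sym (tensor_shiftr _ _ _ _)) _; apply: dec_shift.
have gA := label_good p.1; apply: dec_iso (giso_sym (BX_iso gA ht)) _.
apply: dec_dsum; apply: dec_shift.
  by apply: dec_X; left; apply: stable_cup => //; exact: good_nonempty.
have [ne|ne] := pselect (label p.1 `&` translate t (label p.1) !=set0).
  by apply: dec_X; left; exact: stable_cap.
exact: (dec_zero Xlab (X_zero ne)).
Qed.

Lemma catC_dec M : catC M <-> decomposable M.
Proof.
split=> [[s [hs [N hN]]]|[s hs]]; last first.
  by apply: catC_iso (giso_sym hs) _; apply: catC_bigsum => p _; exact: F_catC.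
have [t ht] : decomposable (Bsum rho s).
  apply: dec_bigsum => p ps /=; apply: dec_shift.
  elim: p.1 (hs p ps) => [_|r ts IH h] /=.
    by apply: dec_iso (giso_sym X_set1) _; apply: dec_X; right.
  apply: dec_B; first by apply: h; rewrite inE eqxx.
  by apply: IH => r' r'ts; apply: h; rewrite inE r'ts orbT.
have [|t' _ h] := sum_summand (F := F) (s := t) _ (giso_trans (giso_sym hN) ht).
  by move=> p _; exact: F_brick.
by exists t'.
Qed.

(** A product of linear functions [l (u - y z)], one for each [y], where [l] is nonzero
    on some vector [x v - y v]. *)
Lemma separate x (s : seq W) : x \notin s -> exists G : polyring (V * V)%type,
  (forall y v, y \in s -> pev G (rho y v, v) = 0) /\ exists v, pev G (rho x v, v) != 0.
Proof.
elim: s => [_|y s IH].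
  by exists 1; split=> //; exists 0; rewrite pev1 oner_neq0.
rewrite inE negb_or => /andP[xy /IH[G [G0 [v0 Gv0]]]].
have [v xyv] : exists v, rho x v - rho y v != 0.
  apply: contrapT => h; case/eqP: xy; apply: faith.1; apply/lfunP => v.
  by apply/eqP; rewrite -subr_eq0; apply: contraT => h'; case: h; exists v.
have [l lv] := functional_ex xyv.
pose f v := l (rho y v); have fl : scalar f by move=> c u w; rewrite /f !linearP.
pose ly : {scalar V} := HB.pack f (GRing.isLinear.Build K V K *%R f fl).
pose H := pr1 (plin l) - pr2 (plin ly).
have HE z : pev H z = l z.1 - l (rho y z.2) by [].
exists (H * G); split=> [z w|].
  rewrite inE pevM => /predU1P[->|zs]; first by rewrite HE subrr mul0r.
  by rewrite G0 // mulr0.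
apply: contrapT => none.
pose g v := (rho x v, v); have gl : linear g by move=> c u w; rewrite /g linearP.
pose gr : {linear V -> (V * V)%type} := HB.pack g (GRing.isLinear.Build K V (V * V)%type *:%R g gl).
have pf (P : polyring (V * V)%type) : polyfun (pev P \o gr) by apply: polyfun_comp; exact: polyfun_pev.
case/eqP: Gv0; apply: (polyfun_domain (pf H) (pf G)) => [w|].
  by rewrite -pevM; apply/eqP; apply: contraT => h; case: none; exists w.
exists v; rewrite -[(_ \o _) v]/(pev H (rho x v, v)) HE /= -[l _ - _]/(l (rho x v) - l (rho y v)).
by rewrite -linearB lv oner_neq0.
Qed.

Lemma ghom_unshift M N k (f : M -> N) : @ghom R (shift M k) (shift N k) f -> ghom f.
Proof.
move=> [f1 f2 f3 f4]; split=> // i x hx.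
by have := f4 (i - k) x; rewrite /= addrCA subrr addr0; apply.
Qed.

(** The bimodule R(A) determines the functions that act on it by zero, hence the
    union of graphs. *)
Lemma iso_subset A A' (f : X A -> X A') : ghom f -> injective f -> A `<=` A'.
Proof.
move=> hf fI x Ax; apply: contrapT => nx.
have [g cod] := A2_coded coxS typeS; have [e eP] := coded_finite cod.
have [|G [G0 [v]]] := @separate x [seq y <- e | y != x]; first by rewrite mem_filter eqxx.
apply/negP; rewrite negbK; apply/eqP.
suff /res_eq/(_ x Ax v) : res rho A G = res rho A 0 by [].
rewrite res0; apply: (res_iso_sub hf fI).
  rewrite -(res0 rho A'); apply/res_eq => y A'y w; rewrite G0 // mem_filter eP andbT.
  by apply/eqP => yx; apply: nx; rewrite -yx.
by apply: (ghom_deg hf); apply: res_deg; exact: gring_deg1.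
Qed.

(** R(A) lives in nonnegative degrees, and its unit is homogeneous of degree 0. *)
Lemma shift_le A A' n m : A !=set0 -> giso (shift (X A) n) (shift (X A') m) -> n <= m.
Proof.
move=> A0 /gisoP[f [g [hf hg fg gf]]].
have d : gdeg (m - n) (f (res rho A 1) : X A').
  apply: (ghom_deg hf (i := - n)) => /=; rewrite subrr; apply: res_deg; exact: gring_deg1.
rewrite -subr_ge0; apply: (graph_ge0 d) => e; apply: (res1_neq0 (rho := rho) A0).
by rewrite -(fg (res rho A 1)) e (ghom0 hg).
Qed.

Lemma F_inj p q : giso (F p) (F q) -> p = q.
Proof.
case: p q => i n [j m] h.
have ne k := good_nonempty (label_good k).
have nm : n = m.
  by apply/eqP; rewrite eq_le (shift_le (ne i) h) (shift_le (ne j) (giso_sym h)).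
move: h; rewrite nm => /gisoP[f [g [/ghom_unshift hf /ghom_unshift hg fg gf]]].
congr (_, _); apply: label_inj; apply/seteqP; split.
  exact: iso_subset hf (can_inj fg).
exact: iso_subset hg (can_inj gf).
Qed.

Lemma indecomposableP M : (catC M /\ indecomposable M) <-> exists p, giso M (F p).
Proof.
split=> [[/catC_dec[[|p s] hs] [nz ind]]|[p h]].
- by case: nz; exact: giso_is_zero (giso_sym hs) (@zero_is_zero R).
- have [z|z] := ind _ _ hs; first by case: (F_brick p).1.
  by exists p; exact: giso_trans hs (giso_sym (dsum0 _ z)).
- split; first exact: catC_iso (giso_sym h) (F_catC p).
  exact: (brick_indecomposable (brick_iso (giso_sym h) (F_brick p))).
Qed.

Lemma regular_neq0 : ~ is_zero (regular_gbimod R).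
Proof.
move=> /(_ (1 : R)) e; have /eqP := congr1 (fun f : R => pev f (0 : V)) e.
by rewrite pev1 pev0 oner_eq0.
Qed.

End Labels.
End TypeA2.

Unset Implicit Arguments.

Theorem proposition3p1 (K : realType) (W : groupType) (S : set W)
    (V : vectType K) (rho : representation W V) :
  coxeter_system S -> type_A2 S -> reflection_faithful S rho ->
  (forall M : gbimod (polyring V),
     (catC S rho M /\ indecomposable M) <->
     exists n : int,
       giso M (shift (regular_gbimod (polyring V)) n) \/
       exists2 A : set W, reflection_stable S A & giso M (shift (graph_bimod rho A) n)) /\
  ((exists (A : algType laurent) (cls : gbimod (polyring V) -> A),
      split_grothendieck (catC S rho) cls) /\
   (forall (A : algType laurent) (cls : gbimod (polyring V) -> A),
      split_grothendieck (catC S rho) cls -> free_of_rank A 20)).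
Proof.
move=> coxS typeS faith; have [g cod] := A2_coded coxS typeS.
have [L [uL sL LP]] := coded_labels cod.
have bF := F_brick rho sL LP.
have iF := F_inj coxS typeS faith uL sL LP.
have CP : catC S rho = decomposable (Xlab rho L).
  by apply/funext => M; apply/propext; exact: catC_dec.
have Ct i j : decomposable (Xlab rho L) (tensor (full_subring _) (Xlab rho L i) (Xlab rho L j)).
  by rewrite -CP; apply: catC_tensor; apply: (catC_X coxS typeS faith); exact: label_good sL LP _.
split; last split.
- move=> M; rewrite (indecomposableP coxS typeS faith sL LP M); split=> [[[i n] h]|[n h]].
    exists n; case: (label_good sL LP i) => [sA|A1]; [right|left].
      by exists (label L i).
    apply: giso_trans h _; rewrite /shifted /Xlab /= A1.
    exact: shift_iso (giso_sym (X_set1 rho)).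
  have [A gA hA] : exists2 A, good_set S A & giso M (shift (graph_bimod rho A) n).
    case: h => [h|[A sA h]]; last by exists A => //; left.
    exists [set 1%g]; first by right.
    exact: giso_trans h (shift_iso _ (X_set1 rho)).
  have [i Ai] := label_ex sL LP gA; exists (i, n).
  by rewrite /shifted /Xlab /= -Ai.
- rewrite CP; apply: (grothendieck_exists bF iF _ Ct (@regular_neq0 K V)).
  by rewrite -CP; exact: catC_regular.
- by rewrite CP => A cls; exact: (grothendieck_free bF iF).
Qed.
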